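(* Let $d\in\{2,3\}$, $M\ge1$, and consider the multi-emitter Poisson frame model described in the context, with average emitter intensity $I>0$, fixed intensity weights $\beta_1,\dots,\beta_M$, fixed point spread functions and fixed noise means $b(\boldsymbol k)$. Let $\mathbf F(I)$ be the Fisher information matrix of a single frame at the true parameter $\boldsymbol\theta_0\in\Theta$ when the average intensity is $I$. Assume that at $\boldsymbol\theta_0$ the model satisfies, at each intensity $I$: (C1) $\Theta$ is compact and $\boldsymbol\theta_0\in\operatorname{int}\Theta$ (every emitter is strictly inside the field of view and all pairwise separations strictly exceed $\delta$). (C2) There exists $v_{\min}>0$ with $v(\boldsymbol k)\ge v_{\min}$ for all $\boldsymbol k\in\Omega$ and all $\boldsymbol\theta\in\Theta$; and $v(\boldsymbol k)\in C^3(\Theta)$ as a function of $\boldsymbol\theta$ (or, more weakly, the model is differentiable in quadratic mean). (C3) The Fisher information matrix of one frame at $\boldsymbol\theta_0$ is positive definite. (C4) The third-order partial derivatives of $\ell_1(\boldsymbol\theta)$ are bounded by an integrable envelope uniformly on a neighborhood of $\boldsymbol\theta_0$. Let $I\to\infty$ with the weights $\beta_m$ fixed. Then $\mathbf F(I)\succ\mathbf 0$ with $\lambda_{\min}(\mathbf F(I))\to\infty$, equivalently $\mathbf F(I)^{-1}\to\mathbf 0$, and the single-frame global maximum-likelihood estimator $\hat{\boldsymbol\theta}^{\mathrm{GML}}\in\arg\max_{\boldsymbol\theta\in\Theta}\ell_1(\boldsymbol\theta)$, computed from one frame drawn at $\boldsymbol\theta_0$ with average intensity $I$, satisfies $$\mathbf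 F(I)^{1/2}\bigl(\hat{\boldsymbol\theta}^{\mathrm{GML}}-\boldsymbol\theta_0\bigr)\xrightarrow{d}\mathcal N(\mathbf 0,\mathbf I_{dM}),$$ i.e. $\hat{\boldsymbol\theta}^{\mathrm{GML}}\approx\mathcal N(\boldsymbol\theta_0,\mathbf F(I)^{-1})$, attaining the Cramér–Rao bound $\mathbf F(I)^{-1}$.
   Context: Pixels. $\Omega=\{0,\dots,K_x-1\}\times\{0,\dots,K_y-1\}$ is the finite pixel set; pixel $\boldsymbol k=(k_x,k_y)$ occupies $p(\boldsymbol k)=[\Delta_xk_x,\Delta_x(k_x+1)]\times[\Delta_yk_y,\Delta_y(k_y+1)]$, with $\Delta_x,\Delta_y>0$; $\Delta_t>0$ is the exposure time; $L_x=K_x\Delta_x$, $L_y=K_y\Delta_y$. Parameter space. The field of view is $\mathcal F=[0,L_x]\times[0,L_y]$ if $d=2$ and $\mathcal F=[0,L_x]\times[0,L_y]\times[-L_z,L_z]$ if $d=3$, with $L_z>0$. For $\delta>0$, $$\Theta=\Bigl\{\boldsymbol\theta=(\boldsymbol\theta_1^\top,\dots,\boldsymbol\theta_M^\top)^\top\in\mathcal F^M:\ \min_{m\ne m'}\|\boldsymbol\theta_m-\boldsymbol\theta_{m'}\|\ge\delta\Bigr\}\subset\mathbb R^{dM},$$ where $\boldsymbol\theta_m\in\mathbb R^d$ is the position of emitter $m$. Point spread functions. For each emitter $m$, $q_m(\boldsymbol u)$, $\boldsymbol u\in\mathbb R^2$, is a probability density determined by $\boldsymbol\theta_m$ (it may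 differ between emitters), and its pixel average is $q_m(\boldsymbol k)=\frac1{\Delta_x\Delta_y}\int_{p(\boldsymbol k)}q_m(\boldsymbol u)\,d\boldsymbol u$. Intensities. The known emitter intensities are $I_m=\beta_mI>0$, where $I=M^{-1}\sum_{m=1}^MI_m$ is the average emitter intensity and the weights satisfy $M^{-1}\sum_{m=1}^M\beta_m=1$. Put $Q(\boldsymbol k)=\sum_{m=1}^M\beta_mq_m(\boldsymbol k)$. Frame model. The noise means $b(\boldsymbol k)>0$ are known and do not depend on $\boldsymbol\theta$ or $I$. A frame is $V=(V(\boldsymbol k))_{\boldsymbol k\in\Omega}$ with independent entries $V(\boldsymbol k)\sim\mathrm{Poisson}(v(\boldsymbol k))$, where $v(\boldsymbol k)=\Delta_t\Delta_x\Delta_y\,I\,Q(\boldsymbol k)+b(\boldsymbol k)$ depends on $\boldsymbol\theta$ through $Q$. Log-likelihood and information. Up to a $\boldsymbol\theta$-independent constant, $\ell_1(\boldsymbol\theta)=\sum_{\boldsymbol k\in\Omega}[V(\boldsymbol k)\ln v(\boldsymbol k)-v(\boldsymbol k)]$, and the per-frame Fisher information matrix is $$\mathbf F(\boldsymbol\theta)=\sum_{\boldsymbol k\in\Omega}\frac1{v(\boldsymbol k)}\frac{\partial v(\boldsymbol k)}{\partial\boldsymbol\theta}\frac{\partial v(\boldsymbol k)}{\partial\boldsymbol\theta}^{\top}\in\mathbb R^{dM\times dM};$$ $\mathbf F(I)$ denotes $\mathbf F(\boldsymbol\theta_0)$ at average intensity $I$. Standing convention: the one-to-one correspondence between the emitter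 indices of the estimated positions and those of the true positions is known (so estimates are not ambiguous up to relabeling of the emitters). Notation: $\lambda_{\min}$ is the smallest eigenvalue; $\mathbf I_{dM}$ is the identity matrix; $\xrightarrow{d}$ is convergence in distribution under $\boldsymbol\theta_0$; $\succ\mathbf 0$ means positive definite.
   Formalization: Adds that any θ in Θ with the same noiseless image as θ0 is a relabeling of θ0 that no frame can detect, the estimate being its relabeling nearest θ0; and in (C4) that one neighborhood serves all I and the envelope's mean is at most C·I for large I. *)

(* Defs.v *)
From HB Require Import structures.
From mathcomp Require Import all_boot all_order all_algebra all_fingroup.
From mathcomp Require Import all_classical all_reals all_analysis.

Set Implicit Arguments.
Unset Strict Implicit.
Unset Printing Implicit Defensive.

Import Order.TTheory GRing.Theory Num.Theory.
Import numFieldNormedType.Exports.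

Local Open Scope classical_set_scope.
Local Open Scope ring_scope.

Section linear_algebra.
Context {R : realType} {n : nat}.
Implicit Types (A S : 'M[R]_n) (x : 'rV[R]_n).

(* The library norm on matrices is the sup norm. *)
Definition enorm x : R := Num.sqrt (\sum_j x 0 j ^+ 2).

Definition posdefmx A : Prop :=
  A^T = A /\ forall x, x != 0 -> 0 < (x *m A *m x^T) 0 0.

Definition possemidefmx A : Prop :=
  A^T = A /\ forall x, 0 <= (x *m A *m x^T) 0 0.

(* The positive semidefinite square root, 0 when there is none. *)
Definition sqrtmx A : 'M[R]_n :=
  xget 0 [set S : 'M[R]_n | possemidefmx S /\ S *m S = A].

Definition lambda_min A : R := inf [set a : R | eigenvalue A a].

End linear_algebra.

Section calculus.
Context {R : realType} {n : nat}.
Implicit Types (f : 'rV[R]_n -> R) (U D : set 'rV[R]_n).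

Definition basis_vec (i : 'I_n) : 'rV[R]_n := delta_mx 0 i.

Definition partial (i : 'I_n) f : 'rV[R]_n -> R :=
  fun x => 'D_(basis_vec i) f x.

Definition grad f (x : 'rV[R]_n) : 'rV[R]_n := \row_i partial i f x.

Fixpoint Ck_on_open (k : nat) U f : Prop :=
  (forall x, U x -> {for x, continuous f}) /\
  match k with
  | 0 => True
  | k'.+1 => forall i, (forall x, U x -> derivable f x (basis_vec i)) /\
                       Ck_on_open k' U (partial i f)
  end.

(* C^k on an arbitrary set: restriction of a C^k function on an open
   neighbourhood of the set. *)
Definition Ck_on (k : nat) D f : Prop :=
  exists (U : set 'rV[R]_n) (g : 'rV[R]_n -> R),
    [/\ open U, D `<=` U, Ck_on_open k U g & {in D, g =1 f}].

(* 'D is total, so the existence of the derivatives is part of the bound. *)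
Definition third_partials_bounded U f (c : R) : Prop :=
  forall x, U x -> forall i j l : 'I_n,
    [/\ derivable f x (basis_vec l),
        derivable (partial l f) x (basis_vec j),
        derivable (partial j (partial l f)) x (basis_vec i) &
        `|partial i (partial j (partial l f)) x| <= c].

End calculus.

Section probability.
Context {R : realType}.

Definition mutually_independent d (T : measurableType d) (P : probability T R)
    (K : finType) d' (S : measurableType d') (X : K -> {RV P >-> S}) : Prop :=
  forall A : K -> set S, (forall k, measurable (A k)) ->
    P (\bigcap_k (X k @^-1` A k)) = (\prod_k fine (P (X k @^-1` A k)))%:E.

(* Distribution function of N(0, I_n), the law with independent N(0, 1)
   components. *)
Definition std_normal_cdf (n : nat) (x : 'rV[R]_n) : R :=
  \prod_i fine (normal_prob 0 1 `]-oo, x 0 i]).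

(* Convergence in distribution, as I -> +oo, of random vectors X I living on
   the probability spaces (T I, P I), towards the law whose joint distribution
   function is G. *)
Definition cvg_in_distribution (n : nat) d (T : R -> measurableType d)
    (P : forall I, probability (T I) R) (X : forall I, T I -> 'rV[R]_n)
    (G : 'rV[R]_n -> R) : Prop :=
  forall x, {for x, continuous G} ->
    P I [set t | forall i, X I t 0 i <= x 0 i] @[I --> +oo] --> (G x)%:E.

End probability.

(* d : dimension of a position, M : number of emitters,
   Kx * Ky : number of pixels. *)
Record imaging (R : realType) (d M Kx Ky : nat) := Imaging {
  dx : R;
  dy : R;
  dt : R;
  Lz : R;     (* unused when d = 2 *)
  sep : R;
  weight : 'I_M -> R;
  psf : 'I_M -> 'rV[R]_d -> R * R -> R;     (* psf m theta_m is the density q_m *)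
  noise : 'I_Kx * 'I_Ky -> R }.

Section frame_model.
Context {R : realType} {d M Kx Ky : nat}.
Variable S : imaging R d M Kx Ky.

Local Notation pixel := ('I_Kx * 'I_Ky)%type.
(* (theta_1^T, ..., theta_M^T)^T, as a row vector *)
Local Notation param := 'rV[R]_(M * d).
Local Notation frame := {ffun pixel -> nat}.

Definition position (m : 'I_M) (theta : param) : 'rV[R]_d :=
  row m (vec_mx theta).

Definition field_of_view : set 'rV[R]_d :=
  [set x : 'rV[R]_d | forall i : 'I_d,
    match val i with
    | 0 => 0 <= x 0 i <= Kx%:R * dx S
    | 1 => 0 <= x 0 i <= Ky%:R * dy S
    | _ => - Lz S <= x 0 i <= Lz S
    end].

Definition Theta : set param :=
  [set theta : param | (forall m, field_of_view (position m theta)) /\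
    forall m m', m != m' ->
      sep S <= enorm (position m theta - position m' theta)].

Definition plane_measure :=
  (@lebesgue_measure R \x @lebesgue_measure R)%E.

Definition is_density (q : R * R -> R) : Prop :=
  [/\ measurable_fun setT q, (forall u, 0 <= q u) &
      (\int[plane_measure]_u (q u)%:E = 1)%E].

Record imaging_axioms : Prop := {
  dx_gt0 : 0 < dx S;
  dy_gt0 : 0 < dy S;
  dt_gt0 : 0 < dt S;
  Lz_gt0 : 0 < Lz S;
  sep_gt0 : 0 < sep S;
  weight_gt0 : forall m, 0 < weight S m;
  weight_mean : M%:R^-1 * (\sum_m weight S m) = 1;
  psf_density : forall m x, field_of_view x -> is_density (psf S m x);
  noise_gt0 : forall k, 0 < noise S k }.

Definition pixel_area (k : pixel) : set (R * R) :=
  `[dx S * k.1%:R, dx S * k.1.+1%:R] `*` `[dy S * k.2%:R, dy S * k.2.+1%:R].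

Definition pixel_psf (m : 'I_M) (k : pixel) (theta : param) : R :=
  (dx S * dy S)^-1 *
  Rintegral plane_measure (pixel_area k) (psf S m (position m theta)).

Definition Q (k : pixel) (theta : param) : R :=
  \sum_m weight S m * pixel_psf m k theta.

Definition rate (I : R) (k : pixel) (theta : param) : R :=
  dt S * dx S * dy S * I * Q k theta + noise S k.

Definition loglik (I : R) (w : frame) (theta : param) : R :=
  \sum_k ((w k)%:R * ln (rate I k theta) - rate I k theta).

Definition fisher (theta : param) (I : R) : 'M[R]_(M * d) :=
  \sum_k (rate I k theta)^-1 *:
    ((grad (rate I k) theta)^T *m grad (rate I k) theta).

Definition frame_pmf (I : R) (theta : param) (w : frame) : R :=
  \prod_k poisson_pmf (rate I k theta) (w k).

(* Differentiability in quadratic mean, at every point of Theta and relative to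
   Theta; frames are countable, so the dominating measure is counting. *)
Definition diff_quadratic_mean (I : R) : Prop :=
  forall theta, Theta theta -> exists score : frame -> param,
  forall e : R, 0 < e -> \forall theta' \near theta, Theta theta' ->
    (\esum_(w in [set: frame])
       ((Num.sqrt (frame_pmf I theta' w) - Num.sqrt (frame_pmf I theta w)
         - 2^-1 * ((theta' - theta) *m (score w)^T) 0 0
             * Num.sqrt (frame_pmf I theta w)) ^+ 2)%:E
     <= (e * enorm (theta' - theta) ^+ 2)%:E)%E.

Definition relabel (s : {perm 'I_M}) (theta : param) : param :=
  mxvec (row_perm s (vec_mx theta)).

(* Relabelings of the emitters that no frame can detect. *)
Definition undetectable (s : {perm 'I_M}) : Prop :=
  forall k theta, Theta theta -> Q k (relabel s theta) = Q k theta.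

(* Undetectable relabelings are the only obstruction to identifying theta0
   from the noiseless image. *)
Definition identifiable_up_to_relabeling (theta0 : param) : Prop :=
  forall theta, Theta theta -> (forall k, Q k theta = Q k theta0) ->
    exists2 s, undetectable s & theta = relabel s theta0.

Definition is_gml (I : R) (w : frame) (theta : param) : Prop :=
  Theta theta /\ forall theta', Theta theta' -> loglik I w theta' <= loglik I w theta.

(* The set of maximizers is stable under undetectable relabelings; knowing the
   correspondence with the true emitters means picking, among the relabelings
   of a maximizer, one that is closest to theta0. *)
Definition correctly_labeled (theta0 theta : param) : Prop :=
  forall s, undetectable s ->
    enorm (theta - theta0) <= enorm (relabel s theta - theta0).

Definition observed_frame (T : Type) (V : pixel -> T -> nat) (t : T) : frame :=
  [ffun k => V k t].

End frame_model.

(* Main.v *)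
Require Import Defs.
From HB Require Import structures.
From mathcomp Require Import all_boot all_order all_algebra all_fingroup.
From mathcomp Require Import all_classical all_reals all_analysis.
From mathcomp Require Import measurable_realfun ring lra.
From mathcomp Require complex.

Set Implicit Arguments.
Unset Strict Implicit.
Unset Printing Implicit Defensive.

Import Order.TTheory GRing.Theory Num.Theory.
Import numFieldNormedType.Exports.

Local Open Scope classical_set_scope.
Local Open Scope ring_scope.

(** The rate of a pixel is [I * q k theta + b k], where the signal [q k] is
nonnegative on the parameter space. Since [(I * q + b) <= I * (q + b)] for
[I >= 1], the information matrices satisfy [F(I) >= I * F(1)] as quadratic
forms ([info_coercive]), and [F(1)] is positive definite: eigenvalues tend to
infinity and the inverse tends to [0].

For the estimator, write [a k = (w k - v k) / sqrt (v k)] for the standardized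
counts at the true parameter [x0]. By Chebyshev they are all bounded by a
constant [A] outside a set of small probability, uniformly in [I]
([box_mean_tail]), and on that event the argument is deterministic.

- Comparing the likelihood of the maximizer [x] with that of [x0] bounds
  [sqrt (v k (x)) - sqrt (v k (x0))] ([sqrt_rate_close]), so the signals at [x]
  and [x0] differ by [O(1 / sqrt I)]. Compactness and identifiability up to
  undetectable relabelings give consistency ([uniformly_identifiable]); the
  gradients of the signals at [x0] separate points because [F(1)] is definite,
  so [x - x0 = O(1 / sqrt I)] ([maximizer_close]).
- The likelihood equation at [x] can then be linearized: the score at [x0]
  minus [(x - x0) F(I)] is [o(sqrt I)] ([linearized_score]). A pixel with
  [q k x0 > 0] is bright and Taylor expansion suffices. At a dark pixel,
  [q k x0 = 0], the rate does not grow with [I] and the exact derivatives at [x]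
  enter with a weight [I]; what saves the argument is that [x0] is a minimum of
  [q k] and that the envelope of the third derivatives grows at most linearly in
  [I], which forces the pure second derivatives of [q k] to vanish at [x0]
  ([zero_pixel_flat]), hence a small gradient near [x0] ([nonneg_gradient_le]).
- Multiplying by [F(I)^(-1/2)], the normalized error [(x - x0) F(I)^(1/2)] is
  within [o(1)] of [sum_k a k * O k], where the vectors [O k] form a matrix with
  orthonormal columns and vanish at dark pixels ([whitened_orth],
  [estimator_score]).

The sum [sum_k a k * O k] combines finitely many independent Poisson variables,
and those with a nonzero coefficient have means that tend to infinity, so its
characteristic function has an explicit form which converges to the Gaussian one ([mean_cvg_cos]). Monotone
steps are approximated on bounded intervals by trigonometric polynomials
([trig_step]), and this turns the convergence of characteristic functions into
the convergence of joint distribution functions ([score_clt]).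

All Poisson expectations are limits of finite sums over boxes of frames
([box_mean]); probabilities enter through [box_mean_event] and
[box_mean_le_integral].

The regularity needed near [x0] comes from the third-derivative envelope alone:
the logarithm of the rate of a pixel is the difference of the log-likelihoods of
two frames that differ by one count in that pixel ([loglik_one_more]). At a dark
pixel one needs two such frames at which the envelope is at most a multiple of
[I]; they exist because the mean of the envelope is ([adjacent_frames]). *)

(** * Spectral theory of real symmetric matrices *)

Section spectral.
Context {R : realType}.
Import complex.
Local Notation C := (complex R).
Local Notation toC := (real_complex R).

(** A polynomial in a symmetric matrix is again symmetric, so a square root that is a
polynomial of the matrix is real as soon as the polynomial is; interpolation
provides it. *)
Lemma interpolation_exists (s : seq R) (f : R -> R) : uniq s ->
  exists p : {poly R}, forall x, x \in s -> p.[x] = f x.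
Proof.
elim: s => [|a s IH] /=; first by exists 0.
move=> /andP[as_ us]; have [p Hp] := IH us.
pose w : {poly R} := \prod_(y <- s) ('X - y%:P).
have wa : w.[a] != 0.
  by rewrite -[_ == 0]/(root w a) root_prod_XsubC.
exists (p + ((f a - p.[a]) / w.[a]) *: w) => x.
rewrite inE hornerD hornerZ => /orP[/eqP->|xs].
  by rewrite divfK// addrC subrK.
have /rootP -> : root w x by rewrite root_prod_XsubC.
by rewrite mulr0 addr0 Hp.
Qed.

(** The spectral theorem is applied over the complex numbers: a real symmetric matrix is
Hermitian, its eigenvalues are real, but the diagonalizing basis is complex.
Only the eigenvalues are brought back to the reals. *)
Lemma symmetric_spectral n (A : 'M[R]_n) : A^T = A ->
  exists (P : 'M[C]_n) (D : 'rV[R]_n), P \in unitmx /\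
    map_mx toC A = invmx P *m diag_mx (map_mx toC D) *m P.
Proof.
move=> As; set B := map_mx toC A.
have Bsym : B \is symmetricmx.
  apply/is_hermitianmxP; rewrite expr0 scale1r; apply/matrixP => i j.
  by rewrite !mxE -{1}As mxE.
have Breal : B \is a mxOver Num.real.
  by apply/mxOverP => i j; rewrite mxE; apply/complex_realP; exists (A i j).
have Bherm := realsym_hermsym Bsym Breal.
have /hermitian_normalmx/orthomx_spectralP Beq := Bherm.
have Dreal := hermitian_spectral_diag_real Bherm.
exists (spectralmx B), (map_mx (@complex.Re R) (spectral_diag B)).
split; first exact: spectral_unit.
rewrite {1}Beq; congr (_ *m diag_mx _ *m _).
apply/matrixP => i j; rewrite !mxE.
by have /mxOverP/(_ i j)/RRe_real := Dreal.
Qed.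

(** Being an eigenvalue is invariant under the extension of scalars, so the complex
eigenvector suffices. *)
Lemma spectral_eigenvalue n (A : 'M[R]_n) (P : 'M[C]_n) (D : 'rV[R]_n) j :
  P \in unitmx -> map_mx toC A = invmx P *m diag_mx (map_mx toC D) *m P ->
  eigenvalue A (D 0 j).
Proof.
move=> Pu AE; rewrite -(eigenvalue_map toC); apply/eigenvalueP.
exists (row j P); last first.
  apply: contraTneq Pu => P0; rewrite -row_free_unit.
  by apply/row_freePn; exists j; rewrite P0 sub0mx.
have -> : row j P = 'e_j *m P by rewrite -rowE.
rewrite AE -!mulmxA (mulmxA P) mulmxV// mul1mx mulmxA scalemxAl.
congr (_ *m _); apply/rowP => k; rewrite mul_mx_diag !mxE mulrC.
by have [->//|_] := eqVneq k j; rewrite andbF !mulr0.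
Qed.

Lemma symmetric_eigenvalue n (A : 'M[R]_n) : (0 < n)%N -> A^T = A ->
  exists a, eigenvalue A a.
Proof.
case: n A => // n A _ /symmetric_spectral[P [D [Pu AE]]].
by exists (D 0 0); apply: spectral_eigenvalue AE.
Qed.

Lemma trmx_horner n (A : 'M[R]_n.+1) p : A^T = A ->
  (horner_mx A p)^T = horner_mx A p.
Proof.
move=> As; elim/poly_ind: p => [|p c IH]; first by rewrite rmorph0 trmx0.
rewrite rmorphD rmorphM/= horner_mx_C horner_mx_X linearD/= tr_scalar_mx.
rewrite trmx_mul IH As; congr (_ + _).
exact: (comm_mx_horner p (erefl : comm_mx A A)).
Qed.

Lemma row_sqr n (x : 'rV[R]_n) : (x *m x^T) 0 0 = \sum_j x 0 j ^+ 2.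
Proof. by rewrite mxE; apply: eq_bigr => j _; rewrite mxE expr2. Qed.

Lemma row_sqr_ge0 n (x : 'rV[R]_n) : 0 <= (x *m x^T) 0 0.
Proof. by rewrite row_sqr sumr_ge0// => j _; rewrite sqr_ge0. Qed.

Lemma row_sqr_gt0 n (x : 'rV[R]_n) : x != 0 -> 0 < (x *m x^T) 0 0.
Proof.
move=> x0; rewrite lt0r row_sqr_ge0 andbT; apply: contra x0.
rewrite row_sqr psumr_eq0; last by move=> j _; rewrite sqr_ge0.
by move=> /allP x0; apply/eqP/rowP => j; rewrite mxE;
  have /= := x0 j (mem_index_enum _); rewrite sqrf_eq0 => /eqP.
Qed.

Lemma eigenvalue_rayleigh n (A : 'M[R]_n) (k a : R) :
  (forall x : 'rV[R]_n, k * (x *m x^T) 0 0 <= (x *m A *m x^T) 0 0) ->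
  eigenvalue A a -> k <= a.
Proof.
move=> kA /eigenvalueP[x xA x0]; have := kA x.
by rewrite xA -scalemxAl [leRHS]mxE ler_pM2r// row_sqr_gt0.
Qed.

Lemma posdefmx_eigenvalue_gt0 n (A : 'M[R]_n) a :
  posdefmx A -> eigenvalue A a -> 0 < a.
Proof.
move=> [_ Apos] /eigenvalueP[x xA x0]; have := Apos x x0.
by rewrite xA -scalemxAl mxE pmulr_lgt0// row_sqr_gt0.
Qed.

(** Take a real polynomial [p] with [p a = a^(1/4)] at every eigenvalue [a]. Then
[T = p(A)] is real and symmetric with [T^4 = A], and [T^2] is a square root of [A]
that is semidefinite because it is the square of a symmetric matrix. *)
Lemma sqrtmx_exists n (A : 'M[R]_n) : posdefmx A ->
  exists S : 'M[R]_n, possemidefmx S /\ S *m S = A.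
Proof.
case: n A => [|n] A Apd.
  exists 0; split; last by apply/matrixP => -[].
  by split => [|x]; rewrite ?trmx0// mulmx0 mul0mx mxE.
have [As _] := Apd.
have [P [D [Pu AE]]] := symmetric_spectral As.
have D_gt0 j : 0 < D 0 j.
  by apply: posdefmx_eigenvalue_gt0 Apd _; exact: spectral_eigenvalue AE.
have [p pE] := interpolation_exists (fun t => Num.sqrt (Num.sqrt t))
  (undup_uniq [seq D 0 j | j <- enum 'I_n.+1]).
pose T := horner_mx A p.
have T4 : T ^+ 4 = A.
  rewrite -rmorphXn; apply/eqP; rewrite -subr_eq0 -{2}(horner_mx_X A) -rmorphB.
  rewrite -(map_mx_eq0 toC); apply/eqP.
  rewrite map_horner_mx AE.
  have -> q : horner_mx (invmx P *m diag_mx (map_mx toC D) *m P) q =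
      invmx P *m horner_mx (diag_mx (map_mx toC D)) q *m P.
    by rewrite horner_mx_uconjC.
  rewrite horner_mx_diag.
  suff -> : map_mx (horner (map_poly toC (p ^+ 4 - 'X))) (map_mx toC D) = 0.
    by rewrite linear0 mulmx0 mul0mx.
  apply/matrixP => i j; rewrite !mxE ord1 horner_map hornerD hornerN hornerX.
  rewrite horner_exp pE; last first.
    by rewrite mem_undup; apply/mapP; exists j; rewrite ?mem_enum.
  by rewrite (exprM _ 2 2) !sqr_sqrtr ?sqrtr_ge0 ?ltW// subrr rmorph0.
have Ts : T^T = T by exact: trmx_horner.
exists (T *m T); split; last first.
  by rewrite -[RHS]T4 /exprz !exprS expr0 mulr1 -!mulmxE !mulmxA.
split => [|x]; first by rewrite trmx_mul Ts.
by rewrite mulmxA -[_ *m T *m _]mulmxA -{2}Ts -trmx_mul row_sqr_ge0.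
Qed.

Lemma sqrtmxP n (A : 'M[R]_n) : posdefmx A ->
  possemidefmx (sqrtmx A) /\ sqrtmx A *m sqrtmx A = A.
Proof.
move=> /sqrtmx_exists[S HS]; rewrite /sqrtmx.
exact: (@xgetPex _ 0 [set S : 'M[R]_n | possemidefmx S /\ S *m S = A]
  (ex_intro _ S HS)).
Qed.

Lemma posdefmx_unit n (A : 'M[R]_n) : posdefmx A -> A \in unitmx.
Proof.
move=> [_ Apos]; rewrite -row_free_unit -kermx_eq0; apply/eqP/row_matrixP => i.
rewrite row0; apply/eqP/negPn/negP => /Apos.
by rewrite -row_mul mulmx_ker row0 mul0mx mxE ltxx.
Qed.
End spectral.

(** * Calculus of one real variable *)

Section real_calculus.
Context {R : realType}.
Implicit Types (f g : R -> R) (x a b : R).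

Lemma is_derive1D f g x a b : is_derive x 1 f a -> is_derive x 1 g b ->
  is_derive x 1 (fun t => f t + g t) (a + b).
Proof. by move=> df dg; exact: is_deriveD. Qed.

Lemma is_derive1M f g x a b : is_derive x 1 f a -> is_derive x 1 g b ->
  is_derive x 1 (fun t => f t * g t) (f x * b + g x * a).
Proof. by move=> df dg; exact: is_deriveM. Qed.

Lemma is_derive1Z f x a b : is_derive x 1 f a ->
  is_derive x 1 (fun t => b * f t) (b * a).
Proof. by move=> df; exact: is_deriveZ. Qed.

Lemma is_derive1_affine x a b : is_derive x 1 (fun t => b + a * t) a.
Proof.
have := is_derive1D (is_derive_cst b x 1) (is_derive1Z a (is_derive_id x 1)).
by rewrite add0r mulr1.
Qed.

Lemma is_derive1_ext f g x a b : is_derive x 1 f a ->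
  f =1 g -> a = b -> is_derive x 1 g b.
Proof. by move=> + /funext <- <-. Qed.

Lemma is_derive1_compose f g x a b : is_derive (g x) 1 f a ->
  is_derive x 1 g b -> is_derive x 1 (fun t => f (g t)) (a * b).
Proof. by move=> df dg; exact: is_derive1_comp. Qed.

Lemma mean_value_le f (df : R -> R) (a b B : R) : a <= b ->
  (forall t, a <= t <= b -> is_derive t 1 f (df t)) ->
  (forall t, a <= t <= b -> `|df t| <= B) ->
  `|f b - f a| <= B * (b - a).
Proof.
move=> ab dfE dfB.
have [||c] := @MVT_segment R f df a b ab.
- by move=> t; rewrite in_itv/= => /andP[at_ tb]; apply: dfE; rewrite !ltW.
- by apply: derivable_within_continuous => t; rewrite in_itv/= => /dfE[].
rewrite in_itv/= => cab ->; rewrite normrM (ger0_norm (_ : 0 <= b - a)) ?subr_ge0//.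
by rewrite ler_wpM2r ?subr_ge0// dfB.
Qed.

(** A version centred at [0] with no sign condition on [t], which is what directional
Taylor expansions need. *)
Lemma mean_value_le_norm f (df : R -> R) (r t B : R) : `|t| <= r ->
  (forall s : R, `|s| <= r -> is_derive s 1 f (df s)) ->
  (forall s : R, `|s| <= `|t| -> `|df s| <= B) ->
  `|f t - f 0| <= B * `|t|.
Proof.
move=> tr dfE dfB; have [t0|t0] := leP 0 t.
  have t0' := ger0_norm t0; rewrite t0' in tr dfB *.
  rewrite -[t in leRHS]subr0; apply: mean_value_le => // s /andP[s0 st].
    by apply: dfE; rewrite ger0_norm// (le_trans st).
  by apply: dfB; rewrite ger0_norm.
have t0' := ltr0_norm t0; rewrite t0' in tr dfB *.
rewrite distrC -[- t]add0r; apply: mean_value_le (ltW t0) _ _ => s /andP[ts s0].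
  by apply: dfE; rewrite ler0_norm// (le_trans _ tr)// lerN2.
by apply: dfB; rewrite ler0_norm// lerN2.
Qed.
Lemma taylor2_le f (f1 f2 : R -> R) (r t S : R) : `|t| <= r ->
  (forall s : R, `|s| <= r -> is_derive s 1 f (f1 s)) ->
  (forall s : R, `|s| <= r -> is_derive s 1 f1 (f2 s)) ->
  (forall s : R, `|s| <= `|t| -> `|f2 s| <= S) ->
  `|f t - f 0 - t * f1 0| <= S * `|t| ^+ 2.
Proof.
move=> tr df df1 f2S.
have S0 : 0 <= S by apply: le_trans (f2S 0 _); rewrite ?normr0.
rewrite (_ : f t - f 0 - _ =
  (f t + (0 + - f1 0 * t)) - (f 0 + (0 + - f1 0 * 0))); last by ring.
rewrite expr2 mulrA.
apply: (@mean_value_le_norm (fun s => f s + (0 + - f1 0 * s))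
  (fun s => f1 s + - f1 0) r t (S * `|t|) tr) => s sr.
  by apply: is_derive1D; [exact: df|exact: is_derive1_affine].
have sr' : `|s| <= r by exact: le_trans tr.
apply: (@le_trans _ _ (S * `|s|)); last by rewrite ler_wpM2l.
by apply: (mean_value_le_norm sr' df1) => u us; apply: f2S; exact: le_trans sr.
Qed.

Lemma taylor3_le f (f1 f2 f3 : R -> R) (r t S : R) : `|t| <= r ->
  (forall s : R, `|s| <= r -> is_derive s 1 f (f1 s)) ->
  (forall s : R, `|s| <= r -> is_derive s 1 f1 (f2 s)) ->
  (forall s : R, `|s| <= r -> is_derive s 1 f2 (f3 s)) ->
  (forall s : R, `|s| <= r -> `|f3 s| <= S) ->
  `|f t - f 0 - t * f1 0 - 2^-1 * t ^+ 2 * f2 0| <= S * `|t| ^+ 3.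
Proof.
move=> tr df df1 df2 f3S.
have r0 : 0 <= r by exact: le_trans tr.
have S0 : 0 <= S by apply: le_trans (f3S 0 _); rewrite ?normr0.
pose F s := f s + ((0 + - f1 0 * s) + (- 2^-1 * f2 0) * (s * s)).
rewrite (_ : f t - f 0 - _ - _ = F t - F 0); last by rewrite /F; ring.
rewrite [_ ^+ 3]exprSr mulrA.
apply: (@mean_value_le_norm F
  (fun s => f1 s + (- f1 0 + (- 2^-1 * f2 0) * (s * 1 + s * 1)))
  r t (S * `|t| ^+ 2) tr) => s sr.
  apply: is_derive1D; first exact: df.
  apply: is_derive1D; first exact: is_derive1_affine.
have sr' : `|s| <= r by exact: le_trans tr.
rewrite (_ : f1 s + _ = f1 s - f1 0 - s * f2 0); last by field.
apply: (le_trans (taylor2_le sr' df1 df2 (S := S) _)).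
  by move=> u us; apply: f3S; exact: le_trans sr'.
by rewrite ler_wpM2l// lerXn2r ?nnegrE.
Qed.

Lemma cvg_sum_fin (K : finType) (T : Type) (F : set_system T) (f : K -> T -> R)
    (l : K -> R) : Filter F -> (forall k, f k x @[x --> F] --> l k) ->
  \sum_k f k x @[x --> F] --> \sum_k l k.
Proof.
move=> FF fl; elim: (index_enum K) => [|k r IH].
  by rewrite big_nil; under eq_cvg do rewrite big_nil; exact: cvg_cst.
by rewrite big_cons; under eq_cvg do rewrite big_cons; exact: cvgD.
Qed.
End real_calculus.

(** * Poisson sums over boxes of frames *)

Section poisson_characteristic.
Context {R : realType}.
Implicit Types (s p v t : R) (N n : nat).

Let term s p n t :=
  expR (- t * cos s) * (t ^+ n / n`!%:R * cos (n%:R * s + p - t * sin s)).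
Let tail s p n t :=
  expR (- t * cos s) * (t ^+ n / n`!%:R * cos (n.+1%:R * s + p - t * sin s)).

(** The derivative of the partial sums of the Poisson characteristic function telescopes
once each term is multiplied by [exp (- t * cos s)] and its phase is shifted by
[- t * sin s], that is, once the expected limit is divided out. *)
Lemma is_derive_term s p n t :
  is_derive t 1 (term s p n)
    ((if n is n'.+1 then tail s p n' t else 0) - tail s p n t).
Proof.
have de : is_derive t 1 (fun t => expR (- t * cos s)) (- cos s * expR (- t * cos s)).
  apply: (is_derive1_ext (is_derive1_compose (is_derive_expR _)
    (is_derive1_affine t (- cos s) 0))) => [u|]; first by congr expR; ring.
  by rewrite mulrC; congr (_ * expR _); ring.
have dc : is_derive t 1 (fun t => cos (n%:R * s + p - t * sin s))
    (sin s * sin (n%:R * s + p - t * sin s)).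
  apply: (is_derive1_ext (is_derive1_compose (is_derive_cos _)
    (is_derive1_affine t (- sin s) (n%:R * s + p)))) => [u|].
    by congr cos; ring.
  by rewrite mulrNN mulrC; congr (_ * sin _); ring.
have dX : is_derive t 1 (fun t => t ^+ n / n`!%:R)
   (if n is n'.+1 then t ^+ n' / n'`!%:R else 0).
  apply: (is_derive1_ext (is_derive1Z n`!%:R^-1 (is_deriveX n (is_derive_id t 1)))).
    by move=> u; rewrite mulrC exprfctE.
  case: n {dc} => [|n]; first by rewrite mul0r scale0r mulr0.
  rewrite /GRing.scale/= mulr1 factS natrM invfM -!mulrA mulrCA.
  by rewrite mulKf// mulrC.
apply: (is_derive1_ext (is_derive1M de (is_derive1M dX dc))) => //.
rewrite /tail (_ : cos (n.+1%:R * s + p - t * sin s) =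
   cos (n%:R * s + p - t * sin s) * cos s - sin (n%:R * s + p - t * sin s) * sin s);
  last by rewrite -cosD; congr cos; ring.
case: n {dc dX} => [|n] /=; rewrite ?invr1; ring.
Qed.

Lemma is_derive_partial_sum s p N t :
  is_derive t 1 (fun t => \sum_(n < N.+1) term s p n t) (- tail s p N t).
Proof.
elim: N => [|N IH].
  apply: (is_derive1_ext (is_derive_term s p 0 t)) => [u|]; rewrite ?big_ord1//.
  by rewrite sub0r.
apply: (is_derive1_ext (is_derive1D IH (is_derive_term s p N.+1 t))) => [u|].
  by rewrite [RHS]big_ord_recr.
by rewrite /= addKr.
Qed.

Lemma partial_sum0 s p N : \sum_(n < N.+1) term s p n 0 = cos p.
Proof.
rewrite big_ord_recl big1 => [|i _]; rewrite /term /=.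
  by rewrite oppr0 mul0r expR0 expr0 fact0 invr1 !mul1r !mul0r add0r subr0 addr0.
by rewrite expr0n /= !mul0r mulr0.
Qed.

(** At [t = 0] only the term [n = 0] survives and the sum is [cos p]; the mean value
inequality bounds the drift up to [t = v] by the last term of the exponential
series. *)
Lemma partial_sum_approx s p N v : 0 <= v ->
  `|\sum_(n < N.+1) term s p n v - cos p| <= expR v * v * exp_coeff v N.
Proof.
move=> v0; rewrite -(partial_sum0 s p N).
rewrite mulrAC -[X in _ <= _ * X]subr0.
apply: (@mean_value_le _ (fun t => \sum_(n < N.+1) term s p n t)
  (fun t => - tail s p N t)) => // t /andP[t0 tv].
  exact: is_derive_partial_sum.
rewrite normrN /tail !normrM ger0_norm ?expR_ge0// (ger0_norm (_ : 0 <= _^-1))//.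
rewrite ger0_norm ?exprn_ge0// /exp_coeff.
apply: ler_pM; rewrite ?expR_ge0// ?mulr_ge0 ?exprn_ge0//.
  by rewrite ler_expR; apply: le_trans tv; rewrite mulNr -mulrN ler_piMr// lerNl cos_geN1.
rewrite -[leRHS]mulr1; apply: ler_pM; rewrite ?mulr_ge0 ?exprn_ge0//.
  by rewrite ler_wpM2r// lerXn2r.
by rewrite ler_norml cos_geN1 cos_le1.
Qed.

(** The real part, with an arbitrary phase [p], of the identity
[E exp (i (s X + p)) = exp (v (exp (i s) - 1) + i p)]. *)
Lemma poisson_characteristic s p v : 0 < v ->
  \sum_(n < N) poisson_pmf v n * cos (n%:R * s + p) @[N --> \oo] -->
  expR (v * (cos s - 1)) * cos (p + v * sin s).
Proof.
move=> v0; rewrite -cvg_shiftS.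
set q := p + v * sin s.
have E N : \sum_(n < N.+1) poisson_pmf v n * cos (n%:R * s + p) =
    expR (v * (cos s - 1)) * \sum_(n < N.+1) term s q n v.
  rewrite mulr_sumr; apply: eq_bigr => n _.
  rewrite /term /poisson_pmf v0 mulrA -expRD.
  rewrite (_ : _ + - v * cos s = - v); last by ring.
  rewrite (_ : n%:R * s + q - v * sin s = n%:R * s + p); last by rewrite /q; ring.
  by ring.
under eq_fun do rewrite E.
apply: cvgMl_tmp; apply/cvgrPdist_le => e e0.
have c0 : expR v * v * exp_coeff v N @[N --> \oo] --> 0.
  rewrite -(mulr0 (expR v * v)); apply: cvgMl_tmp.
  exact: cvg_series_cvg_0 (is_cvg_series_exp_coeff v).
move/cvgr0Pnorm_le : c0 => /(_ _ e0); apply: filterS => N HN.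
rewrite distrC; apply: le_trans (partial_sum_approx s q N (ltW v0)) _.
by rewrite (le_trans _ HN)// ler_norm.
Qed.
End poisson_characteristic.

Section poisson_box.
Context {R : realType} {K : finType}.
Implicit Types (v s : K -> R) (N : nat).

Lemma poisson_pmfS (r : R) n : 0 < r ->
  r * poisson_pmf r n = n.+1%:R * poisson_pmf r n.+1.
Proof.
move=> r0; rewrite /poisson_pmf r0 factS natrM invfM exprS.
have n0 : n.+1%:R != 0 :> R by rewrite pnatr_eq0.
move: n.+1%:R n0 (n`!%:R^-1) => c c0 d.
by rewrite -[LHS]mul1r -(divff c0); ring.
Qed.

(** The truncated variance has a closed form, proved by induction on [N]; the
boundary term is nonpositive as soon as [N] exceeds the mean, which gives the
variance bound without passing to the limit. *)
Lemma poisson_variance_sum (r : R) N : 0 < r ->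
  \sum_(n < N.+1) poisson_pmf r n * (n%:R - r) ^+ 2 =
  r * \sum_(n < N) poisson_pmf r n + r * poisson_pmf r N * (r - N%:R).
Proof.
move=> r0; elim: N => [|N IH].
  by rewrite big_ord1 big_ord0 /=; ring.
rewrite big_ord_recr IH/= [in RHS]big_ord_recr/= (mulrDr r).
by rewrite (poisson_pmfS N r0); ring.
Qed.

Lemma poisson_mass (r : R) : 0 < r ->
  \sum_(n < N) poisson_pmf r n @[N --> \oo] --> (1 : R).
Proof.
move=> r0; have := poisson_characteristic (s := 0) (p := 0) r0.
rewrite cos0 subrr mulr0 expR0 sin0 mulr0 addr0 cos0 mulr1.
by under eq_fun do under eq_bigr do rewrite mulr0 addr0 cos0 mulr1.
Qed.

Lemma poisson_mass_le1 (r : R) N : 0 < r -> \sum_(n < N) poisson_pmf r n <= 1.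
Proof.
move=> r0; rewrite -(cvg_lim _ (poisson_mass r0))//.
apply: (nondecreasing_cvgn_le (u_ := fun N => \sum_(n < N) poisson_pmf r n)).
  apply/nondecreasing_seqP => n; rewrite big_ord_recr/= lerDl.
  exact: poisson_pmf_ge0.
by apply/cvg_ex; exists 1; exact: poisson_mass.
Qed.

Lemma poisson_variance_le (r : R) N : 0 < r -> r <= N%:R ->
  \sum_(n < N.+1) poisson_pmf r n * (n%:R - r) ^+ 2 <= r.
Proof.
move=> r0 rN; rewrite poisson_variance_sum//.
rewrite (@le_trans _ _ (r * \sum_(n < N) poisson_pmf r n))//.
  by rewrite gerDl mulr_ge0_le0 ?subr_le0// mulr_ge0 ?poisson_pmf_ge0// ltW.
by rewrite (ler_piMr (ltW r0))// poisson_mass_le1.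
Qed.

Definition box_frame N (w : {ffun K -> 'I_N}) : {ffun K -> nat} :=
  [ffun k => val (w k)].

Definition frame_prob v (w : {ffun K -> nat}) : R :=
  \prod_k poisson_pmf (v k) (w k).

(** Truncating the counts makes every expectation a finite sum, to which the algebra of
big operators applies; the true expectation is recovered as [N] tends to infinity. *)
Definition box_mean N v (f : {ffun K -> nat} -> R) : R :=
  \sum_(w : {ffun K -> 'I_N}) frame_prob v (box_frame w) * f (box_frame w).

Lemma frame_prob_ge0 v w : 0 <= frame_prob v w.
Proof. by apply: prodr_ge0 => k _; exact: poisson_pmf_ge0. Qed.

Lemma box_meanD N v f g :
  box_mean N v (fun w => f w + g w) = box_mean N v f + box_mean N v g.
Proof. by rewrite -big_split; apply: eq_bigr => w _; rewrite mulrDr. Qed.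

Lemma box_meanZ N v a f : box_mean N v (fun w => a * f w) = a * box_mean N v f.
Proof. by rewrite mulr_sumr; apply: eq_bigr => w _; rewrite mulrCA. Qed.

Lemma le_box_mean N v f g : (forall w, f w <= g w) ->
  box_mean N v f <= box_mean N v g.
Proof.
by move=> fg; apply: ler_sum => w _; rewrite ler_wpM2l ?frame_prob_ge0.
Qed.

(** Independence of the pixels, in the form of distributivity. *)
Lemma box_mean_prod N v (g : K -> nat -> R) :
  box_mean N v (fun w => \prod_k g k (w k)) =
  \prod_k \sum_(n < N) poisson_pmf (v k) n * g k n.
Proof.
rewrite bigA_distr_bigA; apply: eq_bigr => w _.
by rewrite -big_split; apply: eq_bigr => k _; rewrite !ffunE.
Qed.

Let prod1 : \prod_(k : K) 1 = 1 :> R. Proof. exact: big1. Qed.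

Lemma box_mean1 N v :
  box_mean N v (fun=> 1) = \prod_k \sum_(n < N) poisson_pmf (v k) n.
Proof.
rewrite -[in LHS]prod1.
rewrite (box_mean_prod N v (fun _ _ => 1)).
by apply: eq_bigr => k _; apply: eq_bigr => n _; rewrite mulr1.
Qed.

Lemma box_mean1_le1 N v : (forall k, 0 < v k) -> box_mean N v (fun=> 1) <= 1.
Proof.
move=> v0; rewrite box_mean1 -[leRHS]prod1.
apply: ler_prod => k _; rewrite poisson_mass_le1// sumr_ge0// => n _.
exact: poisson_pmf_ge0.
Qed.

Lemma box_mean_coordinate N v k (g : nat -> R) : (forall k, 0 < v k) ->
  (forall n, 0 <= g n) ->
  box_mean N v (fun w => g (w k)) <= \sum_(n < N) poisson_pmf (v k) n * g n.
Proof.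
move=> v0 g0.
have -> : (fun w : {ffun K -> nat} => g (w k)) =
    (fun w => \prod_j (if j == k then g (w j) else 1)).
  by apply/funext => w; rewrite -big_mkcond big_pred1_eq.
rewrite (box_mean_prod N v (fun j n => if j == k then g n else 1)).
rewrite (bigD1 k)//= eqxx ler_piMr//.
  by rewrite sumr_ge0// => n _; rewrite mulr_ge0// poisson_pmf_ge0.
apply: (@le_trans _ _ (\prod_(i | i != k) 1)); last by rewrite big1.
apply: ler_prod => j jk; rewrite (negbTE jk).
under eq_bigr do rewrite mulr1.
rewrite poisson_mass_le1// sumr_ge0// => n _; exact: poisson_pmf_ge0.
Qed.

(** Chebyshev inequality on the box; once [N] exceeds the mean the truncated variance is at most the variance. *)
Lemma box_mean_tail v (k : K) (A : R) : (forall k, 0 < v k) -> 0 < A ->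
  \forall N \near \oo, box_mean N v (fun w =>
    (A < `|(w k)%:R - v k| / Num.sqrt (v k))%R%:R) <= A ^- 2.
Proof.
move=> v0 A0.
have [m vm] : exists m : nat, v k <= m%:R.
  by exists (Num.bound (v k)); rewrite ltW// archi_boundP// ltW.
exists m.+1 => // -[//|N]; rewrite /= ltnS => mN.
apply: (le_trans (@box_mean_coordinate N.+1 v k (fun n =>
  (A < `|n%:R - v k| / Num.sqrt (v k))%R%:R) v0 _)) => //.
have vN : v k <= N%:R by rewrite (le_trans vm)// ler_nat.
have Av0 : 0 < A ^+ 2 * v k by rewrite mulr_gt0// exprn_gt0.
apply: (@le_trans _ _ (\sum_(n < N.+1) poisson_pmf (v k) n *
    ((A ^+ 2 * v k)^-1 * (n%:R - v k) ^+ 2))).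
  apply: ler_sum => n _; rewrite ler_wpM2l ?poisson_pmf_ge0//.
  case: ltP => [An|_]; last by rewrite mulr_ge0 ?sqr_ge0// invr_ge0 ltW.
  rewrite ler_pdivlMl// mulr1 -[leRHS]real_normK ?num_real//.
  have -> : A ^+ 2 * v k = (A * Num.sqrt (v k)) ^+ 2.
    by rewrite exprMn sqr_sqrtr// ltW.
  rewrite lerXn2r ?nnegrE ?mulr_ge0 ?sqrtr_ge0 ?(ltW A0)//.
  by rewrite -ler_pdivlMr ?sqrtr_gt0// ltW.
under eq_bigr do rewrite mulrCA.
rewrite -mulr_sumr ler_pdivrMl// mulrAC mulfV ?mul1r ?gt_eqF ?exprn_gt0//.
exact: poisson_variance_le.
Qed.
End poisson_box.

(** * Characteristic function of a Poisson frame *)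

Section box_mean_cos.
Import complex.
Context {R : realType} {K : finType}.
Local Notation C := (complex R).
Local Notation toC := (real_complex R).
Implicit Types (v s : K -> R) (N : nat).

Let cis (x : R) : C := Complex (cos x) (sin x).

Let cisD x y : cis (x + y) = cis x * cis y.
Proof. by rewrite /cis cosD sinD; apply/eqP; rewrite eq_complex/= eqxx/= addrC. Qed.

Let cis0 : cis 0 = 1. Proof. by rewrite /cis cos0 sin0. Qed.

Let cis_sum (x : K -> R) : cis (\sum_k x k) = \prod_k cis (x k).
Proof. by apply: (big_morph cis cisD cis0). Qed.

Let cvgC (Z : nat -> C) (z : C) :=
  (complex.Re (Z N) @[N --> \oo] --> complex.Re z) /\ (complex.Im (Z N) @[N --> \oo] --> complex.Im z).

Let ReM (z y : C) : complex.Re (z * y) =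
  complex.Re z * complex.Re y - complex.Im z * complex.Im y.
Proof. by case: z y => ? ? []. Qed.

Let ImM (z y : C) : complex.Im (z * y) =
  complex.Re z * complex.Im y + complex.Im z * complex.Re y.
Proof. by case: z y => ? ? []. Qed.

Let cvgCM (Z Y : nat -> C) (z y : C) : cvgC Z z -> cvgC Y y ->
  cvgC (fun N => Z N * Y N) (z * y).
Proof.
move=> [Zr Zi] [Yr Yi]; split.
  by rewrite ReM; under eq_fun do rewrite ReM; apply: cvgB; apply: cvgM.
by rewrite ImM; under eq_fun do rewrite ImM; apply: cvgD; apply: cvgM.
Qed.

Let cvgC_prod (Z : K -> nat -> C) (z : K -> C) :
  (forall k, cvgC (Z k) (z k)) -> cvgC (fun N => \prod_k Z k N) (\prod_k z k).
Proof.
move=> Zz; elim: (index_enum K) => [|k r IH].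
  rewrite (_ : (fun _ => _) = fun=> 1); last by apply/funext => N; rewrite big_nil.
  by rewrite big_nil; split; exact: cvg_cst.
rewrite (_ : (fun _ => _) = fun N => Z k N * \prod_(j <- r) Z j N); last first.
  by apply/funext => N; rewrite big_cons.
by rewrite big_cons; apply: cvgCM.
Qed.

Let toC_mul_cis a x : toC a * cis x = Complex (a * cos x) (a * sin x).
Proof. by apply/eqP; rewrite eq_complex/= !mul0r subr0 addr0 !eqxx. Qed.

Let toC_prod (x : K -> R) : \prod_k toC (x k) = toC (\prod_k x k).
Proof. by rewrite rmorph_prod. Qed.

(** The product of the characteristic functions of the pixels, computed with complex
exponentials; the sine parts are cosines with phase [- pi / 2]. *)
Lemma box_mean_cos v s p : (forall k, 0 < v k) ->
  box_mean N v (fun w => cos (p + \sum_k s k * (w k)%:R)) @[N --> \oo] -->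
  expR (\sum_k v k * (cos (s k) - 1)) * cos (p + \sum_k v k * sin (s k)).
Proof.
move=> v0.
pose Z k N : C := \sum_(n < N) toC (poisson_pmf (v k) n) * cis (s k * n%:R).
have E N : box_mean N v (fun w => cos (p + \sum_k s k * (w k)%:R)) =
    complex.Re (cis p * \prod_k Z k N).
  rewrite bigA_distr_bigA mulr_sumr raddf_sum; apply: eq_bigr => w _.
  rewrite big_split/= -cis_sum mulrCA -cisD toC_prod toC_mul_cis/=.
  congr (_ * cos (_ + _)); first by apply: eq_bigr => k _; rewrite ffunE.
  by apply: eq_bigr => k _; rewrite ffunE.
under eq_fun do rewrite E.
have Zc k : cvgC (Z k) (toC (expR (v k * (cos (s k) - 1))) * cis (v k * sin (s k))).
  have ReZ N : complex.Re (Z k N) =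
      \sum_(n < N) poisson_pmf (v k) n * cos (n%:R * s k + 0).
    rewrite raddf_sum; apply: eq_bigr => n _.
    by rewrite toC_mul_cis/=; congr (_ * cos _); ring.
  have sinE x : sin x = cos (- (pi / 2) + x) :> R.
    by rewrite addrC cosB cos_pihalf sin_pihalf mulr0 mulr1 add0r.
  have ImZ N : complex.Im (Z k N) =
      \sum_(n < N) poisson_pmf (v k) n * cos (n%:R * s k - pi / 2).
    rewrite raddf_sum; apply: eq_bigr => n _.
    by rewrite toC_mul_cis/= sinE; congr (_ * cos _); ring.
  rewrite toC_mul_cis; split => /=.
    by under eq_fun do rewrite ReZ; rewrite -[v k * sin _]add0r;
      exact: poisson_characteristic.
  by under eq_fun do rewrite ImZ; rewrite sinE; exact: poisson_characteristic.
have [] := cvgCM (conj (cvg_cst (cos p)) (cvg_cst (sin p)) : cvgC (fun=> cis p) (cis p)) (cvgC_prod Zc).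
rewrite big_split/= toC_prod -cis_sum.
rewrite mulrCA -cisD toC_mul_cis/= expR_sum => + _; apply.
Qed.
End box_mean_cos.

(** * Characteristic function of the standard Gaussian *)

Section gaussian_characteristic.
Context {R : realType}.
Local Notation mu := (@lebesgue_measure R).
Local Notation pdf := (@normal_pdf R 0 1).
Implicit Types (u p z : R) (f g : R -> R).

Lemma pdfE z : pdf z = normal_peak 1 * expR (- (2^-1 * z ^+ 2)).
Proof.
rewrite normal_pdfE ?oner_neq0// /normal_fun subr0 expr1n; congr (_ * expR _).
by rewrite mulNr mulrC.
Qed.

Let is_derive_continuous f (df : R -> R) :
  (forall x : R, is_derive x 1 f (df x)) -> continuous f.
Proof.
move=> fd x; apply: differentiable_continuous; apply/derivable1_diffP.
by case: (fd x).
Qed.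

Lemma is_derive_pdf z : is_derive z 1 pdf (- z * pdf z).
Proof.
have d2 : is_derive z 1 (fun z : R => 0 + (- 2^-1) * (z * z)) (- z).
  have := is_derive1Z (- 2^-1) (is_derive1M (is_derive_id z 1) (is_derive_id z 1)).
  by move=> h; apply: (is_derive1_ext h) => [y|] /=; [rewrite add0r | lra].
apply: (is_derive1_ext (is_derive1Z (normal_peak 1)
  (is_derive1_compose (is_derive_expR _) d2))) => [y|]; rewrite pdfE.
  by congr (_ * expR _); ring.
have -> : 0 + - 2^-1 * (z * z) = - (2^-1 * z ^+ 2) by ring.
by ring.
Qed.

Lemma continuous_cos_affine u p : continuous (fun z : R => cos (u * z + p)).
Proof.
apply: (@is_derive_continuous _ (fun z => - sin (u * z + p) * u)) => z.
apply: (is_derive1_ext (is_derive1_compose (is_derive_cos _) (is_derive1_affine z u p))) => [y|];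
  by rewrite addrC.
Qed.

Let integrable_dominated f g : measurable_fun setT f ->
  (forall z, `|f z| <= g z) -> mu.-integrable setT (EFin \o g) ->
  mu.-integrable setT (EFin \o f).
Proof.
move=> mf fg ig; apply: (le_integrable measurableT _ _ ig).
  exact/measurable_EFinP.
by move=> z _ /=; rewrite lee_fin (le_trans (fg z))// ler_norm.
Qed.

Lemma integrable_bounded_pdf f c : measurable_fun setT f ->
  (forall z, `|f z| <= c) -> mu.-integrable setT (EFin \o (fun z => f z * pdf z)).
Proof.
move=> cf fc; apply: (@integrable_dominated _ (fun z => c * pdf z)).
- by apply: measurable_funM => //; exact: measurable_normal_pdf.
- by move=> z; rewrite normrM (ger0_norm (normal_pdf_ge0 _ _ _)) ler_wpM2r ?normal_pdf_ge0.
- rewrite (_ : _ \o _ = fun z => (c%:E * (pdf z)%:E)%E); last first.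
    by apply/funext => z /=; rewrite EFinM.
  by apply: integrableZl => //; exact: integrable_normal_pdf.
Qed.

(** A multiple of the density of variance [2] dominates [|z|] times the standard
density, so that first moments need no separate integrability argument. *)
Definition pdf_moment_bound z : R :=
  normal_peak 1 / normal_peak (Num.sqrt 2) * normal_pdf 0 (Num.sqrt 2) z.

Let sqrt2_neq0 : Num.sqrt 2 != 0 :> R.
Proof. by rewrite sqrtr_eq0 -ltNge ltr0n. Qed.

(** After division by the standard density this reads [|z| <= exp (z^2 / 4)], which follows
from [1 + y <= exp y]. *)
Lemma pdf_moment_le z : `|z| * pdf z <= pdf_moment_bound z.
Proof.
rewrite /pdf_moment_bound pdfE normal_pdfE// /normal_fun subr0.
rewrite mulrA divfK ?gt_eqF ?normal_peak_gt0// mulrCA ler_wpM2l ?normal_peak_ge0//.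
rewrite sqr_sqrtr// (_ : - z ^+ 2 / (2 *+ 2) = 4^-1 * z ^+ 2 + - (2^-1 * z ^+ 2)); last first.
  by field.
rewrite expRD ler_wpM2r ?expR_ge0//; apply: le_trans (expR_ge1Dx _).
rewrite -[z ^+ 2]real_normK ?num_real//; have := sqr_ge0 (`|z| - 2); nra.
Qed.

Lemma integrable_pdf_moment_bound : mu.-integrable setT (EFin \o pdf_moment_bound).
Proof.
rewrite (_ : _ \o _ = fun z => ((normal_peak 1 / normal_peak (Num.sqrt 2))%:E *
  (normal_pdf 0 (Num.sqrt 2) z)%:E)%E); last first.
  by apply/funext => z /=; rewrite EFinM.
by apply: integrableZl => //; exact: integrable_normal_pdf.
Qed.

Let moment_dominated f z : `|f z| <= 1 -> `|f z * (z * pdf z)| <= pdf_moment_bound z.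
Proof.
move=> f1; rewrite !normrM (ger0_norm (normal_pdf_ge0 _ _ _)).
apply: le_trans (pdf_moment_le z).
by rewrite ler_piMl// mulr_ge0// normal_pdf_ge0.
Qed.

Let continuous_sin_affine u p : continuous (fun z : R => sin (u * z + p)).
Proof.
rewrite (_ : (fun _ => _) = fun z => cos (u * z + (p - pi / 2))).
  exact: continuous_cos_affine.
by apply/funext => z; rewrite addrA cosB cos_pihalf sin_pihalf mulr0 mulr1 add0r.
Qed.

Let continuous_pdf : continuous pdf.
Proof. by apply: continuous_normal_pdf; rewrite oner_neq0. Qed.

Let ibp_fun u p z := (u * cos (u * z + p) - z * sin (u * z + p)) * pdf z.

Let continuous_ibp u p : continuous (ibp_fun u p).
Proof.
move=> z; apply: cvgM; last exact: continuous_pdf.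
apply: cvgB; first by apply: cvgMl_tmp; exact: continuous_cos_affine.
by apply: cvgM; [exact: cvg_id|exact: continuous_sin_affine].
Qed.

Let ibp_bound u p z : `|ibp_fun u p z| <= `|u| * pdf z + pdf_moment_bound z.
Proof.
rewrite /ibp_fun mulrBl; apply: le_trans (ler_normB _ _) _; apply: lerD.
  rewrite !normrM (ger0_norm (normal_pdf_ge0 _ _ _)) ler_wpM2r ?normal_pdf_ge0//.
  by rewrite ler_piMr// ler_norml cos_geN1 cos_le1.
rewrite mulrAC mulrC; apply: (moment_dominated (f := fun z => sin (u * z + p))).
by rewrite ler_norml sin_geN1 sin_le1.
Qed.

Let integrable_ibp_bound u :
  mu.-integrable setT (EFin \o (fun z => `|u| * pdf z + pdf_moment_bound z)).
Proof.
rewrite (_ : _ \o _ = (fun z => (`|u|%:E * (pdf z)%:E)%E) \+ (EFin \o pdf_moment_bound))%E; last first.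
  by apply/funext => z.
apply: integrableD => //; last exact: integrable_pdf_moment_bound.
by apply: integrableZl => //; exact: integrable_normal_pdf.
Qed.

Let pdf_le_inv n : pdf n.+1%:R <= normal_peak 1 / n.+1%:R.
Proof.
rewrite ler_pdivlMr// mulrC -{1}(ger0_norm (ler0n R n.+1)).
apply: le_trans (pdf_moment_le _) _; rewrite /pdf_moment_bound.
have pk := normal_peak_gt0 sqrt2_neq0.
rewrite -[leRHS](divfK (lt0r_neq0 pk)) ler_wpM2l ?normal_pdf_ub//.
by rewrite divr_ge0 ?normal_peak_ge0.
Qed.

Let pdfN z : pdf (- z) = pdf z.
Proof. by rewrite !pdfE sqrrN. Qed.

Let ibp_segment u p n :
  (\int[mu]_(z in `[(- n.+1%:R)%R, n.+1%:R%R]) (ibp_fun u p z)%:E =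
  (sin (u * n.+1%:R + p) * pdf n.+1%:R - sin (u * - n.+1%:R + p) * pdf (- n.+1%:R))%:E)%E.
Proof.
pose F z := sin (u * z + p) * pdf z.
have dF (z : R) : is_derive z 1 F (ibp_fun u p z).
  apply: (is_derive1_ext (is_derive1M
    (is_derive1_compose (is_derive_sin _) (is_derive1_affine z u p)) (is_derive_pdf z))).
    by move=> y; rewrite addrC.
  by rewrite /ibp_fun [p + _]addrC; ring.
have cF := is_derive_continuous dF.
rewrite (@continuous_FTC2 _ (ibp_fun u p) F).
- by rewrite EFinB.
- by rewrite gtrN.
- by apply: continuous_subspaceT; exact: continuous_ibp.
- split; [by move=> z _; case: (dF z)|exact/cvg_at_right_filter/cF|exact/cvg_at_left_filter/cF].
- by move=> z _; rewrite derive1E; case: (dF z).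
Qed.

Let ibp_segment_le u p n :
  `|sin (u * n.+1%:R + p) * pdf n.+1%:R - sin (u * - n.+1%:R + p) * pdf (- n.+1%:R)|
  <= 2 * normal_peak 1 * n.+1%:R^-1.
Proof.
rewrite pdfN -mulrBl normrM (ger0_norm (normal_pdf_ge0 _ _ _)) -mulrA.
apply: ler_pM => //; rewrite ?normal_pdf_ge0//.
apply: le_trans (ler_normB _ _) _; rewrite (_ : 2 = 1 + 1 :> R)//.
by apply: lerD; rewrite ler_norml sin_geN1 sin_le1.
Qed.

(** The integrand is the derivative of [sin (u z + p)] times the density, which
vanishes at infinity. *)
Lemma ibp_integral u p : \int[mu]_z ibp_fun u p z = 0.
Proof.
pose A n := `[(- n.+1%:R : R), n.+1%:R]%classic.
have mf : measurable_fun setT (EFin \o ibp_fun u p).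
  apply/measurable_EFinP; apply: continuous_measurable_fun.
  exact: (@continuous_ibp u p).
pose f_ n := (EFin \o ibp_fun u p) \_ (A n).
have mf_ n : measurable_fun setT (f_ n).
apply/(measurable_restrictT _ _).1; first exact: measurable_itv.
  exact: (measurable_funS measurableT (@subsetT _ _) mf).
have f_f : {ae mu, forall z, setT z -> f_ ^~ z @ \oo --> (EFin \o ibp_fun u p) z}.
  apply: aeW => z _; apply: cvg_near_cst.
  exists (Num.bound `|z|) => // n /= zn; rewrite /f_ patchE mem_set//= /A/= in_itv/=.
  rewrite -ler_norml (le_trans (ltW (archi_boundP (normr_ge0 z))))// ler_nat.
  exact: leq_trans zn _.
pose g z := `|u| * pdf z + pdf_moment_bound z.
have f_g : {ae mu, forall z n, setT z -> (`|f_ n z| <= (EFin \o g) z)%E}.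
  apply: aeW => z n _; rewrite /f_ patchE; case: ifP => _ /=.
    by rewrite lee_fin ibp_bound.
  by rewrite normr0 lee_fin (le_trans _ (ibp_bound u p z)) ?normr_ge0.
have [_ _ /= H] := @dominated_convergence _ _ _ mu setT measurableT f_ _ _
  mf_ mf f_f (integrable_ibp_bound u) f_g.
have cv0 : (\int[mu]_x f_ n x)%E @[n --> \oo] --> (0 : \bar R).
  under eq_fun => n do rewrite -integral_mkcond /A ibp_segment.
  apply: cvg_EFin; first exact: nearW.
  apply: norm_cvg0.
  apply: (@squeeze_cvgr _ _ _ _ (cst 0) (fun n => 2 * normal_peak 1 * n.+1%:R^-1)).
  - by apply: nearW => n; rewrite normr_ge0/= ibp_segment_le.
  - exact: cvg_cst.
  - rewrite -(mulr0 (2 * normal_peak 1)); apply: cvgMl_tmp.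
    exact: cvg_harmonic.
rewrite /Rintegral.
suff -> : (\int[mu]_z (ibp_fun u p z)%:E = 0)%E by [].
exact: cvg_unique H cv0.
Qed.

Definition gmean f := \int[mu]_z (f z * pdf z).

Let integrable_cos u p :
  mu.-integrable setT (EFin \o (fun z => cos (u * z + p) * pdf z)).
Proof.
apply: (@integrable_bounded_pdf (fun z => cos (u * z + p)) 1).
  by apply: continuous_measurable_fun; exact: (@continuous_cos_affine u p).
by move=> z; rewrite ler_norml cos_geN1 cos_le1.
Qed.

Let integrable_zsin u p :
  mu.-integrable setT (EFin \o (fun z => sin (u * z + p) * (z * pdf z))).
Proof.
apply: (@integrable_dominated _ pdf_moment_bound).
- apply: measurable_funM.
    by apply: continuous_measurable_fun; exact: (@continuous_sin_affine u p).
  by apply: measurable_funM => //; exact: measurable_normal_pdf.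
- by move=> z; apply: (moment_dominated (f := fun z => sin (u * z + p)));
    rewrite ler_norml sin_geN1 sin_le1.
- exact: integrable_pdf_moment_bound.
Qed.

(** Differentiation under the integral, followed by the integration by parts
[ibp_integral]. *)
Lemma is_derive_gmean_cos u p :
  is_derive u 1 (fun u => gmean (fun z => cos (u * z + p)))
    (- u * gmean (fun z => cos (u * z + p))).
Proof.
pose f u z := cos (u * z + p) * pdf z.
have df (x : R) z : is_derive x 1 (f ^~ z) (- (sin (x * z + p) * (z * pdf z))).
  apply: (is_derive1_ext (is_derive1Z (pdf z)
    (is_derive1_compose (is_derive_cos _) (is_derive1_affine x z p)))).
    by move=> y; rewrite mulrC /f [p + _]addrC [z * y]mulrC.
  by rewrite addrC [z * x]mulrC; ring.
have I01 : (`]u - 1, u + 1[%classic : set R) u.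
  by rewrite /= in_itv/= ltrDl ltr01 andbT ltrBlDr ltrDl ltr01.
have G_ge0 z : 0 <= pdf_moment_bound z.
  by rewrite (le_trans _ (pdf_moment_le z))// mulr_ge0// normal_pdf_ge0.
have d1f x z : partial1of2 f x z = - (sin (x * z + p) * (z * pdf z)).
  by rewrite partial1of2E; case: (df x z).
have [drv val] : derivable (fun u => gmean (fun z => cos (u * z + p))) u 1 /\
  derive1 (fun u => gmean (fun z => cos (u * z + p))) u =
    \int[mu]_z (partial1of2 f u z).
  split.
    apply: (@derivable_under_integral _ _ _ mu f setT measurableT u _ _ I01
      _ _ pdf_moment_bound G_ge0 integrable_pdf_moment_bound _).
    - by move=> x _; exact: integrable_cos.
    - by move=> x z _ _; case: (df x z).
    - move=> x z _ _; rewrite d1f normrN.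
      by apply: (moment_dominated (f := fun z => sin (x * z + p)));
        rewrite ler_norml sin_geN1 sin_le1.
  apply: (@differentiation_under_integral _ _ _ mu f setT measurableT u _ _ I01
      _ _ pdf_moment_bound G_ge0 integrable_pdf_moment_bound _).
  - by move=> x _; exact: integrable_cos.
  - by move=> x z _ _; case: (df x z).
  - move=> x z _ _; rewrite d1f normrN.
    by apply: (moment_dominated (f := fun z => sin (x * z + p)));
      rewrite ler_norml sin_geN1 sin_le1.
have intz : u * gmean (fun z => cos (u * z + p)) =
    \int[mu]_z (sin (u * z + p) * (z * pdf z)).
  have i1 : mu.-integrable setT
      (EFin \o (fun z => u * (cos (u * z + p) * pdf z))).
    rewrite (_ : _ \o _ = fun z => (u%:E * (cos (u * z + p) * pdf z)%:E)%E); last first.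
      by apply/funext => z /=; rewrite EFinM.
    by apply: integrableZl => //; exact: integrable_cos.
  apply/eqP; rewrite -subr_eq0; apply/eqP; rewrite -[RHS](ibp_integral u p).
  rewrite /gmean -(RintegralZl u measurableT (integrable_cos u p)).
  rewrite -(RintegralB measurableT i1 (integrable_zsin u p)).
  by apply: eq_Rintegral => z _; rewrite /ibp_fun; ring.
apply: DeriveDef => //; rewrite -derive1E val mulNr intz -[RHS]mulN1r.
rewrite -(RintegralZl (-1) measurableT (integrable_zsin u p)).
by apply: eq_Rintegral => z _; rewrite d1f mulN1r.
Qed.

(** The derivative of the Gaussian mean in [u] is [- u] times itself, so its product with
[exp (u^2 / 2)] is constant, equal to [cos p]. *)
Lemma gmean_cos u p :
  gmean (fun z => cos (u * z + p)) = expR (- (2^-1 * u ^+ 2)) * cos p.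
Proof.
pose psi u := expR (0 + 2^-1 * (u * u)) * gmean (fun z => cos (u * z + p)).
have dpsi (x : R) : is_derive x 1 psi 0.
  have d2 : is_derive x 1 (fun z : R => 0 + 2^-1 * (z * z)) x.
    have h := is_derive1Z 2^-1 (is_derive1M (is_derive_id x 1) (is_derive_id x 1)).
    by apply: (is_derive1_ext h) => [y|] /=; [rewrite add0r | lra].
  apply: (is_derive1_ext (is_derive1M (is_derive1_compose (is_derive_expR _) d2)
    (is_derive_gmean_cos x p))) => //.
  by ring.
have := is_derive_0_is_cst u 0 dpsi; rewrite /psi mul0r mulr0 addr0 expR0 mul1r.
have -> : gmean (fun z => cos (0 * z + p)) = cos p.
  rewrite /gmean; under eq_Rintegral do rewrite mul0r add0r.
  rewrite RintegralZl//; last exact: integrable_normal_pdf.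
  by rewrite /Rintegral integral_normal_pdf/= mulr1.
by rewrite add0r expRN -expr2 => <-; rewrite mulKf// gt_eqF// expR_gt0.
Qed.

End gaussian_characteristic.

(** * Trigonometric approximation of distribution functions *)

Section steps.
Context {R : realType}.
Local Notation mu := (@lebesgue_measure R).
Local Notation pdf := (@normal_pdf R 0 1).
Implicit Types (x z eta eps L : R) (T U : R -> R).

(** Real trigonometric polynomials with arbitrary frequencies; a triple is an
amplitude, a frequency and a phase. *)
Definition trig_poly T := exists s : seq (R * R * R),
  T = fun z => \sum_(c <- s) c.1.1 * cos (c.1.2 * z + c.2).

Lemma trig_poly_cst a : trig_poly (fun=> a).
Proof.
exists [:: (a, 0, 0)]; apply/funext => z.
by rewrite big_seq1/= mul0r addr0 cos0 mulr1.
Qed.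

Lemma trig_polyD T U : trig_poly T -> trig_poly U -> trig_poly (fun z => T z + U z).
Proof.
by move=> [s ->] [t ->]; exists (s ++ t); apply/funext => z; rewrite big_cat.
Qed.

Lemma trig_polyM T U : trig_poly T -> trig_poly U -> trig_poly (fun z => T z * U z).
Proof.
move=> [s ->] [t ->].
exists ([seq (2^-1 * (c.1.1 * d.1.1), c.1.2 + d.1.2, c.2 + d.2) | c <- s, d <- t] ++
  [seq (2^-1 * (c.1.1 * d.1.1), c.1.2 - d.1.2, c.2 - d.2) | c <- s, d <- t]).
apply/funext => z; rewrite big_cat/= !big_allpairs_dep/= -big_split mulr_suml.
apply: eq_bigr => c _; rewrite mulr_sumr -big_split; apply: eq_bigr => d _ /=.
rewrite (_ : (c.1.2 + d.1.2) * z + _ = (c.1.2 * z + c.2) + (d.1.2 * z + d.2)); last by ring.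
rewrite (_ : (c.1.2 - d.1.2) * z + _ = (c.1.2 * z + c.2) - (d.1.2 * z + d.2)); last by ring.
by rewrite [cos (_ + (_ + _))]cosD cosB; field.
Qed.

Lemma trig_polyX T n : trig_poly T -> trig_poly (fun z => T z ^+ n).
Proof.
move=> tT; elim: n => [|n IH]; first exact: trig_poly_cst.
rewrite (_ : (fun _ => _) = (fun z => T z * T z ^+ n)); first exact: trig_polyM.
by apply/funext => z; rewrite exprS.
Qed.

Lemma trig_poly_sin_affine a b : trig_poly (fun z => sin (a * z + b)).
Proof.
exists [:: (1, a, b - pi / 2)]; apply/funext => z.
by rewrite big_seq1/= addrA cosB cos_pihalf sin_pihalf mulr0 mulr1 add0r mul1r.
Qed.

Lemma bernoulli_le (a : R) n : 0 <= a <= 1 -> 1 - n%:R * a <= (1 - a) ^+ n.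
Proof.
move=> /andP[a0 a1]; elim: n => [|n IH]; first by rewrite mul0r subr0 expr0.
rewrite exprS; apply: (@le_trans _ _ ((1 - a) * (1 - n%:R * a))).
  have : 0 <= n%:R * a * a by rewrite !mulr_ge0.
  by rewrite -natr1; nra.
by rewrite ler_wpM2l// subr_ge0.
Qed.

Lemma bernoulli_ge (a : R) n : 0 <= a <= 1 -> (1 - a) ^+ n * (n%:R * a) <= 1.
Proof.
move=> /andP[a0 a1].
have h : n%:R * a <= (1 + a) ^+ n.
  elim: n => [|n IH]; first by rewrite mul0r expr0.
  rewrite exprS -natr1; have : 1 <= (1 + a) ^+ n by rewrite exprn_ege1// lerDl.
  by nra.
apply: (@le_trans _ _ ((1 - a) ^+ n * (1 + a) ^+ n)).
  by rewrite ler_wpM2l// exprn_ge0// subr_ge0.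
rewrite -exprMn exprn_ile1//; nra.
Qed.

(** The function [y = (1 + sin (k (z - x))) / 2] is increasing on [-L, L] for small [k] and
equals [1/2] at [x]. The polynomials [(1 - y^m)^(2^m)] tend to [1] for
[y < 1/2] and to [0] for [y > 1/2], by the two Bernoulli inequalities. *)
Lemma trig_step x eta L eps : 0 < eta -> 0 < L -> 0 < eps ->
  exists T, [/\ trig_poly T, forall z, 0 <= T z <= 1,
    forall z, `|z| <= L -> z <= x - eta -> 1 - eps <= T z &
    forall z, `|z| <= L -> x + eta <= z -> T z <= eps].
Proof.
move=> eta0 L0 eps0.
(* The frequency keeps [k * (z - x)] in [-1, 1], where the sine is increasing. *)
pose Lp := L + `|x| + eta.
have Lp0 : 0 < Lp by rewrite addr_gt0// ltr_wpDr.
pose k := Lp^-1.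
have k0 : 0 < k by rewrite invr_gt0.
pose s := sin (k * eta).
have ke0 : 0 < k * eta by rewrite mulr_gt0.
have ke1 : k * eta < 1.
  by rewrite mulrC ltr_pdivrMr// mul1r /Lp ltrDr ltr_pwDl.
have pih := @pihalf_ge1 R.
have s0 : 0 < s.
  by apply: sin_gt0_pihalf; rewrite ke0/= (lt_le_trans ke1).
have s1 : s <= 1 by exact: sin_le1.
have kz z : `|z| <= L -> `|k * (z - x)| <= 1.
  move=> zL; rewrite normrM gtr0_norm// mulrC ler_pdivrMr// mul1r.
  by have := ler_normB z x; rewrite /Lp; lra.
have sin_mono (a b : R) : `|a| <= 1 -> `|b| <= 1 -> a <= b -> sin a <= sin b.
  rewrite !ler_norml => /andP[a1 a2] /andP[b1 b2].
  rewrite le_eqVlt => /predU1P[->//|ab]; apply: ltW.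
  by rewrite ltr_sin// in_itv/=; apply/andP; split; lra.
have k1 : `|k * eta| <= 1 by rewrite gtr0_norm// ltW.
have [m m1 m2] : exists2 m, (1 - s) ^+ m <= eps & (1 + s)^-1 ^+ m <= eps.
  have c1 : (1 - s) ^+ m @[m --> \oo] --> (0 : R).
    by apply: cvg_expr; rewrite ger0_norm ?subr_ge0// ltrBlDr ltrDl.
  have c2 : (1 + s)^-1 ^+ m @[m --> \oo] --> (0 : R).
    have q0 : 0 < 1 + s by rewrite addr_gt0.
    by apply: cvg_expr; rewrite gtr0_norm ?invr_gt0// invf_lt1// ltrDl.
  move/cvgr0Pnorm_le : c1 => /(_ _ eps0) c1; move/cvgr0Pnorm_le : c2 => /(_ _ eps0) c2.
  have [m _ Hm] := filterI c1 c2.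
  have [h1 h2] := Hm m (leqnn _).
  by exists m; rewrite (le_trans (ler_norm _)).
pose y z := 2^-1 * (1 + sin (k * z + - (k * x))).
have y01 z : 0 <= y z <= 1.
  have := sin_geN1 (k * z + - (k * x)); have := sin_le1 (k * z + - (k * x)).
  by rewrite /y => *; apply/andP; split; lra.
have ym01 z : 0 <= y z ^+ m <= 1.
  by have /andP[y0 y1] := y01 z; rewrite exprn_ge0//= exprn_ile1.
have y2 z : (2 ^ m)%N%:R * y z ^+ m = (1 + sin (k * (z - x))) ^+ m.
  by rewrite natrX -exprMn /y mulrA divff ?mul1r ?mulrBr// pnatr_eq0.
exists (fun z => (1 - y z ^+ m) ^+ (2 ^ m)); split.
- apply: trig_polyX; apply: trig_polyD; first exact: trig_poly_cst.
  rewrite (_ : (fun _ => _) = fun z => (-1) * (y z ^+ m)); last first.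
    by apply/funext => z; rewrite mulN1r.
  apply: trig_polyM; first exact: trig_poly_cst.
  apply: trig_polyX; apply: trig_polyM; first exact: trig_poly_cst.
  by apply: trig_polyD; [exact: trig_poly_cst|exact: trig_poly_sin_affine].
- move=> z; have /andP[a b] := ym01 z.
  by rewrite exprn_ge0 ?subr_ge0//= exprn_ile1 ?subr_ge0// gerBl.
- move=> z zL zx; apply: le_trans (bernoulli_le (2 ^ m) (ym01 z)).
  rewrite lerB// y2 (le_trans _ m1)// lerXn2r ?nnegrE ?subr_ge0// lerD2l -sinN; apply: sin_mono; rewrite ?normrN ?kz//.
  by rewrite -mulrN ler_pM2l//; lra.
- move=> z zL zx.
  have q0 : 0 < 1 + s by rewrite addr_gt0.
  have h : (1 + s) ^+ m <= (2 ^ m)%N%:R * y z ^+ m.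
    rewrite y2 lerXn2r ?nnegrE ?(ltW q0)//.
    by rewrite lerD2l sin_mono ?kz// ler_pM2l//; lra.
  apply: le_trans m2; rewrite exprVn -[leRHS]mul1r ler_pdivlMr ?exprn_gt0//.
  apply: le_trans (bernoulli_ge (2 ^ m) (ym01 z)).
  rewrite ler_wpM2l// exprn_ge0// subr_ge0; by have /andP[] := ym01 z.
Qed.

Definition gintegrable T := mu.-integrable setT (EFin \o (fun z => T z * pdf z)).

Lemma gintegrableD T U : gintegrable T -> gintegrable U ->
  gintegrable (fun z => T z + U z).
Proof.
move=> iT iU; rewrite /gintegrable (_ : _ \o _ = ((EFin \o (fun z => T z * pdf z)%R) \+
  (EFin \o (fun z => U z * pdf z)%R))%E); first exact: integrableD.
by apply/funext => z /=; rewrite mulrDl.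
Qed.

Lemma gintegrableZ a T : gintegrable T -> gintegrable (fun z => a * T z).
Proof.
move=> iT; rewrite /gintegrable.
rewrite (_ : _ \o _ = fun z => (a%:E * (T z * pdf z)%:E)%E); first exact: integrableZl.
by apply/funext => z /=; rewrite -EFinM mulrA.
Qed.

Lemma gmeanD T U : gintegrable T -> gintegrable U ->
  gmean (fun z => T z + U z) = gmean T + gmean U.
Proof.
move=> iT iU; rewrite /gmean -RintegralD//.
by apply: eq_Rintegral => z _; rewrite mulrDl.
Qed.

Lemma gmeanZ a T : gintegrable T -> gmean (fun z => a * T z) = a * gmean T.
Proof.
move=> iT; rewrite /gmean -RintegralZl//.
by apply: eq_Rintegral => z _; rewrite mulrA.
Qed.

Lemma le_gmean T U : gintegrable T -> gintegrable U ->
  (forall z, T z <= U z) -> gmean T <= gmean U.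
Proof.
move=> iT iU TU; apply: le_Rintegral => // z _.
by rewrite ler_wpM2r// normal_pdf_ge0.
Qed.

Lemma gintegrable_cst a : gintegrable (fun=> a).
Proof. exact: (@integrable_bounded_pdf _ _ `|a|). Qed.

Lemma gmean_cst (a : R) : gmean (fun=> a) = a.
Proof.
rewrite /gmean RintegralZl//; last exact: integrable_normal_pdf.
by rewrite /Rintegral integral_normal_pdf/= mulr1.
Qed.

Lemma gintegrable_cos u p : gintegrable (fun z => cos (u * z + p)).
Proof.
apply: (@integrable_bounded_pdf _ _ 1).
  by apply: continuous_measurable_fun; exact: (@continuous_cos_affine _ u p).
by move=> z; rewrite ler_norml cos_geN1 cos_le1.
Qed.

Lemma gmean_trig_sum (s : seq (R * R * R)) :
  let T z := \sum_(c <- s) c.1.1 * cos (c.1.2 * z + c.2) in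
  gintegrable T /\
  gmean T = \sum_(c <- s) c.1.1 * (expR (- (2^-1 * c.1.2 ^+ 2)) * cos c.2).
Proof.
elim: s => [|c s [IHi IH]] /=.
  rewrite (_ : (fun _ => _) = fun=> 0); last by apply/funext => z; rewrite big_nil.
  by rewrite big_nil gmean_cst; split => //; exact: gintegrable_cst.
rewrite (_ : (fun z => \sum_(c0 <- c :: s) _) = fun z =>
   (fun z => c.1.1 * cos (c.1.2 * z + c.2)) z +
   (fun z => \sum_(c <- s) c.1.1 * cos (c.1.2 * z + c.2)) z); last first.
  by apply/funext => z; rewrite big_cons.
have ic := gintegrableZ c.1.1 (gintegrable_cos c.1.2 c.2).
split; first exact: gintegrableD.
rewrite gmeanD// big_cons -IH gmeanZ ?gmean_cos//; exact: gintegrable_cos.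
Qed.

Lemma gintegrable_indic (A : set R) : measurable A -> gintegrable (\1_A).
Proof.
move=> mA; apply: (@integrable_bounded_pdf _ _ 1); first exact: measurable_indic.
by move=> z; rewrite indicE; case: (_ \in _); rewrite ?normr1 ?normr0.
Qed.

Lemma gmean_indic (A : set R) : measurable A ->
  gmean (\1_A) = fine (normal_prob 0 1 A).
Proof.
move=> mA; rewrite /gmean /Rintegral /normal_prob [in RHS]integral_mkcond.
congr fine; apply: eq_integral => z _; rewrite patchE indicE.
by case: ifP; rewrite ?mul1r ?mul0r.
Qed.

Definition gmean_norm_bound : R := fine (\int[mu]_z (@pdf_moment_bound R z)%:E)%E.

Lemma gintegrable_norm : gintegrable (fun z => `|z|).
Proof.
apply: (le_integrable measurableT _ _ (integrable_pdf_moment_bound (R := R))).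
  apply/measurable_EFinP; apply: measurable_funM; last exact: measurable_normal_pdf.
  by apply: continuous_measurable_fun; exact: norm_continuous.
move=> z _ /=; rewrite lee_fin normrM normr_id (ger0_norm (normal_pdf_ge0 _ _ _)).
exact: le_trans (pdf_moment_le z) (ler_norm _).
Qed.

Lemma gmean_norm_le : gmean (fun z => `|z|) <= gmean_norm_bound.
Proof.
apply: le_Rintegral => //; first exact: gintegrable_norm.
  exact: integrable_pdf_moment_bound.
by move=> z _; exact: pdf_moment_le.
Qed.

Definition gcdf x := fine (normal_prob 0 1 `]-oo, x] : \bar R).

Lemma gcdf_gmean x : gcdf x = gmean (\1_(`]-oo, x]%classic)).
Proof. by rewrite gmean_indic. Qed.

(** The density is bounded by its peak. *)
Lemma gcdf_lip x h : 0 <= h -> gcdf (x + h) <= gcdf x + normal_peak 1 * h.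
Proof.
move=> h0; have i1 := gintegrable_indic (measurable_itv (`]-oo, x] : interval R)).
have i2 := gintegrable_indic (measurable_itv (`]x, (x + h)] : interval R)).
rewrite !gcdf_gmean.
apply: (@le_trans _ _ (gmean (fun z => \1_(`]-oo, x]%classic) z + \1_(`]x, (x + h)]%classic) z))).
  apply: le_gmean; [exact: gintegrable_indic|exact: gintegrableD|].
  move=> z; rewrite !indicE !mem_setE !in_itv/=.
  by case: (leP z (x + h)) => _; case: (leP z x) => _ /=; rewrite ?addr0 ?add0r ?ler01 ?lexx ?addr_ge0.
rewrite gmeanD// lerD2l gmean_indic// /normal_prob.
rewrite -[leRHS](_ : fine (\int[mu]_(z in `]x, (x + h)%R]) (normal_peak 1)%:E)%E = _); last first.
  rewrite integral_cst//= lebesgue_measure_itv/= lte_fin ltrDl; case: ltP => [h0'|]/=.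
    by rewrite addrAC subrr add0r.
  by move=> h0'; have /eqP -> : h == 0 by rewrite eq_le h0' h0.
apply: (@le_Rintegral _ _ _ mu) => //.
- apply: (integrableS measurableT) => //; exact: integrable_normal_pdf.
- apply: (@integrableS _ _ _ mu `[x, (x + h)]) => //.
    by apply: subset_itvr; rewrite bnd_simp.
  apply: continuous_compact_integrable; first exact: segment_compact.
  by apply: continuous_subspaceT => z; exact: cvg_cst.
- by move=> z _; rewrite normal_pdf_ub// oner_neq0.
Qed.

(** Outside [-L, L] nothing is known about [T] beyond [0 <= T <= 1]; there the
indicator is at most [|z| / L], whose mean is small. *)
Lemma gmean_step T x eta L eps : trig_poly T ->
  0 <= eta -> 0 < L -> 0 <= eps -> (forall z, 0 <= T z <= 1) ->
  (forall z, `|z| <= L -> z <= x - eta -> 1 - eps <= T z) ->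
  (forall z, `|z| <= L -> x + eta <= z -> T z <= eps) ->
  `|gmean T - gcdf x| <= normal_peak 1 * eta + eps + gmean_norm_bound / L.
Proof.
move=> [s TE] eta0 L0 eps0 T01 Tlo Thi.
have iT : gintegrable T by rewrite TE; case: (gmean_trig_sum s).
have iN : gintegrable (fun z => eps + L^-1 * `|z|).
  by apply: gintegrableD; [exact: gintegrable_cst|apply: gintegrableZ; exact: gintegrable_norm].
have gN : gmean (fun z => eps + L^-1 * `|z|) <= eps + gmean_norm_bound / L.
  rewrite (gmeanD (gintegrable_cst _) (gintegrableZ _ gintegrable_norm)) gmean_cst.
  rewrite lerD2l (gmeanZ _ gintegrable_norm) mulrC ler_wpM2r ?invr_ge0 ?(ltW L0)//.
  exact: gmean_norm_le.
have i1 y := gintegrable_indic (measurable_itv (`]-oo, y] : interval R)).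
have zL z : L < `|z| -> 1 <= eps + L^-1 * `|z|.
  by move=> Lz; rewrite ler_wpDl// ler_pdivlMl// mulr1 ltW.
have N0 z : 0 <= eps + L^-1 * `|z| by rewrite addr_ge0// mulr_ge0// invr_ge0 ltW.
have up : gmean T <= gcdf (x + eta) + (eps + gmean_norm_bound / L).
  rewrite gcdf_gmean; apply: le_trans (lerD (lexx _) gN).
  rewrite -(gmeanD (i1 _) iN); apply: le_gmean => //; first exact: gintegrableD.
  move=> z; have /andP[T0 T1] := T01 z; rewrite indicE mem_setE in_itv/=.
  case: (leP z (x + eta)) => [_|/ltW xz]; first by rewrite (le_trans T1)// lerDl.
  rewrite add0r; case: (leP `|z| L) => [/Thi/(_ xz) h|/zL h]; last exact: le_trans h.
  by rewrite (le_trans h)// lerDl mulr_ge0// invr_ge0 ltW.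
have lo : gcdf (x - eta) <= gmean T + (eps + gmean_norm_bound / L).
  rewrite gcdf_gmean; apply: le_trans (lerD (lexx _) gN).
  rewrite -(gmeanD iT iN); apply: le_gmean => //; first exact: gintegrableD.
  move=> z; have /andP[T0 T1] := T01 z; rewrite indicE mem_setE in_itv/=.
  case: (leP z (x - eta)) => [xz|_]; last by rewrite addr_ge0.
  case: (leP `|z| L) => [/Tlo/(_ xz) h|/zL h]; last by rewrite (le_trans h)// lerDr.
  have : 0 <= L^-1 * `|z| by rewrite mulr_ge0// invr_ge0 ltW.
  by move: h; rewrite /=; lra.
have l1 := gcdf_lip x eta0; have := gcdf_lip (x - eta) eta0; rewrite subrK => l2.
by rewrite ler_norml; apply/andP; split; lra.
Qed.
End steps.

(** * A central limit theorem for whitened Poisson counts *)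

Section trig_taylor.
Context {R : realType}.
Implicit Types x : R.

Lemma sin_sub_le x : `|sin x| <= `|x|.
Proof.
have := @mean_value_le_norm _ (@sin R) (@cos R) `|x| x 1 (lexx _).
rewrite sin0 subr0 mul1r; apply => s _.
by rewrite ler_norml cos_geN1 cos_le1.
Qed.

Lemma cos_taylor1 x : `|cos x - 1| <= `|x| * `|x|.
Proof.
have := @mean_value_le_norm _ (@cos R) (fun x => - sin x) `|x| x `|x| (lexx _).
rewrite cos0; apply => s sx.
by rewrite normrN (le_trans (sin_sub_le s)).
Qed.

Lemma sin_taylor2 x : `|sin x - x| <= `|x| ^+ 3.
Proof.
have := @mean_value_le_norm _ (fun x => sin x + (0 + (-1) * x)) (fun x => cos x + (-1))
  `|x| x (`|x| * `|x|) (lexx _).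
rewrite sin0 mulr0 !addr0 subr0 add0r mulN1r -expr2 -exprSr; apply => s sx.
  by apply: is_derive1D; exact: is_derive1_affine.
rewrite (le_trans (cos_taylor1 s))// expr2 ler_pM//.
Qed.

Lemma cos_taylor3 x : `|cos x - 1 + 2^-1 * x ^+ 2| <= `|x| ^+ 4.
Proof.
have := @mean_value_le_norm _ (fun x => cos x + 2^-1 * (x * x)) (fun x => - sin x + x)
  `|x| x (`|x| ^+ 3) (lexx _).
rewrite cos0 mulr0 mulr0 addr0 -exprSr addrAC expr2; apply => s sx.
  apply: is_derive1D.
  apply: (is_derive1_ext (is_derive1Z 2^-1 (is_derive1M (is_derive_id s 1) (is_derive_id s 1)))) => //=.
  by lra.
by rewrite addrC distrC (le_trans (sin_taylor2 s))// lerXn2r ?nnegrE.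
Qed.
End trig_taylor.

Section clt.
Context {R : realType} {K : finType} {n : nat}.
Variables (v : R -> K -> R) (O : R -> K -> 'I_n -> R).
Hypothesis v_gt0 : forall (I : R) k, 0 < I -> 0 < v I k.
Hypothesis O_orth : forall I : R, 0 < I -> forall i j,
  \sum_k O I k i * O I k j = (i == j)%:R.
Hypothesis dark_or_bright : forall k, (forall I : R, 0 < I -> forall i, O I k i = 0) \/
  v I k @[I --> +oo] --> +oo.
Local Notation frame := {ffun K -> nat}.

Definition dev I k (w : frame) : R := ((w k)%:R - v I k) / Num.sqrt (v I k).
Definition score I (w : frame) (i : 'I_n) : R := \sum_k dev I k w * O I k i.

Lemma O_le1 I k i : 0 < I -> `|O I k i| <= 1.
Proof.
move=> I0; rewrite -(@ler_pXn2r _ 2)// ?nnegrE// [leRHS]expr1n real_normK ?num_real//.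
have <- : \sum_k O I k i * O I k i = 1 by rewrite O_orth// eqxx.
rewrite (bigD1 k)//=.
by rewrite -expr2 lerDl sumr_ge0// => j _; rewrite -expr2 sqr_ge0.
Qed.

Definition mix I (u : 'I_n -> R) k := \sum_i u i * O I k i.

Lemma mix_le I u k : 0 < I -> `|mix I u k| <= \sum_i `|u i|.
Proof.
move=> I0; apply: le_trans (ler_norm_sum _ _ _) _; apply: ler_sum => i _.
by rewrite normrM ler_piMr// O_le1.
Qed.

Lemma mix_sqr I u : 0 < I -> \sum_k mix I u k ^+ 2 = \sum_i u i ^+ 2.
Proof.
move=> I0; transitivity (\sum_i \sum_j u i * u j * (\sum_k O I k i * O I k j)).
  under eq_bigr do rewrite expr2 mulr_suml.
  rewrite exchange_big/=; apply: eq_bigr => i _.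
  under eq_bigr do rewrite mulr_sumr.
  rewrite exchange_big/=; apply: eq_bigr => j _.
  by rewrite mulr_sumr; apply: eq_bigr => k _; rewrite mulrACA.
apply: eq_bigr => i _; rewrite (bigD1 i)//= O_orth// eqxx mulr1 big1 ?addr0//.
by move=> j ji; rewrite O_orth// eq_sym (negbTE ji) mulr0.
Qed.

(** A linear form of the score is an affine form of the counts, to which
[box_mean_cos] applies. *)
Lemma score_mix I u w p : 0 < I -> p + \sum_i u i * score I w i =
  (p - \sum_k mix I u k * Num.sqrt (v I k)) +
  \sum_k (mix I u k / Num.sqrt (v I k)) * (w k)%:R.
Proof.
move=> I0; rewrite -addrA; congr (_ + _); rewrite -sumrN -big_split/=.
under eq_bigr do rewrite mulr_sumr.
rewrite exchange_big; apply: eq_bigr => k _ /=.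
transitivity (dev I k w * mix I u k).
  by rewrite mulr_sumr; apply: eq_bigr => i _; ring.
have v0 := v_gt0 k I0.
have s0 : Num.sqrt (v I k) != 0 by rewrite gt_eqF// sqrtr_gt0.
by rewrite /dev -{1}(@sqr_sqrtr _ (v I k)) ?ltW//; field.
Qed.

(** The double limit: the box exhausts all frames at fixed intensity, and then the
intensity tends to infinity. The inner limit is the expectation of [F] of the
score. *)
Definition mean_cvg (F : ('I_n -> R) -> R) (l : R) := exists l_ : R -> R,
  (forall I, 0 < I -> box_mean N (v I) (fun w => F (score I w)) @[N --> \oo] --> l_ I) /\
  l_ I @[I --> +oo] --> l.

Lemma mean_cvgD F G l m : mean_cvg F l -> mean_cvg G m ->
  mean_cvg (fun x => F x + G x) (l + m).
Proof.
move=> [f [Nf If]] [g [Ng Ig]]; exists (fun I => f I + g I); split.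
  by move=> I I0; under eq_fun do rewrite box_meanD; apply: cvgD; [exact: Nf|exact: Ng].
exact: cvgD.
Qed.

Lemma mean_cvgZ F l a : mean_cvg F l -> mean_cvg (fun x => a * F x) (a * l).
Proof.
move=> [f [Nf If]]; exists (fun I => a * f I); split.
  by move=> I I0; under eq_fun do rewrite box_meanZ; apply: cvgMl_tmp; exact: Nf.
exact: cvgMl_tmp.
Qed.

Lemma mean_cvg_eq F G l : F =1 G -> mean_cvg F l -> mean_cvg G l.
Proof. by move=> /funext ->. Qed.

Lemma mean_cvg_sum (J : Type) (s : seq J) (F : J -> ('I_n -> R) -> R) (l : J -> R) :
  (forall j, mean_cvg (F j) (l j)) ->
  mean_cvg (fun x => \sum_(j <- s) F j x) (\sum_(j <- s) l j).
Proof.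
move=> Fl; elim: s => [|j s IH].
  exists (fun=> 0); rewrite big_nil; split; last exact: cvg_cst.
  move=> I _; rewrite /box_mean; under eq_fun do under eq_bigr do rewrite big_nil mulr0.
  by under eq_fun do rewrite big1//; exact: cvg_cst.
rewrite big_cons; apply: mean_cvg_eq (mean_cvgD (Fl j) IH) => x.
by rewrite big_cons.
Qed.

Let arg I (u : 'I_n -> R) k := mix I u k / Num.sqrt (v I k).

Let v_arg I u k e : 0 < I -> v I k * `|arg I u k| ^+ e.+2 =
  `|mix I u k| ^+ e.+2 / Num.sqrt (v I k) ^+ e.
Proof.
move=> I0; have v0 := v_gt0 k I0.
have s0 : Num.sqrt (v I k) != 0 by rewrite gt_eqF// sqrtr_gt0.
rewrite /arg normrM exprMn normfV (ger0_norm (sqrtr_ge0 _)) -{1}(@sqr_sqrtr _ (v I k)) ?ltW//.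
rewrite mulrCA; congr (_ * _).
by rewrite exprVn -(add2n e) exprD invfM mulrA divff ?mul1r// sqrf_eq0.
Qed.

Lemma mix_zero I u k : (forall i, O I k i = 0) -> mix I u k = 0.
Proof. by move=> Ok; apply: big1 => i _; rewrite Ok mulr0. Qed.

(** The remainders of the expansion of the characteristic function, Lyapunov style: they
are of order at least three in the bounded coefficients and carry a negative
power of the rate, which tends to infinity unless the coefficients vanish. *)
Lemma lyapunov_cvg0 (D : R -> K -> R) u e : (forall I k, 0 < I ->
    `|D I k| <= `|mix I u k| ^+ e.+3 / Num.sqrt (v I k) ^+ e.+1) ->
  \sum_k D I k @[I --> +oo] --> (0 : R).
Proof.
move=> Dle; suff Dk k : D I k @[I --> +oo] --> (0 : R).
  by have := cvg_sum_fin _ Dk; rewrite big1//; apply.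
apply/cvgr0Pnorm_le => eps eps0.
have [Ok|vk] := dark_or_bright k.
  near=> I; have I0 : 0 < I by near: I; exact: nbhs_pinfty_gt.
  rewrite (le_trans (Dle I k I0))// mix_zero ?normr0 ?expr0n/= ?mul0r ?ltW//.
  exact: Ok.
pose S := \sum_i `|u i|.
have S0 : 0 <= S by rewrite sumr_ge0.
move/cvgryPge : vk => /(_ (1 + (S ^+ e.+3 / eps) ^+ 2)) vk.
near=> I; have I0 : 0 < I by near: I; exact: nbhs_pinfty_gt.
have vI : 1 + (S ^+ e.+3 / eps) ^+ 2 <= v I k by near: I.
have v0 := v_gt0 k I0.
apply: (le_trans (Dle I k I0)); rewrite ler_pdivrMr ?exprn_gt0 ?sqrtr_gt0//.
have s1 : 1 <= Num.sqrt (v I k).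
  by rewrite -(sqrtr1 R) ler_wsqrtr// (le_trans _ vI)// lerDl sqr_ge0.
apply: (@le_trans _ _ (S ^+ e.+3)); first by rewrite lerXn2r ?nnegrE// mix_le.
rewrite -ler_pdivrMl// mulrC.
apply: (@le_trans _ _ (Num.sqrt (v I k))).
  have q0 : 0 <= S ^+ e.+3 / eps by rewrite divr_ge0 ?exprn_ge0 ?(ltW eps0).
  rewrite -(@ler_pXn2r _ 2)// ?nnegrE ?sqrtr_ge0// sqr_sqrtr ?(ltW v0)//.
  by rewrite (le_trans _ vI)// lerDr.
by rewrite exprS ler_peMr ?sqrtr_ge0// exprn_ege1.
Unshelve. all: by end_near. Qed.

(** The exponent of the Poisson characteristic function is expanded with
[cos x = 1 - x^2 / 2 + O(x^4)] and [sin x = x + O(x^3)]. The linear terms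
cancel the centering, the quadratic ones add up to [|u|^2 / 2] by orthonormality,
and the rest is controlled by [lyapunov_cvg0]. *)
Lemma mean_cvg_cos (u : 'I_n -> R) p :
  mean_cvg (fun x => cos (p + \sum_i u i * x i))
    (expR (- (2^-1 * \sum_i u i ^+ 2)) * cos p).
Proof.
exists (fun I => expR (\sum_k v I k * (cos (arg I u k) - 1)) *
   cos (p - \sum_k mix I u k * Num.sqrt (v I k) + \sum_k v I k * sin (arg I u k))).
split.
  move=> I I0.
  have -> : (fun w : frame => cos (p + \sum_i u i * score I w i)) = fun w : frame =>
      cos ((p - \sum_k mix I u k * Num.sqrt (v I k)) + \sum_k arg I u k * (w k)%:R).
    by apply/funext => w; rewrite score_mix.
  by apply: box_mean_cos => k; exact: v_gt0.
pose D1 I k := v I k * (cos (arg I u k) - 1 + 2^-1 * arg I u k ^+ 2).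
pose D2 I k := v I k * (sin (arg I u k) - arg I u k).
have c1 : \sum_k D1 I k @[I --> +oo] --> (0 : R).
  apply: (@lyapunov_cvg0 _ u 1) => I k I0; rewrite -v_arg// normrM gtr0_norm ?v_gt0//.
  by rewrite ler_wpM2l ?cos_taylor3// ltW// v_gt0.
have c2 : \sum_k D2 I k @[I --> +oo] --> (0 : R).
  apply: (@lyapunov_cvg0 _ u 0) => I k I0; rewrite -v_arg// normrM gtr0_norm ?v_gt0//.
  by rewrite ler_wpM2l ?sin_taylor2// ltW// v_gt0.
have E1 I : 0 < I -> \sum_k v I k * (cos (arg I u k) - 1) =
    - (2^-1 * \sum_i u i ^+ 2) + \sum_k D1 I k.
  move=> I0; rewrite -(mix_sqr u I0) mulr_sumr -sumrN -big_split/=; apply: eq_bigr => k _.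
  have v0 := v_gt0 k I0.
  rewrite /D1 /arg exprMn exprVn sqr_sqrtr ?ltW//; field.
  by rewrite gt_eqF.
have E2 I : 0 < I -> p - \sum_k mix I u k * Num.sqrt (v I k) +
    \sum_k v I k * sin (arg I u k) = p + \sum_k D2 I k.
  move=> I0; rewrite -addrA; congr (_ + _); rewrite -sumrN -big_split/=.
  apply: eq_bigr => k _; have v0 := v_gt0 k I0.
  have s0 : Num.sqrt (v I k) != 0 by rewrite gt_eqF// sqrtr_gt0.
  have h : v I k * arg I u k = mix I u k * Num.sqrt (v I k).
    by rewrite /arg -{1}(@sqr_sqrtr _ (v I k)) ?ltW//; field.
  by rewrite /D2 mulrBr h addrC.
have cI : (fun I => expR (- (2^-1 * \sum_i u i ^+ 2) + \sum_k D1 I k) *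
    cos (p + \sum_k D2 I k)) @ +oo --> expR (- (2^-1 * \sum_i u i ^+ 2)) * cos p.
  apply: cvgM.
    apply: continuous_cvg; first exact: continuous_expR.
    by rewrite -[X in _ --> X]addr0; apply: cvgD => //; exact: cvg_cst.
  apply: continuous_cvg; first exact: continuous_cos.
  by rewrite -[X in _ --> X]addr0; apply: cvgD => //; exact: cvg_cst.
apply: cvg_trans cI; apply: near_eq_cvg; near=> I.
have I0 : 0 < I by near: I; exact: nbhs_pinfty_gt.
by rewrite E1// E2.
Unshelve. all: by end_near. Qed.

(** Induction on the list of coordinates: expanding one trigonometric polynomial and
using [2 cos a cos b = cos (a + b) + cos (a - b)] moves its frequency into [u]. The
condition on [u] keeps the coordinates still to be treated free. *)
Lemma mean_cvg_trig_prod (T : 'I_n -> R -> R) (r : seq 'I_n) u p :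
  (forall i, trig_poly (T i)) -> uniq r -> (forall i, i \in r -> u i = 0) ->
  mean_cvg (fun x => cos (p + \sum_i u i * x i) * \prod_(i <- r) T i (x i))
    (expR (- (2^-1 * \sum_i u i ^+ 2)) * cos p * \prod_(i <- r) gmean (T i)).
Proof.
move=> tT; elim: r u p => [|i r IH] u p.
  move=> _ _; rewrite big_nil mulr1.
  by apply: mean_cvg_eq (mean_cvg_cos u p) => x; rewrite big_nil mulr1.
move=> /= /andP[ir ur] u0.
have [s Ts] := tT i.
have [_ gT] := gmean_trig_sum s; rewrite -Ts in gT.
pose u' a j := u j + (if j == i then a else 0).
have u'_sum a x : \sum_j u' a j * x j = \sum_j u j * x j + a * x i.
  under eq_bigr do rewrite mulrDl.
  rewrite big_split/=; congr (_ + _); rewrite (bigD1 i)//= eqxx big1 ?addr0//.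
  by move=> j /negbTE ->; rewrite mul0r.
have ui : u i = 0 by rewrite u0// mem_head.
have u'_sqr a : \sum_j u' a j ^+ 2 = \sum_j u j ^+ 2 + a ^+ 2.
  rewrite (bigD1 i)//= [in RHS](bigD1 i)//= /u' eqxx ui expr0n/= !add0r addrC.
  by congr (_ + _); apply: eq_bigr => j /negbTE ->; rewrite addr0.
have u'0 a j : j \in r -> u' a j = 0.
  move=> jr; rewrite /u' u0 ?inE ?jr ?orbT// add0r.
  by case: eqP => // ji; rewrite -ji jr in ir.
rewrite big_cons gT mulr_suml mulr_sumr.
have H (c : R * R * R) := mean_cvgZ (c.1.1 * 2^-1)
  (mean_cvgD (IH (u' c.1.2) (p + c.2) ur (@u'0 _)) (IH (u' (- c.1.2)) (p - c.2) ur (@u'0 _))).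
have := mean_cvg_sum s H.
set L := (X in mean_cvg _ X) => HL; set L' := (X in mean_cvg _ X).
have -> : L' = L.
  apply: eq_bigr => c _; rewrite !u'_sqr sqrrN cosD cosB.
  rewrite (_ : - (2^-1 * (_ + c.1.2 ^+ 2)) =
    - (2^-1 * \sum_j u j ^+ 2) + - (2^-1 * c.1.2 ^+ 2)); last by ring.
  by rewrite expRD; field.
apply: mean_cvg_eq HL => x.
rewrite big_cons Ts mulr_suml mulr_sumr; apply: eq_bigr => c _.
rewrite !u'_sum mulNr.
rewrite (_ : p + c.2 + _ = (p + \sum_j u j * x j) + (c.1.2 * x i + c.2)); last by ring.
rewrite (_ : p - c.2 + _ = (p + \sum_j u j * x j) - (c.1.2 * x i + c.2)); last by ring.
by rewrite [cos (_ + _ + (_ + _))]cosD [cos (_ + _ - (_ + _))]cosB; field.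
Qed.

Lemma mean_cvg_prod (T : 'I_n -> R -> R) : (forall i, trig_poly (T i)) ->
  mean_cvg (fun x => \prod_i T i (x i)) (\prod_i gmean (T i)).
Proof.
move=> tT; have := @mean_cvg_trig_prod T (index_enum 'I_n) (fun=> 0) 0 tT (index_enum_uniq _) (fun _ _ => erefl).
rewrite big1 => [|i _]; last by rewrite expr0n.
rewrite mulr0 oppr0 expR0 cos0 !mul1r; apply: mean_cvg_eq => x.
by rewrite big1 => [|i _]; rewrite ?mul0r// addr0 cos0 mul1r.
Qed.

Lemma prod_lip (J : Type) (r : seq J) (a b : J -> R) (e : R) : 0 <= e ->
  (forall j, 0 <= a j <= 1) -> (forall j, 0 <= b j <= 1) ->
  (forall j, a j <= b j + e) ->
  \prod_(j <- r) a j <= \prod_(j <- r) b j + (size r)%:R * e.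
Proof.
move=> e0 a01 b01 ab; elim: r => [|j r IH]; first by rewrite !big_nil mul0r addr0.
rewrite !big_cons /= -natr1.
have /andP[a0 a1] := a01 j; have /andP[b0 b1] := b01 j.
have A0 : 0 <= \prod_(j <- r) a j by apply: prodr_ge0 => i _; case/andP: (a01 i).
have A1 : \prod_(j <- r) a j <= 1 by apply: prodr_ile1 => i _; exact: a01.
have := ab j; have re : 0 <= (size r)%:R * e by rewrite mulr_ge0.
move: IH A0 A1 re; set P := \prod_(_ <- _) _; set Q := \prod_(_ <- _) _; set m := _%:R * e.
move=> IH A0 A1 re abj.
apply: (@le_trans _ _ ((b j + e) * P)); first by rewrite ler_wpM2r.
rewrite mulrDl; apply: (@le_trans _ _ (b j * (Q + m) + e)).
  by rewrite lerD ?ler_wpM2l// ler_piMr.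
rewrite mulrDr [(size r)%:R + 1]addrC mulrDl mul1r -addrA lerD2l addrC lerD2l.
by rewrite ler_piMl.
Qed.

Lemma prod_ord_lip (a b : 'I_n -> R) (e : R) : 0 <= e ->
  (forall j, 0 <= a j <= 1) -> (forall j, 0 <= b j <= 1) ->
  (forall j, a j <= b j + e) -> \prod_j a j <= \prod_j b j + n%:R * e.
Proof.
move=> e0 a01 b01 ab; have := prod_lip (index_enum 'I_n) e0 a01 b01 ab.
suff -> : size (index_enum 'I_n) = n by [].
by rewrite [index_enum _]unlock -enumT size_enum_ord.
Qed.

Variables (p : R -> set frame -> R) (B : R -> set frame) (x : 'I_n -> R).
Hypothesis p_lim : forall (I : R) (C : set frame), 0 < I ->
  box_mean N (v I) (\1_C) @[N --> \oo] --> p I C.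
Hypothesis B_le : forall eta A : R, 0 < eta -> 0 < A -> \forall I \near +oo, forall w,
  (forall k, `|dev I k w| <= A) -> B I w -> forall i, score I w i <= x i + eta.
Hypothesis B_ge : forall eta A : R, 0 < eta -> 0 < A -> \forall I \near +oo, forall w,
  (forall k, `|dev I k w| <= A) -> (forall i, score I w i <= x i - eta) -> B I w.

Let bad I (A : R) (w : frame) : R := \sum_k (A < `|dev I k w|)%R%:R.

Let bad_ge0 I A w : 0 <= bad I A w.
Proof. by rewrite sumr_ge0. Qed.

Let bad_ge1 I A w : ~ (forall k, `|dev I k w| <= A) -> 1 <= bad I A w.
Proof.
move=> /existsNP[k /negP]; rewrite -ltNge => Ak.
by rewrite /bad (bigD1 k)//= Ak lerDl sumr_ge0.
Qed.

Let box_mean_sum N I (F : K -> frame -> R) :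
  box_mean N (v I) (fun w => \sum_k F k w) = \sum_k box_mean N (v I) (F k).
Proof.
by rewrite /box_mean exchange_big; apply: eq_bigr => w _; rewrite mulr_sumr.
Qed.

Let bad_small (I A : R) : 0 < I -> 0 < A ->
  \forall N \near \oo, box_mean N (v I) (bad I A) <= #|K|%:R * A ^- 2.
Proof.
move=> I0 A0.
have H : \forall N \near \oo, forall k, box_mean N (v I) (fun w => (A < `|dev I k w|)%R%:R) <= A ^- 2.
  apply: filter_forall => k.
  have := @box_mean_tail R K (v I) k A (fun k => v_gt0 k I0) A0.
  apply: filterS => N; apply: le_trans; apply: le_box_mean => w.
  by rewrite /dev normrM normfV (ger0_norm (sqrtr_ge0 _)).
apply: filterS H => N H; rewrite box_mean_sum.
rewrite mulr_natl -sumr_const; apply: ler_sum => k _; exact: H.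
Qed.

Let score_le I A w i : 0 < I -> 0 <= A -> (forall k, `|dev I k w| <= A) ->
  `|score I w i| <= #|K|%:R * A.
Proof.
move=> I0 A0 wA; apply: le_trans (ler_norm_sum _ _ _) _.
rewrite mulr_natl -sumr_const; apply: ler_sum => k _.
by rewrite normrM -[leRHS]mulr1 ler_pM// O_le1.
Qed.

(** The event [B I] is only assumed to be sandwiched between slightly shifted quadrants
of the score, on typical frames. Its indicator is bounded above and below by
products of trigonometric steps, up to the small mean of the atypical frames, and
the means of these products converge to products of Gaussian means. *)
Lemma score_clt : p I (B I) @[I --> +oo] --> \prod_i gcdf (x i).
Proof.
apply/cvgrPdist_le => eps eps0.
(* The total of all the error terms below, in units of [e]. *)
pose C := n%:R * (3 * normal_peak 1 + 2) + 2 + n%:R + #|K|%:R : R.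
have pk : 0 <= normal_peak 1 :> R by exact: normal_peak_ge0.
have n0 : 0 <= n%:R :> R by [].
have K0 : 0 <= #|K|%:R :> R by [].
have C0 : 0 < C by rewrite /C; nra.
pose e := eps / C.
have e0 : 0 < e by rewrite divr_gt0.
pose A := 1 + e^-1.
have ei : 0 < e^-1 by rewrite invr_gt0.
have A0 : 0 < A by rewrite addr_gt0.
have A2 : A ^- 2 <= e.
  rewrite invf_ple ?posrE ?exprn_gt0//; rewrite /A; nra.
pose gb : R := gmean_norm_bound.
have gb0 : 0 <= gb.
  apply: le_trans gmean_norm_le; rewrite -[leLHS](gmean_cst (0 : R)); apply: le_gmean => //.
  exact: gintegrable_cst.
  exact: gintegrable_norm.
pose L := 1 + #|K|%:R * A + gb / e.
have L0 : 0 < L.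
  by rewrite /L -addrA ltr_pwDl// addr_ge0// ?mulr_ge0 ?(ltW A0)// ltW.
have gbL : gb / L <= e.
  rewrite ler_pdivrMr// mulrC -ler_pdivrMr// /L lerDr addr_ge0// mulr_ge0// ltW//.
have KL : #|K|%:R * A <= L.
  by rewrite /L addrAC lerDr addr_ge0// divr_ge0// ltW.
(* Shifting by [2 * e] leaves one [e] for the width of the step and one for the sandwich. *)
have Tup (i : 'I_n) := @trig_step R (x i + 2 * e) e L e e0 L0 e0.
have Tlo (i : 'I_n) := @trig_step R (x i - 2 * e) e L e e0 L0 e0.
have [Tu HTu] := choice Tup.
have [Tl HTl] := choice Tlo.
have tTu i : trig_poly (Tu i) by case: (HTu i).
have tTl i : trig_poly (Tl i) by case: (HTl i).
have Tu01 i z : 0 <= Tu i z <= 1 by case: (HTu i) => _ + _ _; exact.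
have Tl01 i z : 0 <= Tl i z <= 1 by case: (HTl i) => _ + _ _; exact.
have [lu [Nu Iu]] := mean_cvg_prod tTu.
have [ll [Nl Il]] := mean_cvg_prod tTl.
have gm01' (T : R -> R) : gintegrable T -> (forall z, 0 <= T z <= 1) -> 0 <= gmean T <= 1.
  move=> iT T01.
  rewrite -[X in X <= _ <= _](gmean_cst (0 : R)) -[X in _ <= _ <= X](gmean_cst (1 : R)).
  by apply/andP; split; apply: le_gmean => //; try exact: gintegrable_cst;
    move=> t; case/andP: (T01 t).
have gcdf01 (z : R) : 0 <= gcdf z <= 1.
  rewrite gcdf_gmean; apply: gm01'; first exact: gintegrable_indic.
  by move=> t; rewrite indicE; case: (_ \in _); rewrite /= ?ler01 ?lexx.
have gm01 (T : R -> R) : trig_poly T -> (forall z, 0 <= T z <= 1) -> 0 <= gmean T <= 1.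
  by move=> [s ->]; apply: gm01'; case: (gmean_trig_sum s).
pose tol := (3 * normal_peak 1 + 2) * e.
have tol0 : 0 <= tol by rewrite /tol; nra.
have gu i : gmean (Tu i) <= gcdf (x i) + tol.
  have [_ _ h1 h2] := HTu i.
  have := gmean_step (tTu i) (ltW e0) L0 (ltW e0) (Tu01 i) h1 h2.
  rewrite ler_norml => /andP[_]; rewrite lerBlDl => /le_trans; apply.
  have e20 : 0 <= 2 * e by rewrite mulr_ge0// ltW.
  by have := gcdf_lip (x i) e20; rewrite /tol -/gb; lra.
have gl i : gcdf (x i) <= gmean (Tl i) + tol.
  have [_ _ h1 h2] := HTl i.
  have := gmean_step (tTl i) (ltW e0) L0 (ltW e0) (Tl01 i) h1 h2.
  rewrite ler_norml => /andP[+ _].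
  have e20 : 0 <= 2 * e by rewrite mulr_ge0// ltW.
  by have := gcdf_lip (x i - 2 * e) e20; rewrite subrK /tol -/gb; lra.
have Pu := prod_ord_lip tol0 (fun i => gm01 _ (tTu i) (Tu01 i)) (fun i => gcdf01 (x i)) gu.
have Pl := prod_ord_lip tol0 (fun i => gcdf01 (x i)) (fun i => gm01 _ (tTl i) (Tl01 i)) gl.
have BU := B_le e0 A0; have BL := B_ge e0 A0.
move/cvgrPdist_le : Iu => /(_ _ e0) Iu; move/cvgrPdist_le : Il => /(_ _ e0) Il.
near=> I; have I0 : 0 < I by near: I; exact: nbhs_pinfty_gt.
have BUI : forall w, (forall k, `|dev I k w| <= A) -> B I w ->
  forall i, score I w i <= x i + e by near: I.
have BLI : forall w, (forall k, `|dev I k w| <= A) ->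
  (forall i, score I w i <= x i - e) -> B I w by near: I.
have up : p I (B I) <= lu I + (n%:R * e + #|K|%:R * e).
  have cN : box_mean N (v I) (fun w => \prod_i Tu i (score I w i)) +
      (n%:R * e + #|K|%:R * e) @[N --> \oo] --> lu I + (n%:R * e + #|K|%:R * e).
    by apply: cvgD; [exact: Nu|exact: cvg_cst].
  apply: (ler_cvg_to (@p_lim I (B I) I0) cN).
  * apply: filterS (bad_small I0 A0) => N HN.
    apply: (@le_trans _ _ (box_mean N (v I) (fun w => \prod_i Tu i (score I w i) + (n%:R * e * 1 + bad I A w)))).
      apply: le_box_mean => w; rewrite mulr1.
      have T0 : 0 <= \prod_i Tu i (score I w i).
        by apply: prodr_ge0 => i _; case/andP: (Tu01 i (score I w i)).
      have ne0 : 0 <= n%:R * e by rewrite mulr_ge0// ltW.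
      have [wA|/bad_ge1 wA] := pselect (forall k, `|dev I k w| <= A); last first.
        apply: (@le_trans _ _ 1); first by rewrite indicE; case: (_ \in _).
        by rewrite (le_trans wA)// addrA lerDr addr_ge0.
      have [wB|wB] := pselect (B I w); last first.
        rewrite indicE memNset//= addr_ge0// addr_ge0// bad_ge0//.
      rewrite indicE mem_set//= addrA ler_wpDr ?bad_ge0//.
      have := @prod_ord_lip (fun=> 1) (fun i => Tu i (score I w i)) e (ltW e0).
      rewrite big1//; apply => [i|i|i]; rewrite ?ler01 ?lexx//.
      rewrite -lerBlDr; have [_ _ h _] := HTu i; apply: h.
        by rewrite (le_trans _ KL)// score_le// ltW.
      by have := BUI w wA wB i; lra.
    rewrite box_meanD box_meanD box_meanZ lerD2l lerD//.
      apply: ler_piMr; first by rewrite mulr_ge0 ?(ltW e0).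
      by apply: box_mean1_le1 => k; exact: v_gt0.
    by rewrite (le_trans HN)// ler_wpM2l.
have lo : ll I <= p I (B I) + (e + #|K|%:R * e).
  have cN : box_mean N (v I) (\1_(B I)) + (e + #|K|%:R * e) @[N --> \oo] -->
      p I (B I) + (e + #|K|%:R * e).
    by apply: cvgD; [exact: p_lim|exact: cvg_cst].
  apply: (ler_cvg_to (Nl I I0) cN).
  * apply: filterS (bad_small I0 A0) => N HN.
    apply: (@le_trans _ _ (box_mean N (v I) (fun w => \1_(B I) w + (e * 1 + bad I A w)))).
      apply: le_box_mean => w; rewrite mulr1.
      have T1 : \prod_i Tl i (score I w i) <= 1 by apply: prodr_ile1 => i _; exact: Tl01.
      have i0 : 0 <= (\1_(B I) w : R) by rewrite indicE; case: (_ \in _).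
      have [wA|/bad_ge1 wA] := pselect (forall k, `|dev I k w| <= A); last first.
        rewrite (le_trans T1)// (le_trans wA)// addrA lerDr addr_ge0//; exact: ltW.
      have [wx|/existsNP[i wx]] := pselect (forall i, score I w i <= x i - e).
        have wB := BLI w wA wx.
        rewrite indicE mem_set//= (le_trans T1)// lerDl addr_ge0 ?bad_ge0//; exact: ltW.
      apply: ler_wpDl => //; apply: ler_wpDr; first exact: bad_ge0.
      have [_ _ _ h] := HTl i.
      apply: (@le_trans _ _ (Tl i (score I w i))).
        rewrite (bigD1 i)//= ler_piMr//; first by case/andP: (Tl01 i (score I w i)).
        by apply: prodr_ile1 => j _; exact: Tl01.
      apply: h; first by rewrite (le_trans _ KL)// score_le// ltW.
      by move/negP: wx; rewrite -ltNge; lra.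
    rewrite box_meanD box_meanD box_meanZ lerD2l lerD//.
      apply: ler_piMr; first exact: ltW.
      by apply: box_mean1_le1 => k; exact: v_gt0.
    by rewrite (le_trans HN)// ler_wpM2l.
have Iu' : `|\prod_i gmean (Tu i) - lu I| <= e by near: I.
have Il' : `|\prod_i gmean (Tl i) - ll I| <= e by near: I.
have CE : eps = C * e by rewrite mulrC divfK// gt_eqF.
have CEE : C * e = n%:R * tol + 2 * e + n%:R * e + #|K|%:R * e by rewrite /C /tol; ring.
have ne0 : 0 <= n%:R * e by rewrite mulr_ge0// ltW.
have ke0 : 0 <= #|K|%:R * e by rewrite mulr_ge0// ltW.
have nt0 : 0 <= n%:R * tol by rewrite mulr_ge0.
move: Iu' Il'; rewrite !ler_norml CE CEE => /andP[u1 u2] /andP[l1 l2].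
by apply/andP; split; lra.
Unshelve. all: by end_near. Qed.

End clt.

(** * From box sums to probabilities *)

Section frame_law.
Context {R : realType} {K : finType} {d : measure_display} {T : measurableType d}.
Variables (P : probability T R) (V : K -> {RV P >-> nat}) (v : K -> R).
Hypothesis indepV : mutually_independent V.
Hypothesis poissonV : forall k n, P (V k @^-1` [set n]) = (poisson_pmf (v k) n)%:E.
Local Notation frame := {ffun K -> nat}.

Let obs (t : T) : frame := [ffun k => V k t].
Let atom (w : frame) : set T := obs @^-1` [set w].

Let atomE w : atom w = \bigcap_k (V k @^-1` [set w k]).
Proof.
apply/seteqP; split => t /=.
  by rewrite /atom /= => <- k _ /=; rewrite ffunE.
by move=> tw; apply/ffunP => k; rewrite ffunE; exact: tw.
Qed.

Let measurable_pre k (A : set nat) : measurable (V k @^-1` A).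
Proof. by rewrite -[X in measurable X]setTI; exact: measurable_funP. Qed.

Let measurable_atom w : measurable (atom w).
Proof.
rewrite atomE; apply: fin_bigcap_measurable => // k _; exact: measurable_pre.
Qed.

Lemma frame_law w : P (atom w) = (frame_prob v w)%:E.
Proof.
rewrite atomE indepV//; congr EFin; apply: eq_bigr => k _.
by rewrite poissonV.
Qed.

Lemma measurable_frame_event (C : set frame) : measurable (obs @^-1` C).
Proof.
rewrite (_ : obs @^-1` C = \bigcup_(w : frame) (if w \in C then atom w else set0)).
  apply: countable_bigcupT_measurable; first exact: countableP.
  by move=> w; case: ifP.
apply/seteqP; split => t /=.
  by move=> Ct; exists (obs t) => //; rewrite mem_set.
by move=> [w _]; case: ifP => // /set_mem Cw; rewrite /atom /= => ->.
Qed.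

Let box_sum (N : nat) (G : frame -> R) (t : T) :
  (\sum_(w : {ffun K -> 'I_N}) (G (box_frame w))%:E * (\1_(atom (box_frame w)) t)%:E =
  (if [forall k, (obs t k < N)%N] then (G (obs t))%:E else 0))%E.
Proof.
case: ifPn => [/forallP tN|/forallPn[k kN]].
  pose w0 : {ffun K -> 'I_N} := [ffun k => Ordinal (tN k)].
  have w0E : box_frame w0 = obs t by apply/ffunP => k; rewrite !ffunE.
  rewrite (bigD1 w0)//= w0E indicE mem_set// mule1 big1 ?adde0// => w ww0.
  rewrite indicE memNset ?mule0// /atom /= -w0E => /ffunP e.
  move/eqP : ww0; apply; apply/ffunP => k; apply/val_inj.
  by have := e k; rewrite !ffunE /= => ->; rewrite ffunE.
apply: big1 => w _; rewrite indicE memNset ?mule0// /atom /= => e.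
by move: kN; rewrite e ffunE ltn_ord.
Qed.

Let box_integral (N : nat) (G : frame -> R) : (forall w, 0 <= G w) ->
  (\int[P]_t \sum_(w : {ffun K -> 'I_N}) (G (box_frame w))%:E * (\1_(atom (box_frame w)) t)%:E =
  (box_mean N v G)%:E)%E.
Proof.
move=> G0; rewrite ge0_integral_sum//; last 2 first.
- move=> w; apply: measurable_funeM; apply/measurable_EFinP; exact: measurable_indic.
- by move=> w t _; rewrite mule_ge0// lee_fin.
rewrite /box_mean -sumEFin; apply: eq_bigr => w _.
rewrite ge0_integralZl//; last 2 first.
- by apply/measurable_EFinP; exact: measurable_indic.
- by rewrite lee_fin.
rewrite integral_indic// setIT EFinM muleC -frame_law; exact: erefl.
Qed.

(** For nonnegative functions the truncation to a box only decreases the mean. *)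
Lemma box_mean_le_integral N (G : frame -> R) : (forall w, 0 <= G w) ->
  ((box_mean N v G)%:E <= \int[P]_t (G (obs t))%:E)%E.
Proof.
move=> G0; rewrite -box_integral//; apply: ge0_le_integral => //.
- move=> t _; apply: sume_ge0 => w _; by rewrite mule_ge0// lee_fin.
- apply: emeasurable_sum => w; apply: measurable_funeM; apply/measurable_EFinP.
  exact: measurable_indic.
- apply/measurable_EFinP;   have mG : measurable_fun setT (G \o obs : T -> R).
    by move=> _ A mA; rewrite setTI; exact: (measurable_frame_event (G @^-1` A)).
  exact: mG.
- by move=> t _; rewrite box_sum; case: ifP; rewrite lee_fin.
Qed.

(** The box mean of an indicator is the probability of the part of the event inside the
box, and the boxes increase to the whole space. *)
Lemma box_mean_event (C : set frame) :
  box_mean N v (\1_C) @[N --> \oo] --> fine (P (obs @^-1` C)).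
Proof.
pose E N := obs @^-1` (C `&` [set w | forall k, (w k < N)%N]).
have PE N : P (E N) = (box_mean N v (\1_C))%:E.
  rewrite -box_integral// -[E N]setIT -integral_indic//; last first.
    exact: measurable_frame_event.
  apply: eq_integral => t _; rewrite box_sum indicE.
  case: ifPn => [/forallP tN|/forallPn[k kN]].
    have [Ct|Ct] := pselect (C (obs t)); rewrite indicE.
      by rewrite !mem_set.
    by rewrite !memNset// => -[].
  by rewrite memNset// /E /= => -[_ /(_ k) h]; rewrite h in kN.
have cE : P (E N) @[N --> \oo] --> P (\bigcup_N E N).
  apply: nondecreasing_cvg_mu; first by move=> N; exact: measurable_frame_event.
    by apply: bigcupT_measurable => N; exact: measurable_frame_event.
  move=> m n mn; apply/subsetPset => t [Ct tm]; split => // k.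
  exact: leq_trans (tm k) mn.
have -> : obs @^-1` C = \bigcup_N E N.
  apply/seteqP; split => t /=; last by move=> [N _ []].
  move=> Ct; exists (\max_k obs t k).+1 => //; split => // k /=.
  by rewrite ltnS; exact: leq_bigmax.
rewrite -[P (\bigcup_N E N)]fineK in cE; last first.
  by apply: fin_num_measure; apply: bigcupT_measurable => N; exact: measurable_frame_event.
have := fine_cvg cE; rewrite /comp.
by under eq_fun do rewrite PE; apply.
Qed.
End frame_law.

(** * Calculus of several variables and regularity of log-rates *)

Section directional.
Context {R : realType} {n : nat}.
Implicit Types (x y v : 'rV[R]_n) (f : 'rV[R]_n -> R).
Local Notation e_ i := (@basis_vec R n i).

Lemma rV_coord_le x j : `|x 0 j| <= `|x|.
Proof.
rewrite [leRHS]/Num.norm/= mx_normrE.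
exact: (le_bigmax _ (fun ij : 'I_1 * 'I_n => `|x ij.1 ij.2|) (0, j)).
Qed.

Lemma rV_norm_le x c : 0 <= c -> (forall j, `|x 0 j| <= c) -> `|x| <= c.
Proof.
move=> c0 xc; rewrite [leLHS]/Num.norm/= mx_normrE.
by apply: bigmax_le => // -[i j] _ /=; rewrite ord1.
Qed.

Lemma is_derive_line f x v t a :
  is_derive (x + t *: v) v f a <-> is_derive t 1 (fun s => f (x + s *: v)) a.
Proof.
have E : (fun h => h^-1 *: ((f \o shift (x + t *: v)) (h *: v) - f (x + t *: v))) =
  (fun h => h^-1 *: (((fun s => f (x + s *: v)) \o shift t) (h *: (1 : R^o)) - f (x + t *: v))).
  apply/funext => h /=; congr (_ *: (f _ - _)).
  by rewrite [h *: 1]mulr1 scalerDl addrCA.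
split => -[d <-]; split; rewrite /derivable /derive ?E// -?E//.
Qed.

Lemma is_derive_comp_dir (phi : R -> R) f x v a b :
  is_derive (f x) 1 phi b -> is_derive x v f a ->
  is_derive x v (fun y => phi (f y)) (b * a).
Proof.
have xE : x = x + 0 *: v by rewrite scale0r addr0.
rewrite {1 2}xE => db /is_derive_line da; rewrite xE; apply/is_derive_line.
exact: is_derive1_compose db da.
Qed.

Lemma is_deriveM_dir f g x v a b : is_derive x v f a -> is_derive x v g b ->
  is_derive x v (fun y => f y * g y) (f x * b + g x * a).
Proof. by move=> df dg; exact: is_deriveM. Qed.

Lemma is_deriveD_dir f g x v a b : is_derive x v f a -> is_derive x v g b ->
  is_derive x v (fun y => f y + g y) (a + b).
Proof. by move=> df dg; exact: is_deriveD. Qed.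

Lemma is_derive_sum_fin (K : finType) (f : K -> 'rV[R]_n -> R) (df : K -> R) x v :
  (forall k, is_derive x v (f k) (df k)) ->
  is_derive x v (fun y => \sum_k f k y) (\sum_k df k).
Proof.
move=> fd; elim: (index_enum K) => [|k s IH].
  rewrite big_nil (_ : (fun _ => _) = cst 0); first exact: is_derive_cst.
  by apply/funext => y; rewrite big_nil.
rewrite big_cons (_ : (fun _ => _) = (fun y => f k y + \sum_(j <- s) f j y)).
  exact: is_deriveD_dir.
by apply/funext => y; rewrite big_cons.
Qed.

Lemma is_derive_coord x i j : is_derive x (e_ i) (fun y => y 0 j) ((i == j)%:R).
Proof.
have -> : x = x + 0 *: e_ i by rewrite scale0r addr0.
apply/is_derive_line.
apply: (is_derive1_ext (is_derive1_affine (0 : R) (i == j)%:R (x 0 j))) => // s.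
by rewrite !mxE eqxx /= [j == i]eq_sym mulrC.
Qed.

(** Partial derivatives are controlled, not the total derivative, so the segment from [x0]
to [x] is replaced by a path that changes one coordinate at a time and stays in
the sup-norm ball. *)
Lemma coordinate_mean_value f (df : 'I_n -> 'rV[R]_n -> R) x0 x B : 0 <= B ->
  (forall y, `|y - x0| <= `|x - x0| -> forall i,
     is_derive y (e_ i) f (df i y) /\ `|df i y| <= B) ->
  `|f x - f x0| <= n%:R * B * `|x - x0|.
Proof.
move=> B0 fB.
pose y m : 'rV[R]_n := \row_j (if (j < m)%N then x 0 j else x0 0 j).
have step m : (m < n)%N -> `|f (y m.+1) - f (y m)| <= B * `|x - x0|.
  move=> mn; pose i := Ordinal mn; pose s := x 0 i - x0 0 i.
  have sx : `|s| <= `|x - x0| by have := rV_coord_le (x - x0) i; rewrite !mxE.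
  have line t : `|t| <= `|s| -> `|y m + t *: e_ i - x0| <= `|x - x0|.
    move=> ts; apply: rV_norm_le => // j; rewrite !mxE eqxx/=.
    have [->|ji] := eqVneq j i.
      by rewrite ltnn mulr1 addrAC subrr add0r (le_trans ts).
    rewrite mulr0 addr0; case: ifP => _; last by rewrite subrr normr0.
    by have := rV_coord_le (x - x0) j; rewrite !mxE.
  have -> : y m.+1 = y m + s *: e_ i.
    apply/rowP => j; rewrite !mxE eqxx/= ltnS leq_eqVlt.
    have [->|ji] := eqVneq j i.
      by rewrite eqxx/= ltnn mulr1 /s addrC subrK.
    by rewrite (negbTE (_ : val j != m)) //= mulr0 addr0.
  have := @mean_value_le_norm _ (fun t => f (y m + t *: e_ i))
    (fun t => df i (y m + t *: e_ i)) `|s| s B (lexx _).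
  rewrite scale0r addr0 => h; apply: (le_trans (h _ _)).
  - by move=> t ts; apply/is_derive_line; case: (fB _ (line t ts) i).
  - by move=> t ts; case: (fB _ (line t ts) i).
  - by rewrite ler_wpM2l.
have H m : (m <= n)%N -> `|f (y m) - f (y 0%N)| <= m%:R * B * `|x - x0|.
  elim: m => [|m IH] mn; first by rewrite subrr normr0 !mul0r.
  rewrite (_ : f (y m.+1) - f (y 0%N) = (f (y m.+1) - f (y m)) + (f (y m) - f (y 0%N))); last by ring.
  rewrite (le_trans (ler_normD _ _))// -natr1 addrC !mulrDl mul1r lerD//; last exact: step.
  exact/IH/ltnW.
have := H n (leqnn n).
rewrite (_ : y n = x) 1?(_ : y 0%N = x0)//; apply/rowP => j; rewrite mxE//.
by rewrite ltn_ord.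
Qed.

End directional.

Section regularity.
Context {R : realType} {n : nat}.
Variables (x0 : 'rV[R]_n) (r : R).
Hypothesis r0 : 0 < r.
Implicit Types (x y v : 'rV[R]_n).
Local Notation e_ i := (@basis_vec R n i).
Local Notation near0 x := (`|x - x0| < r).

(** The functions [h1] and [h2] play the part of the first and second partial derivatives
of [h] on the ball of radius [r], and [c] bounds the third ones. *)
Definition jet3 (h : 'rV[R]_n -> R) (h1 : 'I_n -> 'rV[R]_n -> R) (h2 : 'I_n -> 'I_n -> 'rV[R]_n -> R)
    (c : R) := forall x, near0 x -> forall i j l,
  [/\ is_derive x (e_ l) h (h1 l x), is_derive x (e_ j) (h1 l) (h2 l j x),
      derivable (h2 l j) x (e_ i) & `|'D_(e_ i) (h2 l j) x| <= c].

Lemma near0_open x : near0 x -> \forall y \near x, near0 y.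
Proof.
move=> xr; near=> y.
rewrite (_ : y - x0 = (y - x) + (x - x0)); last by rewrite addrA subrK.
apply: le_lt_trans (ler_normD _ _) _; rewrite -ltrBrDr distrC.
by near: y; apply: cvgr_dist_lt; rewrite ?subr_gt0.
Unshelve. all: by end_near. Qed.

Lemma near0_refl : near0 x0. Proof. by rewrite subrr normr0. Qed.

Lemma jet3_ge0 h h1 h2 c (i : 'I_n) : jet3 h h1 h2 c -> 0 <= c.
Proof. by move=> /(_ _ near0_refl i i i)[_ _ _]; exact: le_trans. Qed.

Lemma jet3_lip h h1 h2 c l j x : jet3 h h1 h2 c -> near0 x ->
  `|h2 l j x - h2 l j x0| <= n%:R * c * `|x - x0|.
Proof.
move=> J xr; apply: (coordinate_mean_value (df := fun i => 'D_(e_ i) (h2 l j))).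
  exact: jet3_ge0 l J.
move=> y yx i; have [_ _ d b] := J y (le_lt_trans yx xr) i j l.
by split => //; exact: derivableP.
Qed.

Lemma jet3_bounded h h1 h2 c : jet3 h h1 h2 c -> exists2 C, 0 <= C &
  forall x, near0 x -> forall l j, [/\ `|h x| <= C, `|h1 l x| <= C & `|h2 l j x| <= C].
Proof.
move=> J.
pose C2 := \sum_l \sum_j `|h2 l j x0| + n%:R * `|c| * r.
have C20 : 0 <= C2.
  by rewrite addr_ge0// ?sumr_ge0// => [i _|]; rewrite ?sumr_ge0// !mulr_ge0// ltW.
have B2 x l j : near0 x -> `|h2 l j x| <= C2.
  move=> xr; rewrite -(subrK (h2 l j x0) (h2 l j x)) addrC.
  rewrite (le_trans (ler_normD _ _))// lerD//.
    rewrite (bigD1 l)//= (bigD1 j)//= -addrA lerDl addr_ge0// sumr_ge0// => i _.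
    by rewrite sumr_ge0.
  rewrite (le_trans (jet3_lip l j J xr))// ler_pM//; last exact: ltW.
    by rewrite mulr_ge0//; exact: jet3_ge0 l J.
  by rewrite ler_wpM2l// ler_norm.
pose C1 := \sum_l `|h1 l x0| + n%:R * C2 * r.
have C10 : 0 <= C1 by rewrite addr_ge0// ?sumr_ge0// !mulr_ge0// ltW.
have B1 x l : near0 x -> `|h1 l x| <= C1.
  move=> xr; rewrite -(subrK (h1 l x0) (h1 l x)) addrC.
  rewrite (le_trans (ler_normD _ _))// lerD//.
    by rewrite (bigD1 l)//= lerDl sumr_ge0.
  apply: (@le_trans _ _ (n%:R * C2 * `|x - x0|)).
    apply: (coordinate_mean_value (df := fun i => h2 l i)) => // y yx i.
    have yr := le_lt_trans yx xr; have [_ d _ _] := J y yr i i l.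
    by split => //; exact: B2.
  by rewrite ler_wpM2l ?mulr_ge0// ltW.
pose C0 := `|h x0| + n%:R * C1 * r.
have C00 : 0 <= C0 by rewrite addr_ge0// !mulr_ge0// ltW.
have B0 x : near0 x -> `|h x| <= C0.
  move=> xr; rewrite -(subrK (h x0) (h x)) addrC.
  rewrite (le_trans (ler_normD _ _))// lerD//.
  apply: (@le_trans _ _ (n%:R * C1 * `|x - x0|)).
    apply: (coordinate_mean_value (df := h1)) => // y yx i.
    have yr := le_lt_trans yx xr; have [d _ _ _] := J y yr i i i.
    by split => //; exact: B1.
  by rewrite ler_wpM2l ?mulr_ge0// ltW.
exists (C0 + (C1 + C2)); first by rewrite addr_ge0// addr_ge0.
move=> x xr l j; split.
- by rewrite (le_trans (B0 x xr))// lerDl addr_ge0.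
- by rewrite (le_trans (B1 x l xr))// addrCA lerDl addr_ge0.
- by rewrite (le_trans (B2 x l j xr))// addrA lerDr addr_ge0.
Qed.

Variables (g : 'rV[R]_n -> R).
Hypothesis g_gt0 : forall x, near0 x -> 0 < g x.

(** The functions whose derivatives are controlled are the logarithms of the rates; the
rate itself is recovered with the exponential. *)
Lemma is_derive_of_ln x i a : near0 x -> is_derive x (e_ i) (fun y => ln (g y)) a ->
  is_derive x (e_ i) g (g x * a).
Proof.
move=> xr d; apply: (near_eq_is_derive (f := fun y => expR (ln (g y)))).
  by apply: filterS (near0_open xr) => y yr; rewrite lnK// posrE g_gt0.
have := is_derive_comp_dir (is_derive_expR (ln (g x))) d.
by rewrite lnK// posrE g_gt0.
Qed.

Lemma smooth_of_ln h1 h2 c : jet3 (fun y => ln (g y)) h1 h2 c ->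
  exists2 C, 0 <= C & forall x, near0 x -> forall l,
   [/\ is_derive x (e_ l) g (g x * h1 l x),
       `|g x * h1 l x - g x0 * h1 l x0| <= C * `|x - x0| &
       `|g x - g x0 - \sum_i g x0 * h1 i x0 * (x - x0) 0 i| <= C * `|x - x0| ^+ 2].
Proof.
move=> J; have [C C0 B] := jet3_bounded J.
pose D := n%:R * (expR C * (C * C + C)).
have D0 : 0 <= D by rewrite !mulr_ge0 ?expR_ge0// addr_ge0// mulr_ge0.
have dg x l : near0 x -> is_derive x (e_ l) g (g x * h1 l x).
  by move=> xr; apply: is_derive_of_ln => //; have [] := J x xr l l l.
have lip x l : near0 x -> `|g x * h1 l x - g x0 * h1 l x0| <= D * `|x - x0|.
  move=> xr; apply: (coordinate_mean_value (f := fun x => g x * h1 l x)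
    (df := fun j x => g x * h2 l j x + h1 l x * (g x * h1 j x))).
    by rewrite mulr_ge0 ?expR_ge0// addr_ge0// mulr_ge0.
  move=> y yx j; have yr := le_lt_trans yx xr; have [_ d2 _ _] := J y yr j j l.
  split; first by apply: is_deriveM_dir => //; exact: dg.
  have [b0 b1 b2] := B y yr l j; have [_ b1' _] := B y yr j j.
  rewrite (_ : _ + _ = g y * (h1 l y * h1 j y + h2 l j y)); last by ring.
  rewrite normrM ler_pM//.
    rewrite gtr0_norm ?g_gt0// -[leLHS](lnK (_ : g y \in Num.pos)) ?posrE ?g_gt0//.
    by rewrite ler_expR (le_trans (ler_norm _)).
  by rewrite (le_trans (ler_normD _ _))// lerD// normrM ler_pM.
exists (D + n%:R * D); first by rewrite addr_ge0// mulr_ge0.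
move=> x xr l; split; first exact: dg.
  by rewrite (le_trans (lip x l xr))// ler_wpM2r// lerDl mulr_ge0.
pose L y := \sum_i g x0 * h1 i x0 * y 0 i.
have dL y i : is_derive y (e_ i) L (g x0 * h1 i x0).
  have -> : L = \sum_i (fun y : 'rV[R]_n => g x0 * h1 i x0 * y 0 i).
    by apply/funext => z; rewrite fct_sumE.
  apply: is_derive_eq.
    by apply: is_derive_sum => j; apply: is_deriveZ; exact: is_derive_coord.
  rewrite (bigD1 i)//= eqxx big1 => [|j ji]; first by rewrite addr0 /GRing.scale/= mulr1.
  by rewrite eq_sym (negbTE ji) scaler0.
have := @coordinate_mean_value R n (fun y => g y + (- L y))
  (fun i y => g y * h1 i y + - (g x0 * h1 i x0)) x0 x (D * `|x - x0|).
have -> : g x + - L x - (g x0 + - L x0) = g x - g x0 - \sum_i g x0 * h1 i x0 * (x - x0) 0 i.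
  have -> : \sum_i g x0 * h1 i x0 * (x - x0) 0 i = L x - L x0.
    by rewrite -sumrB; apply: eq_bigr => i _; rewrite !mxE mulrBr.
  by ring.
rewrite mulrA -mulrA -expr2 => H; apply: (le_trans (H _ _)).
- by rewrite mulr_ge0.
- move=> y yx i; have yr := le_lt_trans yx xr; split.
    by apply: is_deriveD_dir; exact: dg.
  by rewrite (le_trans (lip y i yr))// ler_wpM2l.
- by rewrite ler_wpM2r ?exprn_ge0// lerDr.
Qed.

Lemma norm_shift_le x i t : `|x + t *: e_ i - x0| <= `|x - x0| + `|t|.
Proof.
rewrite addrAC (le_trans (ler_normD _ _))// lerD2l.
apply: rV_norm_le => // j; rewrite !mxE eqxx normrM /=.
by case: (j == i); rewrite ?normr1 ?mulr1// normr0 mulr0.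
Qed.

(** If the gradient at [x] were large, a step of length [tau] against it would bring [h]
below its minimum. The second derivative in the direction of the step is small near
[x0] because it vanishes there, which is what makes the bound better than the
square-root bound for a nonnegative smooth function. *)
Lemma nonneg_gradient_le h h1 h2 c x i (tau : R) : jet3 h h1 h2 c ->
  (forall y, near0 y -> h x0 <= h y) -> h2 i i x0 = 0 ->
  0 < tau -> `|x - x0| + tau < r ->
  `|h1 i x| <= (h x - h x0) / tau + n%:R * c * (`|x - x0| + tau) * tau.
Proof.
move=> J hmin h20 t0 xt.
have c0 := jet3_ge0 i J.
pose S := n%:R * c * (`|x - x0| + tau).
have S0 : 0 <= S by rewrite !mulr_ge0// addr_ge0// ltW.
have near t : `|t| <= tau -> near0 (x + t *: e_ i).
  by move=> tt; apply: le_lt_trans (norm_shift_le x i t) _; rewrite (le_lt_trans _ xt)// lerD2l.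
have T t : `|t| = tau -> `|h (x + t *: e_ i) - h x - t * h1 i x| <= S * tau ^+ 2.
  move=> tt; rewrite -[in X in _ <= _ * X ^+ 2]tt.
  have := @taylor2_le R (fun t => h (x + t *: e_ i)) (fun t => h1 i (x + t *: e_ i))
    (fun t => h2 i i (x + t *: e_ i)) tau t S.
  rewrite scale0r addr0; apply.
  - by rewrite tt.
  - by move=> s st; apply/is_derive_line; have [] := J _ (near s st) i i i.
  - by move=> s st; apply/is_derive_line; have [] := J _ (near s st) i i i.
  - move=> s st; rewrite tt in st; have := jet3_lip i i J (near s st).
    rewrite h20 subr0 => /le_trans; apply.
    rewrite ler_wpM2l ?mulr_ge0//.
    by rewrite (le_trans (norm_shift_le x i s))// lerD2l.
have tN : `|- tau| = tau by rewrite normrN gtr0_norm.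
have tP : `|tau| = tau by rewrite gtr0_norm.
have := T _ tP; rewrite ler_norml => /andP[_ u1].
have := T _ tN; rewrite ler_norml => /andP[_ u2].
have m1 : h x0 <= h (x + tau *: e_ i) by apply: hmin; apply: near; rewrite tP.
have m2 : h x0 <= h (x + - tau *: e_ i) by apply: hmin; apply: near; rewrite tN.
have E : (h x - h x0) / tau + S * tau = (h x - h x0 + S * tau ^+ 2) / tau.
  by field; rewrite gt_eqF.
rewrite E ler_pdivlMr//.
have -> : `|h1 i x| * tau = `|tau * h1 i x| by rewrite normrM (gtr0_norm t0) mulrC.
by rewrite ler_norml; apply/andP; split; lra.
Qed.

(** Fermat: an interior minimum is critical. *)
Lemma jet3_critical h h1 h2 c i : jet3 h h1 h2 c ->
  (forall y, near0 y -> h x0 <= h y) -> h1 i x0 = 0.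
Proof.
move=> J hmin.
have nr t : t \in `](- r), r[ -> near0 (x0 + t *: e_ i).
  rewrite in_itv/= -ltr_norml => tr; apply: le_lt_trans (norm_shift_le x0 i t) _.
  by rewrite subrr normr0 add0r.
have d t : t \in `](- r), r[ -> is_derive t 1 (fun t => h (x0 + t *: e_ i)) (h1 i (x0 + t *: e_ i)).
  by move=> /nr tr; apply/is_derive_line; have [] := J _ tr i i i.
have z : (0 : R) \in `](- r), r[ by rewrite in_itv/= oppr_lt0 r0.
have rr : - r <= r by rewrite ge0_cp// ltW.
have [_ <-] : is_derive (0 : R) 1 (fun t : R => h (x0 + t *: e_ i)) 0.
  apply: (derive1_at_min rr _ z) => t tr; first by case: (d t tr).
  by rewrite scale0r addr0; apply: hmin; exact: nr.
by have [_ ->] := d 0 z; rewrite scale0r addr0.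
Qed.

(** Here [g] is the rate at intensity [1] of a pixel without signal at [x0], and
[I * (g y - g x0) + g x0] is its rate at intensity [I]. The log-rate at intensity
[I] has a second derivative [I * a] at its critical point [x0] and, for [t] fixed and
small, the Taylor expansion gives [I * (a t^2 / 2 - C t^3)] as a lower bound of a
quantity that grows only like [ln I]; hence [a <= 0], and [a >= 0] at a minimum. *)
Lemma zero_pixel_flat h1 h2 c (C : R) i : jet3 (fun y => ln (g y)) h1 h2 c ->
  (forall y, near0 y -> g x0 <= g y) ->
  (\forall I \near +oo, exists k1 k2,
     jet3 (fun y => ln (I * (g y - g x0) + g x0)) k1 k2 (C * I)) ->
  h2 i i x0 = 0.
Proof.
move=> J gmin [I0 [_ JI]]; set a := h2 i i x0.
have c0 := jet3_ge0 i J.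
have b0 : 0 < g x0 by apply: g_gt0; exact: near0_refl.
have arg_ge I y : 0 < I -> near0 y -> g x0 <= I * (g y - g x0) + g x0.
  by move=> Ip yr; rewrite lerDr mulr_ge0 ?(ltW Ip)// subr_ge0 gmin.
have hmin I : 0 < I -> forall y, near0 y ->
    ln (I * (g x0 - g x0) + g x0) <= ln (I * (g y - g x0) + g x0).
  move=> Ip y yr; rewrite subrr mulr0 add0r ler_ln ?posrE ?arg_ge//.
  exact: lt_le_trans (arg_ge I y Ip yr).
have h10 : h1 i x0 = 0.
  apply: (jet3_critical i J) => y yr.
  by rewrite ler_ln ?posrE ?g_gt0 ?gmin//; exact: near0_refl.
have near t : `|t| < r -> near0 (x0 + t *: e_ i).
  by move=> tr; apply: le_lt_trans (norm_shift_le x0 i t) _; rewrite subrr normr0 add0r.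
have taylor (I t : R) : I0 < I -> 0 < I -> `|t| < r ->
    `|ln (I * (g (x0 + t *: e_ i) - g x0) + g x0) - ln (g x0) - 2^-1 * t ^+ 2 * (I * a)|
    <= C * I * `|t| ^+ 3.
  move=> II0 Ip tr; have [k1 [k2 K]] := JI I II0.
  have k10 : k1 i x0 = 0 by apply: (jet3_critical i K); exact: hmin.
  have k20 : k2 i i x0 = I * a.
    have dg y : near0 y -> is_derive y (e_ i) g (g y * h1 i y).
      by move=> yr; apply: is_derive_of_ln => //; have [] := J y yr i i i.
    have darg y : near0 y ->
        is_derive y (e_ i) (fun y => g x0 - I * g x0 + I * g y) (I * (g y * h1 i y)).
      move=> yr; have da := is_derive1_affine (g y) I (g x0 - I * g x0).
      exact: is_derive_comp_dir da (dg y yr).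
    have argE y : I * (g y - g x0) + g x0 = g x0 - I * g x0 + I * g y by ring.
    have k1E y : near0 y -> I * (g y * h1 i y) = (g x0 - I * g x0 + I * g y) * k1 i y.
      move=> yr; have [[_ <-] _ _ _] := K y yr i i i.
      have ap : 0 < g x0 - I * g x0 + I * g y by rewrite -argE (lt_le_trans _ (arg_ge I y Ip yr)).
      have [_ dE] := is_derive_comp_dir (is_derive1_ln ap) (darg y yr).
      under eq_fun do rewrite argE.
      by rewrite dE [RHS]mulrA divff ?mul1r// gt_eqF.
    have [_ dk _ _] := K x0 near0_refl i i i.
    have [_ dh _ _] := J x0 near0_refl i i i.
    have [_ E1] := is_deriveM_dir (darg _ near0_refl) dk.
    have [_ E2] := is_deriveZ I (is_deriveM_dir (dg _ near0_refl) dh).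
    have E3 : 'D_(e_ i) (fun y => I * (g y * h1 i y)) x0 =
        'D_(e_ i) (fun y => (g x0 - I * g x0 + I * g y) * k1 i y) x0.
      by apply: near_eq_derive; apply: filterS (near0_open near0_refl) => y /k1E.
    move: E1; rewrite -E3 [LHS]E2 h10 k10 !mul0r !addr0 subrK /GRing.scale/= => E.
    by apply: (mulfI (lt0r_neq0 b0)); rewrite -E mulrCA.
  have := @taylor3_le R (fun t => ln (I * (g (x0 + t *: e_ i) - g x0) + g x0))
    (fun t => k1 i (x0 + t *: e_ i)) (fun t => k2 i i (x0 + t *: e_ i))
    (fun t => 'D_(e_ i) (k2 i i) (x0 + t *: e_ i)) `|t| t (C * I) (lexx _).
  rewrite scale0r addr0 k10 mulr0 subr0 k20 subrr mulr0 add0r; apply.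
  - by move=> s st; have [] := K _ (near s (le_lt_trans st tr)) i i i => + _ _ _; exact: (is_derive_line _ _ _ _ _).1.
  - by move=> s st; have [] := K _ (near s (le_lt_trans st tr)) i i i => _ + _ _; exact: (is_derive_line _ _ _ _ _).1.
  - move=> s st; have [_ _ dk _] := K _ (near s (le_lt_trans st tr)) i i i.
    by apply/is_derive_line; exact: derivableP.
  - by move=> s st; have [] := K _ (near s (le_lt_trans st tr)) i i i.
(* pick t so small that the cubic remainder is dominated *)
pose C' := 1 + `|C|.
have C'0 : 0 < C' by rewrite ltr_pwDl.
apply/eqP/negPn/negP => a_neq0.
have na0 : 0 < `|a| by rewrite normr_gt0.
pose t := Num.min (r / 2) (`|a| / (4 * C')).
have t0 : 0 < t by rewrite lt_min !divr_gt0// mulr_gt0.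
have tr : `|t| < r.
  by rewrite gtr0_norm// gt_min; apply/orP; left; rewrite ltr_pdivrMr// mulr_natr mulr2n ltrDl.
have ta : C' * t <= `|a| / 4.
  apply: (@le_trans _ _ (C' * (`|a| / (4 * C')))).
    by rewrite ler_wpM2l ?(ltW C'0)// ge_min lexx orbT.
  by rewrite le_eqVlt; apply/orP; left; apply/eqP; field; rewrite gt_eqF.
pose M := (g (x0 + t *: e_ i) - g x0) / g x0.
have M0 : 0 <= M by rewrite divr_ge0 ?subr_ge0 ?gmin ?near// ltW.
pose kap := t ^+ 2 * `|a| / 4.
have kap0 : 0 < kap by rewrite divr_gt0// mulr_gt0// exprn_gt0.
have main I : I0 < I -> 0 < I -> `|ln (1 + I * M) - 2^-1 * t ^+ 2 * (I * a)| <= I * kap.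
  move=> II0 Ip.
  have := taylor I t II0 Ip tr.
  have -> : I * (g (x0 + t *: e_ i) - g x0) + g x0 = (1 + I * M) * g x0.
    by rewrite /M; field; rewrite gt_eqF.
  have M1 : 0 < 1 + I * M by rewrite ltr_pwDl// mulr_ge0// ltW.
  rewrite lnM ?posrE// addrK (gtr0_norm t0) => /le_trans; apply.
  have CC : C <= C' by rewrite (le_trans (ler_norm _))// lerDr.
  apply: (@le_trans _ _ (I * t ^+ 2 * (C' * t))).
    rewrite (_ : C * I * t ^+ 3 = I * t ^+ 2 * (C * t)); last by ring.
    by rewrite ler_wpM2l ?mulr_ge0 ?exprn_ge0 ?(ltW Ip) ?(ltW t0)// ler_wpM2r// ltW.
  rewrite (_ : I * kap = I * t ^+ 2 * (`|a| / 4)); last by rewrite /kap; ring.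
  by rewrite ler_wpM2l ?mulr_ge0 ?exprn_ge0 ?(ltW Ip) ?(ltW t0).
pose I := 1 + `|I0| + 2 * M / kap ^+ 2.
have IM0 : 0 <= 2 * M / kap ^+ 2 by apply: divr_ge0; [exact: mulr_ge0|exact: exprn_ge0 (ltW kap0)].
have II0 : I0 < I by have := ler_norm I0; rewrite /I; lra.
have Ip : 0 < I by have := normr_ge0 I0; rewrite /I; lra.
have := main I II0 Ip; rewrite ler_norml => /andP[lo hi].
have lnM0 : 0 <= ln (1 + I * M) by rewrite ln_ge0// lerDl mulr_ge0// ltW.
have Ia : 2^-1 * t ^+ 2 * (I * a) = I * (2 * kap) * (a / `|a|).
  by rewrite /kap; field; rewrite gt_eqF.
have Ik : 0 < I * kap by rewrite mulr_gt0.
rewrite Ia in lo hi.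
have [a0|a0] := ltP a 0.
  (* a negative second derivative contradicts the minimum *)
  have e : a / `|a| = -1 by rewrite ltr0_norm// invrN mulrN divff// lt_eqF.
  rewrite e in hi; lra.
(* a positive one makes the logarithm grow linearly in I *)
have e : a / `|a| = 1 by rewrite ger0_norm// divff.
rewrite e in lo.
have le1 : I * kap <= ln (1 + I * M) by lra.
have : expR (I * kap) <= 1 + I * M.
  by rewrite -[leRHS]lnK ?ler_expR// posrE ltr_pwDl// mulr_ge0// ltW.
suff : 1 + I * M < expR (I * kap) by rewrite ltNge => /negP.
apply: lt_le_trans (expR_ge1Dxn 1 (ltW Ik)).
rewrite ltrD2l exprMn -mulrA expr2 -mulrA ltr_pM2l//.
rewrite (_ : 2`! = 2)%N// mulrA ltr_pdivlMr// mulrC -ltr_pdivrMr ?exprn_gt0//.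
by rewrite /I ltrDr ltr_pwDl.
Qed.

End regularity.

(** * Deterministic analysis of the likelihood maximizer *)

Section log_bound.
Context {R : realType}.

Lemma ln_le_sub1 (x : R) : 0 < x -> ln x <= x - 1.
Proof. by move=> x0; have := @le_ln1Dx R (x - 1); rewrite (addrC 1) subrK; apply; lra. Qed.

(** Hellinger form of the likelihood ratio: [ln (u / v) <= 2 (sqrt (u / v) - 1)] turns the
log-likelihood difference into a quadratic function of [sqrt u - sqrt v] with a
linear term proportional to the standardized count. *)
Lemma poisson_loglik_gap (w u v : R) : 0 <= w -> 0 < u -> 0 < v ->
  w * (ln u - ln v) - (u - v) <=
  - (Num.sqrt u - Num.sqrt v) ^+ 2 +
  2 * ((w - v) / Num.sqrt v) * (Num.sqrt u - Num.sqrt v).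
Proof.
move=> w0 u0 v0; set s := Num.sqrt u; set t := Num.sqrt v.
have s0 : 0 < s by rewrite sqrtr_gt0.
have t0 : 0 < t by rewrite sqrtr_gt0.
have uE : u = s ^+ 2 by rewrite sqr_sqrtr// ltW.
have vE : v = t ^+ 2 by rewrite sqr_sqrtr// ltW.
have lnE : ln u - ln v = 2 * ln (s / t).
  by rewrite uE vE !lnXn// ln_div ?posrE// -mulrnBl mulr_natl.
have l1 : ln (s / t) <= s / t - 1 by rewrite ln_le_sub1// divr_gt0.
rewrite lnE; apply: (@le_trans _ _ (w * (2 * (s / t - 1)) - (u - v))).
  by rewrite lerB// ler_wpM2l// ler_wpM2l.
by rewrite le_eqVlt uE vE; apply/orP; left; apply/eqP; field; rewrite gt_eqF.
Qed.
End log_bound.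

Section mle.
Context {R : realType} {n : nat} {K : finType}.
Variables (q : K -> 'rV[R]_n -> R) (b : K -> R) (Th : set 'rV[R]_n) (x0 : 'rV[R]_n).
Variables (g : K -> 'I_n -> 'rV[R]_n -> R) (r C c : R).
Variable labeled : 'rV[R]_n -> Prop.
Hypothesis r0 : 0 < r.
Hypothesis C0 : 0 <= C.
Hypothesis c0 : 0 <= c.
Hypothesis b_gt0 : forall k, 0 < b k.
Hypothesis ball_Th : forall x, `|x - x0| < r -> Th x.
Hypothesis q_ge0 : forall k x, Th x -> 0 <= q k x.
Hypothesis q_derive : forall k x, `|x - x0| < r -> forall l,
  is_derive x (@basis_vec R n l) (q k) (g k l x).
Hypothesis g_lip : forall k x, `|x - x0| < r -> forall l,
  `|g k l x - g k l x0| <= C * `|x - x0|.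
Hypothesis q_taylor : forall k x, `|x - x0| < r ->
  `|q k x - q k x0 - \sum_i g k i x0 * (x - x0) 0 i| <= C * `|x - x0| ^+ 2.
Hypothesis flat0 : forall k, q k x0 = 0 -> forall i, g k i x0 = 0.
Hypothesis flat : forall k, q k x0 = 0 -> forall i x (tau : R), 0 < tau ->
  `|x - x0| + tau < r -> `|g k i x| <= C * (q k x / tau + (`|x - x0| + tau) * tau).
Hypothesis injective_gradients : forall y : 'rV[R]_n,
  `|y| <= c * \sum_k `|\sum_i g k i x0 * y 0 i|.
Hypothesis identifiable : forall rho : R, 0 < rho -> exists2 eta : R, 0 < eta &
  forall x, Th x -> labeled x -> (forall k, `|q k x - q k x0| <= eta) -> `|x - x0| < rho.

Local Notation frame := {ffun K -> nat}.
Definition rate_at I k x := I * q k x + b k.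
Local Notation v I k := (rate_at I k x0).
Definition loglik_at I (w : frame) x :=
  \sum_k ((w k)%:R * ln (rate_at I k x) - rate_at I k x).
Local Notation excess I k w := ((w k)%:R - v I k).
Definition maximizer I w x := [/\ Th x, labeled x &
  forall y, Th y -> loglik_at I w y <= loglik_at I w x].
Definition typical (A I : R) (w : frame) := forall k, `|excess I k w / Num.sqrt (v I k)| <= A.

Lemma x0_near : `|x0 - x0| < r. Proof. by rewrite subrr normr0. Qed.

Lemma rate_gt0 I k x : 0 < I -> Th x -> 0 < rate_at I k x.
Proof. by move=> I0 Tx; rewrite ltr_wpDl// mulr_ge0 ?q_ge0// ltW. Qed.

(** Summing [poisson_loglik_gap] over the pixels, the maximizer satisfies
[sum_j y j ^ 2 <= 2 A sum_j |y j|], and completing the squares bounds each [y j]. *)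
Lemma sqrt_rate_close A I w x : 0 < I -> 0 <= A -> typical A I w -> maximizer I w x ->
  forall k, `|Num.sqrt (rate_at I k x) - Num.sqrt (v I k)| <= (1 + #|K|%:R) * A.
Proof.
move=> I0 A0 tw [Tx _ /(_ x0 (ball_Th x0_near)) mx] k.
pose y j := Num.sqrt (rate_at I j x) - Num.sqrt (v I j).
have S : \sum_j (`|y j| - A) ^+ 2 <= #|K|%:R * A ^+ 2.
  rewrite -subr_ge0 in mx.
  have : 0 <= \sum_j (- y j ^+ 2 + 2 * A * `|y j|).
    apply: (le_trans mx); rewrite -sumrB; apply: ler_sum => j _.
    have := @poisson_loglik_gap R (w j)%:R (rate_at I j x) (v I j) (ler0n _ _)
      (rate_gt0 j I0 Tx) (rate_gt0 j I0 (ball_Th x0_near)).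
    rewrite -/(y j) => h.
    rewrite (_ : _ - _ = (w j)%:R * (ln (rate_at I j x) - ln (v I j)) - (rate_at I j x - v I j));
      last by ring.
    rewrite (le_trans h)// lerD2l -(mulrA 2) -(mulrA 2 A) ler_wpM2l// (le_trans (ler_norm _))//.
    by rewrite normrM ler_wpM2r//; exact: tw.
  have -> : #|K|%:R * A ^+ 2 = \sum_(j : K) A ^+ 2 by rewrite sumr_const mulr_natl.
  move=> h; rewrite -subr_ge0 -sumrB; apply: le_trans h _.
  apply: ler_sum => j _; rewrite -[y j ^+ 2]real_normK ?num_real//.
  by rewrite le_eqVlt; apply/orP; left; apply/eqP; ring.
have : (`|y k| - A) ^+ 2 <= (#|K|%:R * A) ^+ 2.
  apply: (le_trans _ (le_trans S _)).
    by rewrite (bigD1 k)//= lerDl sumr_ge0// => j _; rewrite sqr_ge0.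
  rewrite exprMn ler_wpM2r ?sqr_ge0// -natrX ler_nat.
  by rewrite -{1}(expn1 #|K|) leq_pexp2l// -(cardsT K) card_gt0; apply/set0Pn; exists k; rewrite inE.
rewrite -ler_sqrt ?exprn_ge0 ?mulr_ge0// !sqrtr_sqr (ger0_norm (_ : 0 <= _ * A)) ?mulr_ge0//.
by rewrite ler_norml mulrDl mul1r => /andP[_]; rewrite lerBlDl.
Qed.

(** A bound, relative to [sqrt I], for the difference between the rates at the maximizer and at [x0]. *)
Definition spread A k := (1 + #|K|%:R) * A *
  (2 * Num.sqrt (q k x0 + b k) + (1 + #|K|%:R) * A).

Lemma spread_ge0 A k : 0 <= A -> 0 <= spread A k.
Proof. by move=> A0; rewrite /spread !mulr_ge0// addr_ge0// ?mulr_ge0// ?sqrtr_ge0. Qed.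

Lemma rate_close_sqrt A I w x k : 0 < I -> 0 <= A -> typical A I w -> maximizer I w x ->
  `|rate_at I k x - v I k| <= (1 + #|K|%:R) * A *
    (2 * Num.sqrt (v I k) + (1 + #|K|%:R) * A).
Proof.
move=> I0 A0 tw mx; have := sqrt_rate_close I0 A0 tw mx k.
have [Tx _ _] := mx.
have u0 := ltW (rate_gt0 k I0 Tx); have v0 := ltW (rate_gt0 k I0 (ball_Th x0_near)).
have t0 : 0 <= Num.sqrt (v I k) by exact: sqrtr_ge0.
have s0 : 0 <= Num.sqrt (rate_at I k x) by exact: sqrtr_ge0.
rewrite -{2}(sqr_sqrtr u0) -{2}(sqr_sqrtr v0).
move: t0 s0; set s := Num.sqrt _; set t := Num.sqrt _; set D := _ * A => t0 s0 st.
rewrite subr_sqr normrM ler_pM// ger0_norm ?addr_ge0//.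
by move: st; rewrite ler_norml => /andP[_]; lra.
Qed.

Lemma rate_close A (sg : R) w x k : 1 <= sg -> 0 <= A ->
  typical A (sg ^+ 2) w -> maximizer (sg ^+ 2) w x ->
  `|rate_at (sg ^+ 2) k x - v (sg ^+ 2) k| <= spread A k * sg.
Proof.
move=> s1 A0 tw mx; have s0 : 0 < sg by exact: lt_le_trans s1.
have I0 : 0 < sg ^+ 2 by rewrite exprn_gt0.
apply: (le_trans (rate_close_sqrt k I0 A0 tw mx)).
have q0 : 0 <= q k x0 by apply: q_ge0; apply: ball_Th; exact: x0_near.
have D0 : 0 <= (1 + #|K|%:R) * A by rewrite mulr_ge0.
rewrite /spread; set D := _ * A in D0 *.
clearbody D. rewrite -(mulrA D) ler_wpM2l// (mulrDl _ D sg) lerD//; last by rewrite ler_peMr.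
rewrite -(mulrA 2) ler_wpM2l// -{2}(ger0_norm (ltW s0)) -sqrtr_sqr -sqrtrM ?addr_ge0 ?(ltW (b_gt0 k))//.
rewrite ler_wsqrtr// /rate_at mulrDl [q k x0 * _]mulrC lerD2l (ler_peMr (ltW (b_gt0 k)))//.
by rewrite exprn_ege1.
Qed.

Lemma rate_close_flat A I w x k : 0 < I -> 0 <= A -> typical A I w -> maximizer I w x ->
  q k x0 = 0 -> `|rate_at I k x - v I k| <= spread A k.
Proof.
move=> I0 A0 tw mx q0; apply: (le_trans (rate_close_sqrt k I0 A0 tw mx)).
by rewrite /spread /rate_at q0 mulr0.
Qed.

(** Consistency first, then the rate: near [x0] the increments of the signals, which are
[O(1 / sqrt I)], determine [x - x0] up to a quadratic error that consistency absorbs. *)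
Lemma maximizer_close A : 0 <= A -> exists2 D, 0 <= D &
  \forall sg \near +oo, forall w x, typical A (sg ^+ 2) w -> maximizer (sg ^+ 2) w x ->
    `|x - x0| < r /\ `|x - x0| <= D / sg.
Proof.
move=> A0; pose B := \sum_k spread A k.
have B0 : 0 <= B by rewrite sumr_ge0// => k _; exact: spread_ge0.
pose m := c * (#|K|%:R * C).
have m0 : 0 <= m by rewrite !mulr_ge0.
(* With this radius the quadratic Taylor error is at most half of the distance itself. *)
pose rho := Num.min r (1 + 2 * m)^-1.
have rho0 : 0 < rho by rewrite lt_min r0 invr_gt0 ltr_pwDl// mulr_ge0.
have [eta eta0 id] := identifiable rho0.
exists (2 * (c * B)); first by rewrite !mulr_ge0.
near=> sg => w x tw mx.
have s1 : 1 <= sg by near: sg; apply: nbhs_pinfty_ge; rewrite num_real.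
have s0 : 0 < sg by exact: lt_le_trans s1.
have seta : B / eta <= sg by near: sg; apply: nbhs_pinfty_ge; rewrite num_real.
have qd k : `|q k x - q k x0| <= spread A k / sg.
  have := rate_close k s1 A0 tw mx.
  rewrite (_ : rate_at _ k x - _ = sg ^+ 2 * (q k x - q k x0)); last by rewrite /rate_at; ring.
  rewrite normrM (gtr0_norm (exprn_gt0 2 s0)) expr2 -mulrA mulrC ler_pM2r//.
  by rewrite ler_pdivlMr// mulrC.
have Tx : Th x by case: mx.
have Lx : labeled x by case: mx.
have xrho : `|x - x0| < rho.
  apply: id => // k; apply: (le_trans (qd k)).
  rewrite ler_pdivrMr// mulrC -ler_pdivrMr//; apply: le_trans seta.
  rewrite ler_pM2r ?invr_gt0// /B (bigD1 k)//= lerDl sumr_ge0// => j _; exact: spread_ge0.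
have xr : `|x - x0| < r by apply: lt_le_trans xrho _; rewrite ge_min lexx.
split => //; set d := `|x - x0|.
have d0 : 0 <= d by exact: normr_ge0.
have md : m * d <= 2^-1.
  have : d <= (1 + 2 * m)^-1 by rewrite ltW// (lt_le_trans xrho)// ge_min lexx orbT.
  move=> dm; apply: (@le_trans _ _ (m / (1 + 2 * m))); first by rewrite ler_wpM2l.
  by rewrite ler_pdivrMr ?ltr_pwDl ?mulr_ge0//; lra.
have : d <= c * (B / sg + #|K|%:R * (C * d ^+ 2)).
  apply: (le_trans (injective_gradients _)); rewrite ler_wpM2l//.
  rewrite /B mulr_suml mulr_natl -sumr_const -big_split/=; apply: ler_sum => k _.
  rewrite -[X in `|X|](subrK (q k x - q k x0)) (le_trans (ler_normD _ _))//.
  by rewrite addrC lerD// distrC; exact: q_taylor.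
rewrite mulrDr (_ : c * (#|K|%:R * _) = m * d * d); last by rewrite /m; ring.
move=> h; have h2 : m * d * d <= 2^-1 * d by rewrite ler_wpM2r.
rewrite -!mulrA; lra.
Unshelve. all: by end_near. Qed.

Local Notation e_ i := (@basis_vec R n i).

Lemma is_derive_loglik I w x i : 0 < I -> `|x - x0| < r ->
  is_derive x (e_ i) (loglik_at I w)
    (\sum_k ((w k)%:R - rate_at I k x) / rate_at I k x * (I * g k i x)).
Proof.
move=> I0 xr; apply: is_derive_sum_fin => k.
have u0 := rate_gt0 k I0 (ball_Th xr).
have dr : is_derive x (e_ i) (fun y => b k + I * q k y) (I * g k i x).
  exact: is_derive_comp_dir (is_derive1_affine (q k x) I (b k)) (q_derive k xr i).
have rE y : b k + I * q k y = rate_at I k y by rewrite addrC.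
rewrite -rE in u0 *.
have d1 := is_deriveZ (w k)%:R (is_derive_comp_dir (is_derive1_ln u0) dr).
have -> : (fun y => (w k)%:R * ln (rate_at I k y) - rate_at I k y) =
    ((w k)%:R \*: (fun y => ln (b k + I * q k y)) - (fun y => b k + I * q k y)).
  by apply/funext => y; rewrite -rE.
apply: (is_derive_eq (is_deriveB d1 dr)).
by rewrite rE /GRing.scale/=; field; rewrite -rE gt_eqF.
Qed.

Lemma stationary I w x i : 0 < I -> `|x - x0| < r -> maximizer I w x ->
  \sum_k ((w k)%:R - rate_at I k x) / rate_at I k x * (I * g k i x) = 0.
Proof.
move=> I0 xr [_ _ mx].
pose d := r - `|x - x0|.
have d0 : 0 < d by rewrite subr_gt0.
have nr t : t \in `](- d), d[ -> `|x + t *: e_ i - x0| < r.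
  rewrite in_itv/= -ltr_norml /d ltrBrDl; apply: le_lt_trans.
  exact: norm_shift_le.
have dl t : t \in `](- d), d[ -> is_derive t 1 (fun t => loglik_at I w (x + t *: e_ i))
    (\sum_k ((w k)%:R - rate_at I k (x + t *: e_ i)) / rate_at I k (x + t *: e_ i)
       * (I * g k i (x + t *: e_ i))).
  by move=> /nr tr; apply/is_derive_line; exact: is_derive_loglik.
have z : (0 : R) \in `](- d), d[ by rewrite in_itv/= oppr_lt0 d0.
have dd : - d <= d by lra.
have [_ E1] : is_derive (0 : R) 1 (fun t : R => loglik_at I w (x + t *: e_ i)) 0.
  apply: (derive1_at_max dd _ z) => t tr; first by case: (dl t tr).
  by rewrite scale0r addr0; apply: mx; apply: ball_Th; exact: nr.
by have [_] := dl 0 z; rewrite E1 scale0r addr0.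
Qed.

(** The contribution of one pixel to the difference between the linearized score equation
and the exact one; the exact contributions sum to zero at an interior maximizer. *)
Definition linear_gap I w x k i :=
  (excess I k w - I * \sum_j g k j x0 * (x - x0) 0 j) * (I * g k i x0 / v I k) -
  ((w k)%:R - rate_at I k x) / rate_at I k x * (I * g k i x).

Lemma excess_le A I w k : 0 < I -> typical A I w -> `|excess I k w| <= A * Num.sqrt (v I k).
Proof.
move=> I0 tw; have v0 := rate_gt0 k I0 (ball_Th x0_near).
have := tw k; rewrite normrM normfV (ger0_norm (sqrtr_ge0 _)) ler_pdivrMr//.
by rewrite sqrtr_gt0.
Qed.

(** The linear part vanishes at a dark pixel, and the exact term is [I] times a gradient.
In [flat] the free length [tau] is taken to be [la / sqrt I]: as [I * q k x] is
bounded, the gradient term is of order [sqrt I / la] up to a constant, and [la] is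
chosen large. *)
Lemma linear_gap_flat k i A D eps : q k x0 = 0 -> 0 <= A -> 0 <= D -> 0 < eps ->
  exists2 M, 0 <= M & \forall sg \near +oo, forall w x,
    typical A (sg ^+ 2) w -> maximizer (sg ^+ 2) w x -> `|x - x0| < r ->
    `|x - x0| <= D / sg -> `|linear_gap (sg ^+ 2) w x k i| <= eps * sg + M.
Proof.
move=> q0 A0 D0 eps0.
pose B := spread A k; have B0 : 0 <= B by exact: spread_ge0.
pose E := (A * Num.sqrt (b k) + B) / b k * C.
have AB0 : 0 <= A * Num.sqrt (b k) + B.
  by apply: addr_ge0 => //; apply: mulr_ge0 => //; exact: sqrtr_ge0.
have E0 : 0 <= E.
  by apply: mulr_ge0 => //; apply: divr_ge0 => //; exact: ltW.
(* Large enough for [E * B / la <= eps]. *)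
pose la := 1 + E * B / eps.
have la0 : 0 < la.
  by apply: ltr_pwDl => //; apply: divr_ge0; [exact: mulr_ge0 | exact: ltW].
have lae : E * B <= eps * la.
  rewrite /la mulrDr mulr1 [eps * (_ / _)]mulrC divfK ?gt_eqF//; lra.
have Dla : 0 <= D + la by rewrite addr_ge0// ltW.
exists (E * ((D + la) * la)).
  by apply: mulr_ge0 => //; apply: mulr_ge0 => //; exact: ltW.
clearbody la.
near=> sg => w x tw mx xr xD.
have s1 : 1 <= sg by near: sg; apply: nbhs_pinfty_ge; rewrite num_real.
have s0 : 0 < sg by exact: lt_le_trans s1.
have I0 : 0 < sg ^+ 2 by rewrite exprn_gt0.
have sr : (D + la) / r < sg by near: sg; apply: nbhs_pinfty_gt; rewrite num_real.
have Tx : Th x by case: mx.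
have vE : v (sg ^+ 2) k = b k by rewrite /rate_at q0 mulr0 add0r.
have u_ge : b k <= rate_at (sg ^+ 2) k x by rewrite lerDr mulr_ge0 ?q_ge0// ltW.
have u0 : 0 < rate_at (sg ^+ 2) k x by exact: lt_le_trans u_ge.
have mB := rate_close_flat I0 A0 tw mx q0.
have eA := excess_le k I0 tw; rewrite vE in mB eA.
rewrite /linear_gap flat0// mulr0 mul0r mulr0 sub0r normrN.
set u := rate_at _ _ _ in u_ge u0 mB *.
have wu : `|(w k)%:R - u| <= A * Num.sqrt (b k) + B.
  rewrite (_ : _ - u = ((w k)%:R - b k) - (u - b k)); last by ring.
  by rewrite (le_trans (ler_normB _ _))// lerD.
have t0 : 0 < la / sg by rewrite divr_gt0.
have tr : `|x - x0| + la / sg < r.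
  apply: (@le_lt_trans _ _ ((D + la) / sg)); first by rewrite mulrDl lerD2r.
  by rewrite ltr_pdivrMr// mulrC -ltr_pdivrMr.
have gx := flat q0 i t0 tr.
have qB : sg ^+ 2 * q k x <= B.
  have -> : sg ^+ 2 * q k x = u - b k by rewrite /u /rate_at addrK.
  exact: le_trans (ler_norm _) mB.
have Ig : sg ^+ 2 * `|g k i x| <= C * (B * sg / la + (D + la) * la).
  apply: (@le_trans _ _ (sg ^+ 2 * (C * (q k x / (la / sg) + (`|x - x0| + la / sg) * (la / sg))))).
    by rewrite ler_wpM2l// ltW.
  rewrite mulrCA ler_wpM2l// mulrDr lerD//.
    rewrite (_ : sg ^+ 2 * (q k x / (la / sg)) = (sg ^+ 2 * q k x) * (sg / la)); last first.
      by field; rewrite !gt_eqF.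
    by rewrite -(mulrA B) ler_wpM2r// divr_ge0 ?(ltW la0) ?(ltW s0).
  apply: (@le_trans _ _ (sg ^+ 2 * ((D / sg + la / sg) * (la / sg)))).
    by rewrite ler_wpM2l ?(ltW I0)// ler_wpM2r ?(ltW t0)// lerD2r.
  rewrite le_eqVlt; apply/orP; left; apply/eqP; field; rewrite gt_eqF//.
rewrite normrM normrM normfV (gtr0_norm u0) normrM (gtr0_norm I0).
apply: (@le_trans _ _ ((A * Num.sqrt (b k) + B) / b k * (C * (B * sg / la + (D + la) * la)))).
  apply: ler_pM => //; first by rewrite divr_ge0 ?(ltW u0).
    by rewrite mulr_ge0 ?(ltW I0).
  by apply: ler_pM => //; rewrite ?invr_ge0 ?(ltW u0)// lef_pV2 ?posrE.
rewrite mulrA -/E mulrDr lerD2r.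
rewrite (_ : E * (B * sg / la) = E * B / la * sg); last by field; rewrite gt_eqF.
by rewrite ler_wpM2r ?(ltW s0)// ler_pdivrMr.
Unshelve. all: by end_near. Qed.

(** At a bright pixel the rate is of order [I] and its relative error of order
[1 / sqrt I], so all second-order terms are bounded. *)
Lemma linear_gap_bright k i A D : 0 < q k x0 -> 0 <= A -> 0 <= D ->
  exists2 M, 0 <= M & \forall sg \near +oo, forall w x,
    typical A (sg ^+ 2) w -> maximizer (sg ^+ 2) w x -> `|x - x0| < r ->
    `|x - x0| <= D / sg -> `|linear_gap (sg ^+ 2) w x k i| <= M.
Proof.
move=> q0 A0 D0.
pose B := spread A k; have B0 : 0 <= B by exact: spread_ge0.
pose G := `|g k i x0| + C * r.
have G0 : 0 <= G by rewrite addr_ge0// mulr_ge0// ltW.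
pose E := A * Num.sqrt (q k x0 + b k) + B.
have E0 : 0 <= E by rewrite addr_ge0// mulr_ge0// sqrtr_ge0.
pose q_ := q k x0.
pose M1 := C * D ^+ 2 * `|g k i x0| / q_.
pose M2 := E * (C * D / q_ + 2 * G * B / q_ ^+ 2).
have q1 : 0 <= q_^-1 by rewrite invr_ge0 ltW.
exists (M1 + M2).
  apply: addr_ge0; first by apply: mulr_ge0 => //; do 2 apply: mulr_ge0 => //; exact: exprn_ge0.
  apply: mulr_ge0 => //; apply: addr_ge0; first by apply: mulr_ge0 => //; exact: mulr_ge0.
  by rewrite -exprVn; apply: mulr_ge0; [do 2 apply: mulr_ge0 => // | exact: exprn_ge0].
near=> sg => w x tw mx xr xD.
have s1 : 1 <= sg by near: sg; apply: nbhs_pinfty_ge; rewrite num_real.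
have s0 : 0 < sg by exact: lt_le_trans s1.
have sB : 2 * B / q_ <= sg by near: sg; apply: nbhs_pinfty_ge; rewrite num_real.
have I0 : 0 < sg ^+ 2 by rewrite exprn_gt0.
have Tx : Th x by case: mx.
have mB := rate_close k s1 A0 tw mx; rewrite -/B in mB.
have eA := excess_le k I0 tw.
rewrite /linear_gap.
set V := v (sg ^+ 2) k in mB eA *; set u := rate_at (sg ^+ 2) k x in mB *.
have V_ge : sg ^+ 2 * q_ <= V by rewrite /V /rate_at lerDl ltW.
have V_le : Num.sqrt V <= Num.sqrt (q k x0 + b k) * sg.
  rewrite -(ger0_norm (ltW s0)) -sqrtr_sqr -sqrtrM ?addr_ge0 ?(ltW q0) ?(ltW (b_gt0 k))//.
  rewrite ler_wsqrtr// /V /rate_at mulrDl [q k x0 * _]mulrC lerD2l.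
  by rewrite (ler_peMr (ltW (b_gt0 k)))// exprn_ege1.
have u_ge : sg ^+ 2 * q_ / 2 <= u.
  have : V - u <= B * sg by rewrite (le_trans (ler_norm _))// distrC.
  have : 2 * (B * sg) <= sg ^+ 2 * q_.
    rewrite (_ : sg ^+ 2 * q_ = sg * q_ * sg); last by ring.
    by rewrite mulrA ler_pM2r// -ler_pdivrMr.
  move: V_ge; lra.
have Q0 : 0 < sg ^+ 2 * q_ by rewrite mulr_gt0.
have V0 : 0 < V by exact: lt_le_trans V_ge.
have u0 : 0 < u by apply: lt_le_trans u_ge; rewrite divr_gt0.
have D2 : sg ^+ 2 * `|x - x0| ^+ 2 <= D ^+ 2.
  rewrite -exprMn lerXn2r ?nnegrE ?mulr_ge0 ?(ltW s0)//.
  by rewrite mulrC -ler_pdivlMr.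
set L := \sum_j _.
have mL : `|(u - V) - sg ^+ 2 * L| <= C * D ^+ 2.
  have -> : (u - V) - sg ^+ 2 * L = sg ^+ 2 * (q k x - q k x0 - L).
    by rewrite /u /V /rate_at; ring.
  rewrite normrM (gtr0_norm I0).
  apply: (@le_trans _ _ (sg ^+ 2 * (C * `|x - x0| ^+ 2))).
    by rewrite ler_wpM2l ?(ltW I0)//; exact: q_taylor.
  by rewrite mulrCA ler_wpM2l.
have em : `|(w k)%:R - u| <= E * sg.
  rewrite (_ : _ - u = ((w k)%:R - V) - (u - V)); last by ring.
  rewrite (le_trans (ler_normB _ _))// /E mulrDl lerD// (le_trans eA)//.
  by rewrite -mulrA ler_wpM2l.
have gx := g_lip k xr i.
have gG : `|g k i x| <= G.
  rewrite -[g k i x](subrK (g k i x0)) (le_trans (ler_normD _ _))// addrC /G lerD//.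
  by rewrite (le_trans gx)// ler_wpM2l// ltW.
have gD : `|g k i x0 - g k i x| <= C * D / sg.
  by rewrite distrC (le_trans gx)// -mulrA ler_wpM2l.
have -> : ((w k)%:R - V - sg ^+ 2 * L) * (sg ^+ 2 * g k i x0 / V) -
    ((w k)%:R - u) / u * (sg ^+ 2 * g k i x) =
    ((u - V) - sg ^+ 2 * L) * (g k i x0 * (sg ^+ 2 / V)) +
    ((w k)%:R - u) * ((g k i x0 - g k i x) * (sg ^+ 2 / V) +
      g k i x * (u - V) * (sg ^+ 2 / V) / u).
  by field; rewrite !gt_eqF.
have IV : `|sg ^+ 2 / V| <= q_^-1.
  rewrite ger0_norm ?divr_ge0 ?(ltW I0) ?(ltW V0)//.
  by rewrite ler_pdivrMr// mulrC ler_pdivlMr.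
have u1 : `|u^-1| <= 2 / (sg ^+ 2 * q_).
  rewrite normfV (gtr0_norm u0) -[leRHS]invrK lef_pV2 ?posrE ?invr_gt0 ?divr_gt0//.
  by rewrite invfM invrK mulrC.
apply: (le_trans (ler_normD _ _)); apply: lerD.
  have -> : M1 = C * D ^+ 2 * (`|g k i x0| * q_^-1) by rewrite /M1 [RHS]mulrA.
  by rewrite normrM; apply: ler_pM => //; rewrite normrM ler_wpM2l.
rewrite normrM.
have -> : M2 = E * sg * (C * D / sg * q_^-1 + G * (B * sg) * q_^-1 * (2 / (sg ^+ 2 * q_))).
  have q_0 : 0 < q_ by []. have q_n := lt0r_neq0 q_0. have s_n := lt0r_neq0 s0.
  by rewrite /M2; clearbody E G B q_; field; rewrite ?q_n ?s_n.
apply: ler_pM => //; apply: (le_trans (ler_normD _ _)); apply: lerD.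
  by rewrite normrM ler_pM.
by rewrite normrM ler_pM// normrM ler_pM// normrM ler_pM.
Unshelve. all: by end_near. Qed.

Lemma linear_gap_small k i A D eps : 0 <= A -> 0 <= D -> 0 < eps ->
  \forall sg \near +oo, forall w x,
    typical A (sg ^+ 2) w -> maximizer (sg ^+ 2) w x -> `|x - x0| < r ->
    `|x - x0| <= D / sg -> `|linear_gap (sg ^+ 2) w x k i| <= eps * sg.
Proof.
move=> A0 D0 eps0; have e2 : 0 < eps / 2 by rewrite divr_gt0.
suff [M M0 HM] : exists2 M, 0 <= M & \forall sg \near +oo, forall w x,
    typical A (sg ^+ 2) w -> maximizer (sg ^+ 2) w x -> `|x - x0| < r ->
    `|x - x0| <= D / sg -> `|linear_gap (sg ^+ 2) w x k i| <= eps / 2 * sg + M.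
  near=> sg => w x tw mx xr xD.
  have sM : M / (eps / 2) <= sg by near: sg; apply: nbhs_pinfty_ge; rewrite num_real.
  rewrite [leRHS](_ : _ = eps / 2 * sg + eps / 2 * sg); last first.
    by rewrite -mulrDl -splitr.
  apply: (@le_trans _ _ (eps / 2 * sg + M)); first by move: w x tw mx xr xD; near: sg.
  by rewrite lerD2l mulrC -ler_pdivrMr.
have [q0|q0] := eqVneq (q k x0) 0; first exact: linear_gap_flat.
have q1 : 0 < q k x0 by rewrite lt0r q0 q_ge0//; apply: ball_Th; exact: x0_near.
have [M M0 HM] := linear_gap_bright i q1 A0 D0; exists M => //.
near=> sg => w x tw mx xr xD; apply: (@le_trans _ _ M); first by move: w x tw mx xr xD; near: sg.
rewrite lerDr mulr_ge0 ?(ltW e2)//; near: sg; apply: nbhs_pinfty_ge; rewrite num_real.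
Unshelve. all: by end_near. Qed.

Lemma linearized_score A eps : 0 <= A -> 0 < eps ->
  \forall sg \near +oo, forall w x,
    typical A (sg ^+ 2) w -> maximizer (sg ^+ 2) w x -> forall i,
    `|\sum_k (excess (sg ^+ 2) k w - sg ^+ 2 * \sum_j g k j x0 * (x - x0) 0 j) *
       (sg ^+ 2 * g k i x0 / v (sg ^+ 2) k)| <= eps * sg.
Proof.
move=> A0 eps0; have [D D0 close] := maximizer_close A0.
have e0 : 0 < eps / (1 + #|K|%:R) by rewrite divr_gt0// ltr_pwDl.
have gaps : \forall sg \near +oo, forall k i w x,
    typical A (sg ^+ 2) w -> maximizer (sg ^+ 2) w x -> `|x - x0| < r ->
    `|x - x0| <= D / sg -> `|linear_gap (sg ^+ 2) w x k i| <= eps / (1 + #|K|%:R) * sg.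
  by apply: filter_forall => k; apply: filter_forall => i; exact: linear_gap_small.
near=> sg => w x tw mx i.
have s0 : 0 < sg by near: sg; apply: nbhs_pinfty_gt; rewrite num_real.
have I0 : 0 < sg ^+ 2 by rewrite exprn_gt0.
have [xr xD] : `|x - x0| < r /\ `|x - x0| <= D / sg by move: w x tw mx; near: sg.
rewrite -[X in `|X|]subr0 -[X in `|_ - X|](stationary i I0 xr mx) -sumrB.
apply: (le_trans (ler_norm_sum _ _ _)).
apply: (@le_trans _ _ (\sum_(k : K) eps / (1 + #|K|%:R) * sg)).
  apply: ler_sum => k _; rewrite -/(linear_gap (sg ^+ 2) w x k i).
  by move: k i w x tw mx xr xD; near: sg.
rewrite sumr_const -[_ *+ _]mulr_natr mulrAC; apply: ler_wpM2r; first exact: ltW.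
by rewrite mulrAC ler_pdivrMr ?ltr_pwDl// ler_wpM2l ?(ltW eps0)// lerDr.
Unshelve. all: by end_near. Qed.

End mle.

(** * The information matrix at large intensity *)

Section posdef_bounds.
Context {R : realType} {n : nat}.
Implicit Types (A : 'M[R]_n) (x : 'rV[R]_n).

Lemma mxsquare_norm A x : A^T = A -> (x *m (A *m A) *m x^T) 0 0 = \sum_j (x *m A) 0 j ^+ 2.
Proof. by move=> As; rewrite -row_sqr trmx_mul As !mulmxA. Qed.

Lemma coord_sqr_le x j : x 0 j ^+ 2 <= \sum_i x 0 i ^+ 2.
Proof. by rewrite (bigD1 j)//= lerDl sumr_ge0// => i _; rewrite sqr_ge0. Qed.

Lemma sqrtmx_unit A : posdefmx A -> sqrtmx A \in unitmx.
Proof.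
move=> pA; have [_ SS] := sqrtmxP pA.
by have := posdefmx_unit pA; rewrite -{1}SS unitmx_mul => /andP[].
Qed.

(** Through the square root [S]: each coordinate of [x] is a combination of the
coordinates of [x S]. *)
Lemma posdefmx_coercive A : posdefmx A -> exists2 kappa, 0 < kappa &
  forall x, kappa * \sum_j x 0 j ^+ 2 <= (x *m A *m x^T) 0 0.
Proof.
move=> pA; have [[Ss _] SS] := sqrtmxP pA.
have Su := sqrtmx_unit pA; set S := sqrtmx A in Ss SS Su *.
pose c := 1 + \sum_j (\sum_i `|invmx S i j|) ^+ 2.
have c0 : 0 < c by rewrite ltr_pwDl// sumr_ge0// => j _; rewrite sqr_ge0.
exists c^-1; first by rewrite invr_gt0.
move=> x; rewrite -SS mxsquare_norm//; set Y := \sum_j (x *m S) 0 j ^+ 2.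
have Y0 : 0 <= Y by rewrite sumr_ge0// => j _; rewrite sqr_ge0.
rewrite mulrC ler_pdivrMr//; apply: (@le_trans _ _ (\sum_j Y * (\sum_i `|invmx S i j|) ^+ 2)).
  apply: ler_sum => j _; rewrite -(sqr_sqrtr Y0) -exprMn -[x 0 j ^+ 2]real_normK ?num_real//.
  rewrite lerXn2r ?nnegrE ?mulr_ge0 ?sqrtr_ge0 ?sumr_ge0//.
  rewrite -{1}(mulmxK Su x) mxE (le_trans (ler_norm_sum _ _ _))// mulr_sumr.
  apply: ler_sum => i _; rewrite normrM ler_wpM2r//.
  rewrite -sqrtr_sqr ler_wsqrtr//. exact: coord_sqr_le.
by rewrite -mulr_sumr ler_wpM2l// lerDr.
Qed.
End posdef_bounds.

Section information.
Context {R : realType} {n : nat} {K : finType}.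
Variables (q b : K -> R) (g : K -> 'rV[R]_n).
Hypothesis q_ge0 : forall k, 0 <= q k.
Hypothesis b_gt0 : forall k, 0 < b k.
Hypothesis flat : forall k, q k = 0 -> g k = 0.
Local Notation v I k := (I * q k + b k).
Definition info I : 'M[R]_n := \sum_k (v I k)^-1 *: ((I *: g k)^T *m (I *: g k)).
Local Notation S I := (sqrtmx (info I)).
Hypothesis info_pd : forall I, 0 < I -> posdefmx (info I).

Let v_gt0 I k : 0 < I -> 0 < v I k.
Proof. by move=> I0; rewrite ltr_wpDl// mulr_ge0// ltW. Qed.

Lemma info_form I (x : 'rV[R]_n) : (x *m info I *m x^T) 0 0 =
  \sum_k (v I k)^-1 * (I * \sum_i g k 0 i * x 0 i) ^+ 2.
Proof.
rewrite /info mulmx_sumr mulmx_suml summxE; apply: eq_bigr => k _.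
rewrite -scalemxAr -scalemxAl mxE; congr (_ * _).
have -> : x *m ((I *: g k)^T *m (I *: g k)) *m x^T =
    (x *m (I *: g k)^T) *m (x *m (I *: g k)^T)^T by rewrite trmx_mul trmxK !mulmxA.
rewrite mxE big_ord1 [X in _ * X]mxE -expr2; congr (_ ^+ 2).
by rewrite mxE mulr_sumr; apply: eq_bigr => i _; rewrite !mxE; ring.
Qed.

Lemma info_coercive : exists2 kappa, 0 < kappa & forall I, 1 <= I -> forall x : 'rV[R]_n,
  kappa * I * \sum_j x 0 j ^+ 2 <= (x *m info I *m x^T) 0 0.
Proof.
have [kappa k0 H] := posdefmx_coercive (info_pd ltr01); exists kappa => // I I1 x.
have I0 : 0 < I by exact: lt_le_trans I1.
rewrite mulrAC; apply: (@le_trans _ _ ((x *m info 1 *m x^T) 0 0 * I)).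
  by rewrite ler_wpM2r// ltW.
rewrite !info_form mulr_suml; apply: ler_sum => k _; set a := \sum_i _.
have := v_gt0 k I0; have := v_gt0 k (@ltr01 R); rewrite !mul1r => v1 vI.
rewrite (_ : (I * q k + b k)^-1 * _ = a ^+ 2 * I * (I / (I * q k + b k))); last by ring.
rewrite [leLHS](_ : _ = a ^+ 2 * I * (q k + b k)^-1); last by ring.
apply: ler_wpM2l; first by rewrite mulr_ge0 ?sqr_ge0// ltW.
rewrite ler_pdivlMr// mulrC ler_pdivrMr// mulrDr lerD2l.
by rewrite ler_peMl// ltW.
Qed.

(** For [y] a row of the inverse, [y F y^T] is a coordinate of [y]; coercivity
then bounds [kappa * I * |y|^2] by [|y|]. *)
Lemma info_invmx_le : exists2 kappa, 0 < kappa & forall I, 1 <= I ->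
  forall i j, `|invmx (info I) i j| <= (kappa * I)^-1.
Proof.
have [kappa k0 H] := info_coercive; exists kappa => // I I1 i j.
have I0 : 0 < I by exact: lt_le_trans I1.
have kI : 0 < kappa * I by rewrite mulr_gt0.
pose y := row i (invmx (info I)).
have yi l : y 0 l = invmx (info I) i l by rewrite mxE.
have := H I I1 y; rewrite {1}/y -row_mul mulVmx ?posdefmx_unit//; last exact: info_pd.
have -> : (row i 1%:M *m y^T) 0 0 = y 0 i by rewrite row1 -rowE !mxE.
rewrite -(yi j); set Y := \sum_j _ => h.
have Y0 : 0 <= Y by rewrite sumr_ge0// => l _; rewrite sqr_ge0.
have jY : `|y 0 j| ^+ 2 <= Y by rewrite real_normK ?num_real// coord_sqr_le.
have iY := coord_sqr_le y i; rewrite -/Y in iY.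
have YY : (kappa * I * Y) ^+ 2 <= Y.
  by apply: le_trans iY; rewrite lerXn2r ?nnegrE ?mulr_ge0 ?(ltW k0) ?(ltW I0)//; apply: le_trans h; rewrite mulr_ge0 ?(ltW kI).
have [Y1|Y1] := eqVneq Y 0.
  have -> : y 0 j = 0.
    by apply/eqP; rewrite -normr_eq0 -sqrf_eq0 eq_le sqr_ge0 andbT -Y1.
  by rewrite normr0 invr_ge0 ltW.
have Yp : 0 < Y by rewrite lt0r Y1.
rewrite -[leRHS]ger0_norm ?invr_ge0 ?(ltW kI)// -ler_sqr ?nnegrE//.
rewrite !real_normK ?num_real//; apply: (le_trans (coord_sqr_le y j)).
rewrite exprVn -[leRHS]mul1r ler_pdivlMr ?exprn_gt0//.
by rewrite -(ler_pM2r Yp) mul1r -mulrA [_ * Y]mulrC mulrA -expr2 mulrC -exprMn.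
Qed.

(** [|u S|^2 = u F u^T]. *)
Lemma sqrtmx_expands : exists2 kappa, 0 < kappa & forall I, 1 <= I -> forall u : 'rV[R]_n,
  kappa * I * \sum_j u 0 j ^+ 2 <= \sum_j (u *m S I) 0 j ^+ 2.
Proof.
have [kappa k0 H] := info_coercive; exists kappa => // I I1 u.
have pI : posdefmx (info I) by apply: info_pd; exact: lt_le_trans I1.
have [[Ss _] SS] := sqrtmxP pI.
by rewrite -mxsquare_norm// SS; exact: H.
Qed.

(** The gradient of the rate, standardized and multiplied by [F(I)^(-1/2)]. *)
Definition whitened I k i : R := (I / Num.sqrt (v I k)) * (g k *m invmx (S I)) 0 i.

Lemma whitened_orth I : 0 < I -> forall i j,
  \sum_k whitened I k i * whitened I k j = (i == j)%:R.
Proof.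
move=> I0 i j; have pI := info_pd I0; have [[Ss _] SS] := sqrtmxP pI.
have Su := sqrtmx_unit pI.
have : (invmx (S I))^T *m info I *m invmx (S I) = 1%:M.
  by rewrite -{2}SS trmx_inv Ss mulmxA mulVmx// mul1mx mulmxV.
move=> /matrixP/(_ i j); rewrite [RHS]mxE => <-.
rewrite /info mulmx_sumr mulmx_suml summxE; apply: eq_bigr => k _.
rewrite -scalemxAr -scalemxAl mxE.
have -> : (invmx (S I))^T *m ((I *: g k)^T *m (I *: g k)) *m invmx (S I) =
   ((I *: g k) *m invmx (S I))^T *m ((I *: g k) *m invmx (S I)) by rewrite trmx_mul !mulmxA.
rewrite mxE big_ord1 -scalemxAl /whitened !mxE.
have v0 := v_gt0 k I0; rewrite -[in RHS](sqr_sqrtr (ltW v0)).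
by field; rewrite gt_eqF// sqrtr_gt0.
Qed.

Lemma whitened_or k : (forall I, 0 < I -> forall i, whitened I k i = 0) \/
  v I k @[I --> +oo] --> +oo.
Proof.
have [q0|q0] := eqVneq (q k) 0; [left|right].
  by move=> I I0 i; rewrite /whitened flat// mul0mx mxE mulr0.
have qp : 0 < q k by rewrite lt0r q0 q_ge0.
apply/cvgryPge => A; near=> I.
rewrite -lerBlDr -ler_pdivrMr//; near: I; apply: nbhs_pinfty_ge; rewrite num_real.
Unshelve. all: by end_near. Qed.

Lemma lambda_min_info : (0 < n)%N -> lambda_min (info I) @[I --> +oo] --> +oo.
Proof.
move=> n0; have [kappa k0 H] := info_coercive.
apply/cvgryPge => A; near=> I.
have I1 : 1 <= I by near: I; apply: nbhs_pinfty_ge; rewrite num_real.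
have IA : A / kappa <= I by near: I; apply: nbhs_pinfty_ge; rewrite num_real.
apply: (@le_trans _ _ (kappa * I)); first by rewrite mulrC -ler_pdivrMr.
apply: lb_le_inf.
  have [Fs _] := info_pd (lt_le_trans ltr01 I1).
  by have [a Ha] := symmetric_eigenvalue n0 Fs; exists a.
move=> a; apply: eigenvalue_rayleigh => x; rewrite row_sqr; exact: H.
Unshelve. all: by end_near. Qed.

Lemma invmx_info : invmx (info I) @[I --> +oo] --> (0 : 'M[R]_n).
Proof.
have [kappa k0 H] := info_invmx_le.
apply/cvgrPdist_le => eps eps0; near=> I.
have I1 : 1 <= I by near: I; apply: nbhs_pinfty_ge; rewrite num_real.
have Ie : eps^-1 / kappa <= I by near: I; apply: nbhs_pinfty_ge; rewrite num_real.
rewrite sub0r normrN [leLHS]/Num.norm/= mx_normrE; apply: bigmax_le => [|[i j] _ /=].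
  exact: ltW.
apply: (le_trans (H I I1 i j)).
have I0 : 0 < I by exact: lt_le_trans I1.
have kI : 0 < kappa * I by rewrite mulr_gt0.
by rewrite -[eps]invrK lef_pV2 ?posrE ?invr_gt0// mulrC -ler_pdivrMr.
Unshelve. all: by end_near. Qed.

(** The quadratic form of [info 1] is a weighted sum of the squares of the directional
derivatives, and it is coercive. *)
Lemma gradients_separate : exists2 c, 0 <= c & forall y : 'rV[R]_n,
  `|y| <= c * \sum_k `|\sum_i g k 0 i * y 0 i|.
Proof.
have [kappa k0 H] := info_coercive.
pose B := \sum_k (v 1 k)^-1.
have vi k : 0 <= (v 1 k)^-1 by rewrite invr_ge0 ltW// v_gt0.
have B0 : 0 <= B by rewrite sumr_ge0.
have Bk : 0 <= B / kappa by rewrite divr_ge0// ltW.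
exists (Num.sqrt (B / kappa)); first exact: sqrtr_ge0.
move=> y; set A := \sum_k `|_|.
have A0 : 0 <= A by rewrite sumr_ge0.
apply: rV_norm_le => [|j]; first by rewrite mulr_ge0// sqrtr_ge0.
rewrite -(@ler_pXn2r _ 2)// ?nnegrE ?mulr_ge0 ?sqrtr_ge0//.
rewrite exprMn sqr_sqrtr// real_normK ?num_real//.
apply: (le_trans (coord_sqr_le y j)).
rewrite mulrAC ler_pdivlMr// mulrC -[kappa]mulr1; apply: (le_trans (H 1 (lexx _) y)).
rewrite info_form mulr_suml; apply: ler_sum => k _; rewrite ler_wpM2l// mul1r.
rewrite -[leLHS]real_normK ?num_real// lerXn2r ?nnegrE//.
by rewrite /A (bigD1 k)//= lerDl sumr_ge0.
Qed.

(** Here [rho] is the error in the linearized likelihood equation [z = x F + rho]; multiply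
by the inverse of the square root of [F]. *)
Lemma whitened_error I (w : {ffun K -> nat}) (x rho : 'rV[R]_n) : 0 < I ->
  (forall i, rho 0 i = \sum_k ((w k)%:R - v I k - I * \sum_j g k 0 j * x 0 j) *
     (I * g k 0 i / v I k)) ->
  forall i, score (fun I k => v I k) whitened I w i =
    (x *m S I) 0 i + (rho *m invmx (S I)) 0 i.
Proof.
move=> I0 rhoE i; have pI := info_pd I0; have [[Ss _] SS] := sqrtmxP pI.
have Su := sqrtmx_unit pI.
pose z : 'rV[R]_n := \sum_k (((w k)%:R - v I k) / v I k) *: (I *: g k).
have zE : z = x *m info I + rho.
  apply/rowP => j; rewrite [RHS]mxE rhoE /z /info mulmx_sumr !summxE -big_split/=.
  apply: eq_bigr => k _.
  have gE : (x *m (I *: g k)^T *m (I *: g k)) 0 j =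
      I * (\sum_l g k 0 l * x 0 l) * (I * g k 0 j).
    rewrite mxE big_ord1 [X in X * _]mxE [X in _ * X]mxE mulr_sumr; congr (_ * _).
    by apply: eq_bigr => l _; rewrite !mxE; ring.
  rewrite -scalemxAr mulmxA [(_ *: (x *m _ *m _)) 0 j]mxE gE.
  rewrite [(_ *: (I *: g k)) 0 j]mxE [(I *: g k) 0 j]mxE.
  by field; rewrite gt_eqF// v_gt0.
have -> : (x *m S I) 0 i + (rho *m invmx (S I)) 0 i = (z *m invmx (S I)) 0 i.
  have xS : x *m info I *m invmx (S I) = x *m S I by rewrite -{1}SS mulmxA mulmxK.
  by rewrite zE mulmxDl [RHS]mxE xS.
rewrite /z mulmx_suml summxE; apply: eq_bigr => k _.
rewrite -!scalemxAl /dev /whitened !mxE.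
have v0 := v_gt0 k I0.
have -> (e : R) : e / (I * q k + b k) = e / Num.sqrt (I * q k + b k) ^+ 2.
  by rewrite sqr_sqrtr ?(ltW v0).
by field; rewrite gt_eqF// sqrtr_gt0.
Qed.

Lemma whitened_small (eta : R) : 0 < eta -> exists2 eps, 0 < eps &
  forall I (rho : 'rV[R]_n), 1 <= I -> (forall i, `|rho 0 i| <= eps * Num.sqrt I) ->
    forall i, `|(rho *m invmx (S I)) 0 i| <= eta.
Proof.
move=> eta0; have [kappa k0 H] := sqrtmx_expands.
pose s := Num.sqrt (kappa / (1 + n%:R)).
have n1 : 0 < 1 + n%:R :> R by rewrite ltr_pwDl.
have kn : 0 < kappa / (1 + n%:R) by rewrite divr_gt0.
have s0 : 0 < s by rewrite sqrtr_gt0.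
exists (eta * s); first by rewrite mulr_gt0.
move=> I rho I1 Hr i; have I0 : 0 < I by exact: lt_le_trans I1.
have pI := info_pd I0; have Su := sqrtmx_unit pI.
have := H I I1 (rho *m invmx (S I)); rewrite mulmxKV// => h.
have := coord_sqr_le (rho *m invmx (S I)) i; set u := (rho *m _) 0 i => hu.
rewrite -(@ler_pXn2r _ 2)// ?nnegrE ?(ltW eta0)// real_normK ?num_real//.
apply: (le_trans hu); rewrite -(ler_pM2l (mulr_gt0 k0 I0)); apply: (le_trans h).
apply: (@le_trans _ _ (\sum_(j < n) (eta * s * Num.sqrt I) ^+ 2)).
  apply: ler_sum => j _; have t0 : 0 <= eta * s * Num.sqrt I.
    by apply: mulr_ge0; [apply: mulr_ge0; exact: ltW | exact: sqrtr_ge0].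
  by rewrite -[leLHS]real_normK ?num_real// lerXn2r ?nnegrE.
rewrite sumr_const card_ord !exprMn /s !sqr_sqrtr ?(ltW kn) ?(ltW I0)// -[leLHS]mulr_natr.
have -> : eta ^+ 2 * (kappa / (1 + n%:R)) * I * n%:R = kappa * I * eta ^+ 2 * (n%:R / (1 + n%:R)).
  by field; rewrite gt_eqF.
rewrite ler_piMr ?mulr_ge0 ?(ltW k0) ?(ltW I0) ?sqr_ge0 ?(ltW eta0)//.
by rewrite ler_pdivrMr// mul1r lerDr.
Qed.
End information.

(** * Frames that differ by one count *)

Section adjacent.
Context {R : realType} {K : finType}.
Local Notation frame := {ffun K -> nat}.

Definition one_more (k : K) (w : frame) : frame := [ffun j => w j + (j == k)]%N.

(** The Poisson recursion [p (n + 1) = v / (n + 1) * p n] at [n = 0]. *)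
Lemma frame_prob_one_more (v : K -> R) k (w : frame) : 0 < v k -> w k = 0%N ->
  frame_prob v (one_more k w) = v k * frame_prob v w.
Proof.
move=> v0 wk; rewrite /frame_prob (bigD1 k)//= [in RHS](bigD1 k)//= mulrA; congr (_ * _).
  by rewrite ffunE eqxx wk add0n poisson_pmfS// mul1r.
by apply: eq_bigr => j /negPf jk; rewrite ffunE jk addn0.
Qed.

(** The frames with count [0] in pixel [k] and those with count [1] are in bijection and
disjoint. *)
Lemma box_mean_one_more (v : K -> R) k N (G : frame -> R) : (forall k, 0 < v k) ->
  (forall w, 0 <= G w) ->
  box_mean N.+2 v (fun w => (w k == 0%N)%:R * (G w + v k * G (one_more k w))) <=
  box_mean N.+2 v G.
Proof.
move=> v0 G0; pose F w := frame_prob v w * G w.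
have F0 w : 0 <= F w by rewrite mulr_ge0 ?frame_prob_ge0.
pose set_k (a : 'I_N.+2) (w : {ffun K -> 'I_N.+2}) := [ffun j => if j == k then a else w j].
(* The box needs room for the counts [0] and [1]. *)
pose o1 : 'I_N.+2 := Ordinal (isT : (1 < N.+2)%N).
rewrite /box_mean -/F.
have -> : \sum_(w : {ffun K -> 'I_N.+2}) frame_prob v (box_frame w) *
      ((box_frame w k == 0%N)%:R * (G (box_frame w) + v k * G (one_more k (box_frame w)))) =
    \sum_(w : {ffun K -> 'I_N.+2} | w k == ord0) F (box_frame w) +
    \sum_(w : {ffun K -> 'I_N.+2} | w k == ord0) F (one_more k (box_frame w)).
  rewrite -big_split/= [RHS]big_mkcond/=; apply: eq_bigr => w _.
  rewrite ffunE -val_eqE/=; case: eqP => wk; last by rewrite mul0r mulr0.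
  rewrite /F frame_prob_one_more ?ffunE//.
  by rewrite mul1r; ring.
have -> : \sum_(w : {ffun K -> 'I_N.+2} | w k == ord0) F (one_more k (box_frame w)) =
    \sum_(w : {ffun K -> 'I_N.+2} | w k == o1) F (box_frame w).
  rewrite [RHS](reindex_onto (set_k o1) (set_k ord0))/=; last first.
    by move=> w /eqP wk; apply/ffunP => j; rewrite !ffunE; case: eqP => [->|].
  apply: eq_big => w.
    rewrite ffunE eqxx eqxx/=; apply/eqP/eqP => [wk|<-].
      by apply/ffunP => j; rewrite !ffunE; case: eqP => [->|].
    by rewrite ffunE eqxx.
  move=> /eqP wk; congr (F _); apply/ffunP => j; rewrite !ffunE.
  by case: eqP => [->|_]; rewrite ?wk ?addn0.
rewrite [leRHS](bigID (fun w : {ffun K -> 'I_N.+2} => w k == ord0))/= lerD2l.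
rewrite [leRHS](bigID (fun w : {ffun K -> 'I_N.+2} => w k == o1))/=.
rewrite ler_wpDr//; first by apply: sumr_ge0 => w _; exact: F0.
rewrite le_eqVlt; apply/orP; left; apply/eqP; apply: eq_bigl => w.
by case: (w k =P o1) => [->|]; rewrite ?andbF.
Qed.

Context {d : measure_display} {T : measurableType d}.
Variables (P : probability T R) (V : K -> {RV P >-> nat}) (v : K -> R).
Hypothesis v_gt0 : forall k, 0 < v k.
Hypothesis indepV : mutually_independent V.
Hypothesis poissonV : forall k n, P (V k @^-1` [set n]) = (poisson_pmf (v k) n)%:E.

(** If the envelope were large at one of the two frames for every frame with count [0] in
pixel [k], its mean would be large too, since that count has a positive probability
which depends on [v k] only. *)
Lemma adjacent_frames k (G : frame -> R) (B : R) : (forall w, 0 <= G w) ->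
  (\int[P]_t (G [ffun k => V k t])%:E <= B%:E)%E ->
  exists w, G w + G (one_more k w) <= (B + 1) / (poisson_pmf (v k) 0 * Num.min 1 (v k)).
Proof.
move=> G0 GB; set p := poisson_pmf (v k) 0; set m := Num.min 1 (v k).
have p0 : 0 < p.
  by rewrite /p /poisson_pmf v_gt0 expr0 fact0 invr1 !mul1r expR_gt0.
have m0 : 0 < m by rewrite lt_min ltr01 v_gt0.
set L := _ / _; apply: contrapT => /forallNP noL.
have GL w : L <= G w + G (one_more k w) by have /negP := noL w; rewrite -ltNge => /ltW.
have L0 : 0 <= B.
  rewrite -lee_fin; apply: le_trans GB; apply: integral_ge0 => t _; rewrite lee_fin; exact: G0.
have L1 : 0 < L by rewrite divr_gt0 ?mulr_gt0// ltr_pwDr.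
have box N : m * L * box_mean N.+2 v (\1_[set w : frame | w k = 0%N]) <= B.
  apply: (@le_trans _ _ (box_mean N.+2 v G)); last first.
    by rewrite -lee_fin; apply: le_trans GB; exact: box_mean_le_integral.
  apply: le_trans (box_mean_one_more k N v_gt0 G0).
  rewrite -box_meanZ; apply: le_box_mean => w; rewrite indicE.
  rewrite mulrC [in leLHS](_ : (w \in _) = (w k == 0%N)); last first.
    by apply/idP/eqP => [/set_mem//|wk]; exact: mem_set.
  rewrite ler_wpM2l// (@le_trans _ _ (m * (G w + G (one_more k w))))// ?ler_wpM2l ?(ltW m0)//.
  by rewrite mulrDr lerD// ?ler_piMl// ?ler_wpM2r// ge_min lexx ?orbT.
have lim : m * L * box_mean N v (\1_[set w : frame | w k = 0%N]) @[N --> \oo] --> m * L * p.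
  apply: cvgMl_tmp; have := @box_mean_event _ _ _ _ P V v indepV poissonV [set w : frame | w k = 0%N].
  rewrite (_ : _ @^-1` _ = V k @^-1` [set 0%N]) ?poissonV//.
  by apply/seteqP; split => t /=; rewrite ffunE.
have : m * L * p <= B.
  have cB : (fun _ : nat => B) @ \oo --> B by exact: cvg_cst.
  apply: (ler_cvg_to lim cB).
  by exists 2%N => // -[|[|N]]//= _; exact: box.
have -> : m * L * p = B + 1 by rewrite /L; field; rewrite !gt_eqF.
by rewrite gerDl ler10.
Qed.
End adjacent.

(** * Regularity of the rates from the third-derivative envelope *)

Section smooth_rates.
Context {R : realType} {n : nat} {K : finType}.
Variables (q : K -> 'rV[R]_n -> R) (b : K -> R) (U : set 'rV[R]_n) (x0 : 'rV[R]_n) (r : R).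
Hypothesis n_gt0 : (0 < n)%N.
Hypothesis r0 : 0 < r.
Hypothesis b_gt0 : forall k, 0 < b k.
Hypothesis ball_U : forall x, `|x - x0| < r -> U x.
Hypothesis q_ge0 : forall k x, `|x - x0| < r -> 0 <= q k x.
Local Notation e_ i := (@basis_vec R n i).

(** The identity that turns bounds on derivatives of log-likelihoods into bounds on
derivatives of log-rates. *)
Lemma loglik_one_more I k w x : loglik_at q b I (one_more k w) x =
  loglik_at q b I w x + ln (rate_at q b I k x).
Proof.
rewrite /loglik_at (bigD1 k)//= [in RHS](bigD1 k)//= ffunE eqxx addn1 -natr1.
rewrite (eq_bigr (fun j => (w j)%:R * ln (rate_at q b I j x) - rate_at q b I j x)); last first.
  by move=> j /negPf jk; rewrite ffunE jk addn0.
ring.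
Qed.

Lemma jet3_of_envelope I k w c c' :
  third_partials_bounded U (loglik_at q b I w) c ->
  third_partials_bounded U (loglik_at q b I (one_more k w)) c' ->
  exists h1 h2, jet3 x0 r (fun y => ln (rate_at q b I k y)) h1 h2 (c + c').
Proof.
set f := loglik_at _ _ _ w; set f' := loglik_at _ _ _ _ => Hf Hf'.
exists (fun l => partial l f' - partial l f).
exists (fun l j => partial j (partial l f') - partial j (partial l f)).
have -> : (fun y => ln (rate_at q b I k y)) = f' - f.
  by apply/funext => y /=; rewrite /f' /f [RHS]/GRing.add/= /GRing.opp/= loglik_one_more addrAC subrr add0r.
move=> x xr i j l.
have [d1 d2 d3 d4] := Hf x (ball_U xr) i j l.
have [d1' d2' d3' d4'] := Hf' x (ball_U xr) i j l.
split.
- exact: is_deriveB (derivableP d1') (derivableP d1).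
- exact: is_deriveB (derivableP d2') (derivableP d2).
- exact: derivableB.
- by rewrite deriveB// (le_trans (ler_normB _ _))// addrC lerD.
Qed.

Lemma jet3_weaken h h1 h2 c c' : c <= c' -> jet3 x0 r h h1 h2 c -> jet3 x0 r h h1 h2 c'.
Proof.
by move=> cc J x xr i j l; have [? ? ? /le_trans cj] := J x xr i j l; split => //; exact: cj.
Qed.

(** The last two clauses concern a dark pixel. There [h = ln (q + b)] is minimal at [x0], so
[nonneg_gradient_le] applies, and [h x - h x0 <= q x / b]. *)
Lemma smooth_pixel k :
  (exists h1 h2 c, jet3 x0 r (fun y => ln (rate_at q b 1 k y)) h1 h2 c) ->
  (q k x0 = 0 -> exists C : R, \forall I \near +oo, exists k1 k2,
     jet3 x0 r (fun y => ln (rate_at q b I k y)) k1 k2 (C * I)) ->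
  exists (g : 'I_n -> 'rV[R]_n -> R) (C : R), 0 <= C /\
    [/\ forall x, `|x - x0| < r -> forall l, is_derive x (e_ l) (q k) (g l x),
        forall x, `|x - x0| < r -> forall l, `|g l x - g l x0| <= C * `|x - x0|,
        forall x, `|x - x0| < r ->
          `|q k x - q k x0 - \sum_i g i x0 * (x - x0) 0 i| <= C * `|x - x0| ^+ 2,
        q k x0 = 0 -> forall i, g i x0 = 0 &
        q k x0 = 0 -> forall i x (tau : R), 0 < tau -> `|x - x0| + tau < r ->
          `|g i x| <= C * (q k x / tau + (`|x - x0| + tau) * tau)].
Proof.
move=> [h1 [h2 [c J]]] JI.
pose G := rate_at q b 1 k.
have GE y : G y = q k y + b k by rewrite /G /rate_at mul1r.
have G0 x : `|x - x0| < r -> 0 < G x by move=> xr; rewrite GE ltr_wpDl// q_ge0.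
have [C1 C10 S1] := smooth_of_ln r0 G0 J.
have [C2 C20 B] := jet3_bounded r0 J.
pose i0 := Ordinal n_gt0.
have c0 : 0 <= c := jet3_ge0 r0 i0 J.
have nc0 : 0 <= n%:R * c by rewrite mulr_ge0.
pose C3 := expR C2 * ((b k)^-1 + n%:R * c).
have bi : 0 <= (b k)^-1 by rewrite invr_ge0 ltW.
have C30 : 0 <= C3 by apply: mulr_ge0; [exact: expR_ge0 | exact: addr_ge0].
exists (fun l x => G x * h1 l x), (C1 + C3); split; first exact: addr_ge0.
split.
- move=> x xr l; have [dG _ _] := S1 x xr l.
  rewrite (_ : q k = G - cst (b k)); last first.
    by apply/funext => y; rewrite [RHS]/GRing.add/= /GRing.opp/= GE addrK.
  by apply: (is_derive_eq (is_deriveB dG (is_derive_cst _ _ _))); rewrite subr0.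
- move=> x xr l; have [_ gl _] := S1 x xr l.
  by apply: (le_trans gl); rewrite ler_wpM2r// lerDl.
- move=> x xr; have [_ _ tl] := S1 x xr i0.
  have -> : q k x - q k x0 = G x - G x0 by rewrite !GE; ring.
  by apply: (le_trans tl); rewrite ler_wpM2r ?sqr_ge0// lerDl.
- move=> q0 i; rewrite (@jet3_critical _ _ _ _ r0 _ h1 h2 c i J) ?mulr0// => y yr.
  by rewrite ler_ln ?posrE ?G0// ?subrr ?normr0// -!/(G _) !GE lerD2r q0 q_ge0.
- move=> q0 i x tau t0 xt.
  have xr : `|x - x0| < r by apply: le_lt_trans xt; rewrite lerDl ltW.
  have x0r : `|x0 - x0| < r by rewrite subrr normr0.
  have Gmin y : `|y - x0| < r -> G x0 <= G y by move=> yr; rewrite !GE lerD2r q0 q_ge0.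
  have h20 : h2 i i x0 = 0.
    have [C {}JI] := JI q0; apply: (zero_pixel_flat r0 G0 i J Gmin (C := C)).
    apply: filterS JI => I [k1 [k2 J2]]; exists k1, k2.
    rewrite (_ : (fun y => ln (I * (G y - G x0) + G x0)) = (fun y => ln (rate_at q b I k y)))//.
    by apply/funext => y; rewrite !GE q0 /rate_at; congr ln; ring.
  have hmin y : `|y - x0| < r -> ln (rate_at q b 1 k x0) <= ln (rate_at q b 1 k y).
    by move=> yr; rewrite ler_ln ?posrE; [exact: Gmin | exact: G0 | exact: G0].
  have := nonneg_gradient_le r0 J hmin h20 t0 xt.
  have hq : ln (rate_at q b 1 k x) - ln (rate_at q b 1 k x0) <= q k x / b k.
    rewrite -ln_div ?posrE -/(G _) ?G0//.
    apply: (le_trans (ln_le_sub1 _)); first by rewrite divr_gt0 ?G0.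
    rewrite -/(G _) !GE q0 add0r mulrDl divff ?addrK// gt_eqF//.
  have GX : G x <= expR C2.
    rewrite -[G x]lnK ?posrE ?G0// ler_expR; apply: (le_trans (ler_norm _)).
    by have [] := B x xr i i.
  move=> h; rewrite normrM (gtr0_norm (G0 x xr)).
  have qx := q_ge0 k xr.
  apply: (@le_trans _ _ (expR C2 * (q k x / b k / tau + n%:R * c * (`|x - x0| + tau) * tau))).
    apply: ler_pM => //; first exact: ltW (G0 x xr).
    by apply: (le_trans h); rewrite lerD2r ler_wpM2r ?invr_ge0 ?(ltW t0).
  have T0 : 0 <= q k x / tau by rewrite divr_ge0// ltW.
  have T1 : 0 <= (`|x - x0| + tau) * tau.
    by apply: mulr_ge0; [apply: addr_ge0 => //; exact: ltW | exact: ltW].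
  apply: (@le_trans _ _ (C3 * (q k x / tau + (`|x - x0| + tau) * tau))); last first.
    by apply: ler_wpM2r; [exact: addr_ge0 | rewrite lerDr].
  rewrite /C3 -(mulrA (expR C2)) ler_wpM2l ?expR_ge0//.
  rewrite -(mulrA (n%:R * c)) (mulrAC (q k x)) (mulrDl (b k)^-1).
  by apply: lerD; [rewrite mulrC ler_wpM2l// lerDl | rewrite ler_wpM2l// lerDr].
Qed.

Lemma smooth_rates :
  (forall k, exists h1 h2 c, jet3 x0 r (fun y => ln (rate_at q b 1 k y)) h1 h2 c) ->
  (forall k, q k x0 = 0 -> exists C : R, \forall I \near +oo, exists k1 k2,
     jet3 x0 r (fun y => ln (rate_at q b I k y)) k1 k2 (C * I)) ->
  exists (g : K -> 'I_n -> 'rV[R]_n -> R) (C : R), 0 <= C /\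
    [/\ forall k x, `|x - x0| < r -> forall l, is_derive x (e_ l) (q k) (g k l x),
        forall k x, `|x - x0| < r -> forall l, `|g k l x - g k l x0| <= C * `|x - x0|,
        forall k x, `|x - x0| < r ->
          `|q k x - q k x0 - \sum_i g k i x0 * (x - x0) 0 i| <= C * `|x - x0| ^+ 2,
        forall k, q k x0 = 0 -> forall i, g k i x0 = 0 &
        forall k, q k x0 = 0 -> forall i x (tau : R), 0 < tau -> `|x - x0| + tau < r ->
          `|g k i x| <= C * (q k x / tau + (`|x - x0| + tau) * tau)].
Proof.
move=> J JI; have /fin_all_exists[g] := fun k => smooth_pixel (J k) (JI k).
move=> /fin_all_exists[C H].
have CS k : C k <= \sum_j C j.
  by rewrite (bigD1 k)//= lerDl sumr_ge0// => j _; have [] := H j.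
exists g, (\sum_k C k); split; first by rewrite sumr_ge0// => j _; have [] := H j.
split=> k; have [Ck0 [H1 H2 H3 H4 H5]] := H k => //.
- move=> x xr l; apply: (le_trans (H2 x xr l)); by rewrite ler_wpM2r.
- move=> x xr; apply: (le_trans (H3 x xr)); by rewrite ler_wpM2r ?sqr_ge0.
- move=> q0 i x tau t0 xt; apply: (le_trans (H5 q0 i x tau t0 xt)); rewrite ler_wpM2r//.
  have xr : `|x - x0| < r by apply: le_lt_trans xt; rewrite lerDl ltW.
  apply: addr_ge0; first by rewrite divr_ge0 ?q_ge0// ltW.
  by apply: mulr_ge0; [apply: addr_ge0 => //; exact: ltW | exact: ltW].
Qed.
End smooth_rates.

(** * The imaging model: continuity and identifiability *)

Section enorm_sup.
Context {R : realType} {n : nat}.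
Implicit Types x : 'rV[R]_n.

Lemma norm_le_enorm x : `|x| <= enorm x.
Proof.
apply: rV_norm_le => [|j]; first exact: sqrtr_ge0.
by rewrite -sqrtr_sqr ler_wsqrtr// coord_sqr_le.
Qed.

Lemma enorm_le_norm x : enorm x <= Num.sqrt n%:R * `|x|.
Proof.
rewrite -[X in _ * X]ger0_norm// -sqrtr_sqr -sqrtrM// ler_wsqrtr//.
rewrite mulr_natl -[X in _ *+ X]card_ord -sumr_const; apply: ler_sum => j _.
by rewrite -[leLHS]real_normK ?num_real// lerXn2r ?nnegrE// rV_coord_le.
Qed.
End enorm_sup.

Section model.
Context {R : realType} {d M Kx Ky : nat} (S : imaging R d M Kx Ky).
Local Notation pixel := ('I_Kx * 'I_Ky)%type.
Local Notation param := 'rV[R]_(M * d).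
Local Notation frame := {ffun pixel -> nat}.
Hypothesis axS : imaging_axioms S.

Definition signal k (theta : param) : R := dt S * dx S * dy S * Q S k theta.

Let scale_gt0 : 0 < dt S * dx S * dy S.
Proof. by case: axS => *; rewrite !mulr_gt0. Qed.

Lemma rate_signal I k theta : rate S I k theta = rate_at signal (noise S) I k theta.
Proof. by rewrite /rate /rate_at /signal; ring. Qed.

Lemma loglik_signal I w : loglik S I w = loglik_at signal (noise S) I w.
Proof. by apply/funext => x; apply: eq_bigr => k _; rewrite rate_signal. Qed.

Lemma signal_ge0 k theta : Theta S theta -> 0 <= signal k theta.
Proof.
move=> [fov _]; rewrite mulr_ge0 ?(ltW scale_gt0)//.
case: axS => dx0 dy0 _ _ _ w0 _ psf_ _.
apply: sumr_ge0 => m _; rewrite mulr_ge0 ?(ltW (w0 m))//.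
rewrite /pixel_psf mulr_ge0 ?invr_ge0 ?mulr_ge0 ?(ltW dx0) ?(ltW dy0)//.
have [_ psf0 _] := psf_ m _ (fov m).
by apply: fine_ge0; apply: integral_ge0 => u _; rewrite lee_fin.
Qed.

Lemma position_relabel s m (theta : param) :
  position m (relabel s theta) = position (s m) theta.
Proof. by rewrite /position /relabel mxvecK; apply/rowP => j; rewrite !mxE. Qed.

Lemma relabel_Theta s theta : Theta S theta -> Theta S (relabel s theta).
Proof.
move=> [fov far]; split=> [m|m m' mm']; rewrite !position_relabel//.
by apply: far; rewrite (inj_eq perm_inj).
Qed.

Lemma relabelK s (theta : param) : relabel s (relabel s^-1 theta) = theta.
Proof. by rewrite /relabel mxvecK -row_permM mulgV row_perm1 vec_mxK. Qed.

Lemma relabelVK s (theta : param) : relabel s^-1 (relabel s theta) = theta.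
Proof. by rewrite /relabel mxvecK -row_permM mulVg row_perm1 vec_mxK. Qed.

Lemma relabelB s (x y : param) : relabel s (x - y) = relabel s x - relabel s y.
Proof. by rewrite /relabel !linearB. Qed.

(** In the sup norm a permutation of coordinates is harmless. *)
Lemma relabel_norm s (x : param) : `|relabel s x| <= `|x|.
Proof.
apply: rV_norm_le => // j; case/mxvec_indexP: j => i l.
by rewrite /relabel mxvecE !mxE rV_coord_le.
Qed.

Lemma undetectableV s : undetectable S s -> undetectable S s^-1.
Proof. by move=> us k theta /(relabel_Theta s^-1) /(us k); rewrite relabelK. Qed.

(** A single term of the quadratic-mean sum already bounds the variation of the square
root of the probability of one frame. *)
Lemma frame_pmf_cvg I theta w : diff_quadratic_mean S I -> Theta S theta ->
  frame_pmf S I y w @[y --> within (Theta S) (nbhs theta)] --> frame_pmf S I theta w.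
Proof.
move=> dqm Tt; have [sc /(_ 1 ltr01) near1] := dqm theta Tt.
pose p y := frame_pmf S I y w.
have p0 y : 0 <= p y by apply: prodr_ge0 => k _; exact: poisson_pmf_ge0.
suff : Num.sqrt (p y) @[y --> within (Theta S) (nbhs theta)] --> Num.sqrt (p theta).
  move=> h; rewrite -[frame_pmf S I theta w](sqr_sqrtr (p0 _)) expr2.
  rewrite (_ : (fun y => frame_pmf S I y w) = (fun y => Num.sqrt (p y) * Num.sqrt (p y))).
    exact: cvgM.
  by apply/funext => y; rewrite -expr2 sqr_sqrtr.
pose t := Num.sqrt (p theta); have t0 : 0 <= t by exact: sqrtr_ge0.
pose N := Num.sqrt (M * d)%:R + \sum_j `|sc w 0 j| * t.
have N0 : 0 <= N.
  by apply: addr_ge0; [exact: sqrtr_ge0 | apply: sumr_ge0 => j _; exact: mulr_ge0].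
apply/cvgrPdist_le => eps eps0; rewrite near_withinE; near=> y => Ty.
have /(_ Ty) esum_y : Theta S y -> (\esum_(w in [set: frame])
       ((Num.sqrt (frame_pmf S I y w) - Num.sqrt (frame_pmf S I theta w)
         - 2^-1 * ((y - theta) *m (sc w)^T) 0 0
             * Num.sqrt (frame_pmf S I theta w)) ^+ 2)%:E
     <= (1 * enorm (y - theta) ^+ 2)%:E)%E by near: y.
have yN : `|y - theta| < eps / (1 + N).
  by rewrite distrC; near: y; apply: cvgr_dist_lt => //; rewrite divr_gt0// ltr_pwDl.
set D := (y - theta) *m (sc w)^T in esum_y.
have : (Num.sqrt (p y) - Num.sqrt (p theta) - 2^-1 * D 0 0 * Num.sqrt (p theta)) ^+ 2 <=
    enorm (y - theta) ^+ 2.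
  rewrite -lee_fin -[in leRHS](mul1r (enorm _ ^+ 2)); apply: le_trans esum_y.
  by apply: esum_ge; exists [set w] => //; rewrite fsbig_set1.
rewrite -[leLHS]real_normK ?num_real// ler_pXn2r ?nnegrE ?sqrtr_ge0// => h1.
have D1 : `|D 0 0| <= `|y - theta| * \sum_j `|sc w 0 j|.
  rewrite /D mxE (le_trans (ler_norm_sum _ _ _))// mulr_sumr; apply: ler_sum => j _.
  by rewrite normrM [(sc w)^T _ _]mxE ler_wpM2r// rV_coord_le.
rewrite distrC -/t; rewrite -/t in h1.
apply: (@le_trans _ _ (`|y - theta| * N)); last first.
  rewrite (le_trans (ler_wpM2r N0 (ltW yN)))// mulrAC ler_pdivrMr ?ltr_pwDl//.
  by rewrite ler_wpM2l ?(ltW eps0)// lerDr.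
rewrite -[X in `|X|](subrK (2^-1 * D 0 0 * t)) (le_trans (ler_normD _ _))// mulrDr lerD//.
  by rewrite (le_trans h1)// mulrC enorm_le_norm.
rewrite -mulr_suml mulrA normrM (ger0_norm t0) ler_wpM2r// normrM.
rewrite (le_trans _ D1)// ler_piMl// ger0_norm// invf_le1// ler1n.
Unshelve. all: by end_near. Qed.

(** A rate is a ratio of probabilities of two frames; this recovers the continuity of the
rates from that of the probabilities. *)
Lemma frame_pmf_one_more I k theta (w : frame) : (forall k, 0 < rate S I k theta) ->
  w k = 0%N -> rate S I k theta = frame_pmf S I theta (one_more k w) / frame_pmf S I theta w.
Proof.
move=> v0 wk.
have p0 : 0 < frame_pmf S I theta w.
  apply: prodr_gt0 => j _; rewrite /poisson_pmf v0.
  by rewrite !mulr_gt0 ?exprn_gt0 ?invr_gt0 ?ltr0n ?fact_gt0 ?expR_gt0.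
rewrite [frame_pmf _ _ _ (one_more k w)](frame_prob_one_more (v := fun k => rate S I k theta))//.
by rewrite mulfK// gt_eqF.
Qed.

Lemma rate_gt0_Theta I k theta : 0 < I -> Theta S theta -> 0 < rate S I k theta.
Proof.
move=> I0 Tt; rewrite rate_signal; apply: ltr_wpDl; last by case: axS.
by apply: mulr_ge0; [exact: ltW | exact: signal_ge0].
Qed.

Lemma rate_cvg I k theta : 0 < I ->
  (forall k, Ck_on 3 (Theta S) (rate S I k)) \/ diff_quadratic_mean S I -> Theta S theta ->
  rate S I k y @[y --> within (Theta S) (nbhs theta)] --> rate S I k theta.
Proof.
move=> I0 [/(_ k)[U [g [oU TU [gc _] gE]]]|dqm] Tt.
  rewrite -gE ?inE//; apply: (@cvg_trans _ (g @ within (Theta S) (nbhs theta))).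
    apply: near_eq_cvg; rewrite near_withinE; near=> y => Ty; by rewrite gE ?inE.
  by apply: cvg_within_filter; apply: gc; exact: TU.
pose w : frame := [ffun=> 0%N].
have pos y : Theta S y -> forall k, 0 < rate S I k y by move=> Ty j; exact: rate_gt0_Theta.
have wk : w k = 0%N by rewrite ffunE.
rewrite (frame_pmf_one_more (pos theta Tt) wk).
apply: (@cvg_trans _ ((fun y => frame_pmf S I y (one_more k w) / frame_pmf S I y w)
    @ within (Theta S) (nbhs theta))).
  apply: near_eq_cvg; rewrite near_withinE; near=> y => Ty.
  by rewrite -frame_pmf_one_more//; exact: pos.
apply: cvgM; first exact: frame_pmf_cvg.
apply: cvgV; last exact: frame_pmf_cvg.
rewrite gt_eqF//; apply: prodr_gt0 => j _; rewrite /poisson_pmf (pos _ Tt).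
by rewrite !mulr_gt0 ?exprn_gt0 ?invr_gt0 ?ltr0n ?fact_gt0 ?expR_gt0 ?(pos _ Tt).
Unshelve. all: by end_near. Qed.

Variable theta0 : param.
Hypothesis compact_Theta : compact (Theta S).
Hypothesis smooth_model : (forall k, Ck_on 3 (Theta S) (rate S 1 k)) \/ diff_quadratic_mean S 1.
Hypothesis ident : identifiable_up_to_relabeling S theta0.

Lemma signal_cvg k theta : Theta S theta ->
  signal k y @[y --> within (Theta S) (nbhs theta)] --> signal k theta.
Proof.
move=> Tt; have E y : signal k y = rate S 1 k y - noise S k.
  by rewrite rate_signal /rate_at mul1r addrK.
rewrite E (_ : signal k = fun y => rate S 1 k y - noise S k); last exact/funext.
by apply: cvgB; [exact: rate_cvg | exact: cvg_cst].
Qed.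

(** By compactness it is enough to argue near each point [x] of the parameter space. Either
some signal tells [x] from the truth, and does so nearby; or [x] is an undetectable
relabeling of the truth, and a correctly labeled point near [x] is no farther from
the truth than its image under the inverse relabeling, which is near the truth. *)
Lemma uniformly_identifiable (rho : R) : 0 < rho -> exists2 eta : R, 0 < eta &
  forall x, Theta S x -> correctly_labeled S theta0 x ->
  (forall k, `|signal k x - signal k theta0| <= eta) -> `|x - theta0| < rho.
Proof.
move=> rho0.
pose P (eta : R) (x : param) := Theta S x -> correctly_labeled S theta0 x ->
  (forall k, `|signal k x - signal k theta0| <= eta) -> `|x - theta0| < rho.
have [near_cov _] := compact_near_coveringP (Theta S).
have := near_cov compact_Theta R (0 : R)^'+ P _; case=> [x Tx|e /= e0 He]; last first.
  (* The covering gives every tolerance in a right neighbourhood of [0]. *)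
  exists (e / 2); first by rewrite divr_gt0.
  move=> x Tx Lx; apply: (He (e / 2)) => //=; last by rewrite divr_gt0.
  by rewrite sub0r normrN gtr0_norm ?divr_gt0// ltr_pdivrMr// ltr_pMr// ltr1n.
have [[k qk]|same] := pselect (exists k, signal k x != signal k theta0).
  pose a := `|signal k x - signal k theta0|.
  have a0 : 0 < a by rewrite normr_gt0 subr_eq0.
  have a3 : 0 < a / 3 by rewrite divr_gt0.
  have := @signal_cvg k x Tx => /cvgrPdist_le /(_ _ a3); rewrite near_withinE => ny.
  exists ([set y | Theta S y -> `|signal k x - signal k y| <= a / 3], [set e | e <= a / 3]).
    by split => //=; exact: nbhs_right_le.
  move=> [y e] /= [h1 h2] Ty _ /(_ k) ek; exfalso; move: h1 => /(_ Ty) h1.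
  have : `|signal k x - signal k theta0| <= a / 3 + a / 3.
    rewrite -(subrKA (signal k y)) (le_trans (ler_normD _ _))// lerD//.
    exact: le_trans ek h2.
  rewrite -/a; move: a0; clearbody a; lra.
have [|s us xE] := ident Tx.
  move=> k; apply: contrapT => /eqP nQ; apply: same; exists k.
  by apply: contra nQ => /eqP/(mulfI (lt0r_neq0 scale_gt0)) ->.
pose N : R := Num.sqrt (M * d)%:R.
have N0 : 0 <= N by exact: sqrtr_ge0.
exists ([set y | `|x - y| < rho / (1 + N)], setT).
  split => //=; last exact: filterT.
  near=> y; near: y; apply: cvgr_dist_lt => //; by rewrite divr_gt0// ltr_pwDl.
move=> [y e] /= [yx _] Ty Ly _; rewrite distrC in yx.
apply: (le_lt_trans (norm_le_enorm _)); apply: (le_lt_trans (Ly _ (undetectableV us))).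
have -> : relabel s^-1 y - theta0 = relabel s^-1 (y - x).
  by rewrite relabelB [in RHS]xE relabelVK.
apply: (le_lt_trans (enorm_le_norm _)); rewrite -/N.
apply: (@le_lt_trans _ _ (N * `|y - x|)); first by rewrite ler_wpM2l// relabel_norm.
apply: (@le_lt_trans _ _ ((1 + N) * `|y - x|)); first by rewrite ler_wpM2r// lerDr.
by rewrite mulrC -ltr_pdivlMr// ltr_pwDl.
Unshelve. all: by end_near. Qed.
End model.

(** * Limit law of an estimator with a linearized score *)

Section estimator.
Context {R : realType} {n : nat} {K : finType}.
Variables (q b : K -> R) (g : K -> 'rV[R]_n) (x0 : 'rV[R]_n).
Hypothesis q_ge0 : forall k, 0 <= q k.
Hypothesis b_gt0 : forall k, 0 < b k.
Hypothesis flat : forall k, q k = 0 -> g k = 0.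
Hypothesis info_pd : forall I, 0 < I -> posdefmx (info q b g I).
Local Notation frame := {ffun K -> nat}.
Local Notation v := (fun I k => I * q k + b k).
Variable max : R -> frame -> 'rV[R]_n -> Prop.
Hypothesis linearized : forall A eps : R, 0 <= A -> 0 < eps -> \forall sg \near +oo,
  forall (w : frame) x, (forall k, `|dev v (sg ^+ 2) k w| <= A) -> max (sg ^+ 2) w x ->
  forall i, `|\sum_k ((w k)%:R - v (sg ^+ 2) k - sg ^+ 2 * \sum_j g k 0 j * (x - x0) 0 j) *
       (sg ^+ 2 * g k 0 i / v (sg ^+ 2) k)| <= eps * sg.

(** The deterministic estimates are stated in terms of [sg = sqrt I], which avoids square
roots of the intensity in them. *)
Lemma near_sqrt (Q : R -> Prop) : (\forall s \near +oo, Q s) ->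
  \forall I \near +oo, Q (Num.sqrt I).
Proof.
move=> [m [_ Hm]]; near=> I; apply: Hm.
apply: (le_lt_trans (ler_norm m)); rewrite -sqrtr_sqr ltr_sqrt.
  by near: I; apply: nbhs_pinfty_gt; rewrite num_real.
by near: I; apply: nbhs_pinfty_gt; rewrite num_real.
Unshelve. all: by end_near. Qed.

(** The normalized error and the score have the same limit law because they differ by at
most [eta] on typical frames. *)
Lemma estimator_score (A eta : R) : 0 <= A -> 0 < eta -> \forall I \near +oo,
  forall (w : frame) x, (forall k, `|dev v I k w| <= A) -> max I w x ->
  forall i, `|score v (whitened q b g) I w i - ((x - x0) *m sqrtmx (info q b g I)) 0 i| <= eta.
Proof.
move=> A0 eta0; have [eps eps0 small] := whitened_small q_ge0 b_gt0 info_pd eta0.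
have lin := near_sqrt (linearized A0 eps0).
near=> I => w x tw mx i.
have I1 : 1 <= I by near: I; apply: nbhs_pinfty_ge; rewrite num_real.
have I0 : 0 < I by exact: lt_le_trans I1.
pose rho : 'rV[R]_n := \row_i \sum_k ((w k)%:R - v I k - I * \sum_j g k 0 j * (x - x0) 0 j) *
     (I * g k 0 i / v I k).
rewrite (whitened_error (x := x - x0) (rho := rho) q_ge0 b_gt0 info_pd I0); last first.
  by move=> j; rewrite mxE.
rewrite addrAC subrr add0r; apply: small => // j; rewrite mxE.
have /(_ w x) : forall (w : frame) x, (forall k, `|dev v (Num.sqrt I ^+ 2) k w| <= A) ->
  max (Num.sqrt I ^+ 2) w x ->
  forall i, `|\sum_k ((w k)%:R - v (Num.sqrt I ^+ 2) k -
       Num.sqrt I ^+ 2 * \sum_j g k 0 j * (x - x0) 0 j) *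
       (Num.sqrt I ^+ 2 * g k 0 i / v (Num.sqrt I ^+ 2) k)| <= eps * Num.sqrt I by near: I.
by rewrite sqr_sqrtr ?(ltW I0)//; apply.
Unshelve. all: by end_near. Qed.

Variables (p : R -> set frame -> R) (est : R -> frame -> 'rV[R]_n).
Hypothesis p_lim : forall I C, 0 < I ->
  box_mean N (v I) (\1_C) @[N --> \oo] --> p I C.
Hypothesis est_max : forall I w, 0 < I -> max I w (est I w).

Lemma estimator_clt (x : 'rV[R]_n) :
  p I [set w | forall i, ((est I w - x0) *m sqrtmx (info q b g I)) 0 i <= x 0 i] @[I --> +oo]
  --> std_normal_cdf x.
Proof.
have v_gt0 I k : 0 < I -> 0 < v I k by move=> I0; rewrite ltr_wpDl// mulr_ge0// ltW.
apply: (score_clt (v := v) (O := whitened q b g) v_gt0 _ _ p_lim (x := fun i => x 0 i)).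
- exact: whitened_orth.
- exact: whitened_or.
- move=> eta A eta0 A0; have es := estimator_score (ltW A0) eta0.
  near=> I => w tw /= Bw i; have I0 : 0 < I by near: I; exact: nbhs_pinfty_gt.
  have := Bw i; have : `|score v (whitened q b g) I w i -
    ((est I w - x0) *m sqrtmx (info q b g I)) 0 i| <= eta.
    by move: i {Bw}; apply: (near es I) => //; exact: est_max.
  by rewrite ler_norml => /andP[_]; lra.
- move=> eta A eta0 A0; have es := estimator_score (ltW A0) eta0.
  near=> I => w tw /= Bw i; have I0 : 0 < I by near: I; exact: nbhs_pinfty_gt.
  have := Bw i; have : `|score v (whitened q b g) I w i -
    ((est I w - x0) *m sqrtmx (info q b g I)) 0 i| <= eta.
    by move: i {Bw}; apply: (near es I) => //; exact: est_max.
  by rewrite ler_norml => /andP[+ _]; lra.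
Unshelve. all: by end_near. Qed.
End estimator.

(** * Growth of the information and asymptotic normality *)

Theorem theorem2 (R : realType) (d M Kx Ky : nat) (S : imaging R d M Kx Ky)
    (theta0 : 'rV[R]_(M * d))
    (disp : measure_display) (T : R -> measurableType disp)
    (P : forall I : R, probability (T I) R)
    (V : forall I : R, 'I_Kx * 'I_Ky -> {RV (P I) >-> nat})
    (thetahat : R -> {ffun 'I_Kx * 'I_Ky -> nat} -> 'rV[R]_(M * d)) :
  (d = 2 \/ d = 3)%N -> (0 < M)%N ->
  imaging_axioms S ->
  (* frames drawn at theta0 with average intensity I *)
  (forall I : R, 0 < I -> mutually_independent (V I)) ->
  (forall (I : R) k (n : nat), 0 < I ->
     P I (V I k @^-1` [set n]) = (poisson_pmf (rate S I k theta0) n)%:E) ->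
  (* (C1) *)
  compact (Theta S) -> interior (Theta S) theta0 ->
  (* (C2) *)
  (forall I : R, 0 < I -> exists2 vmin : R, 0 < vmin &
     forall k theta, Theta S theta -> vmin <= rate S I k theta) ->
  (forall I : R, 0 < I ->
     (forall k, Ck_on 3 (Theta S) (rate S I k)) \/ diff_quadratic_mean S I) ->
  (* (C3) *)
  (forall I : R, 0 < I -> posdefmx (fisher S theta0 I)) ->
  (* (C4) *)
  (exists U : set 'rV[R]_(M * d),
   exists G : R -> {ffun 'I_Kx * 'I_Ky -> nat} -> R,
   exists C : R,
   [/\ nbhs theta0 U,
       forall I : R, 0 < I ->
         (P I).-integrable setT
           (fun t => (G I (observed_frame (fun k => V I k) t))%:E),
       forall (I : R) w, 0 < I ->
         third_partials_bounded U (loglik S I w) (G I w) &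
       \forall I \near +oo,
         (\int[P I]_t (G I (observed_frame (fun k => V I k) t))%:E
          <= (C * I)%:E)%E]) ->
  (* labels are the only ambiguity, and they are known *)
  identifiable_up_to_relabeling S theta0 ->
  (forall (I : R) w, 0 < I ->
     is_gml S I w (thetahat I w) /\
     correctly_labeled S theta0 (thetahat I w)) ->
  [/\ forall I : R, 0 < I -> posdefmx (fisher S theta0 I),
      lambda_min (fisher S theta0 I) @[I --> +oo] --> +oo,
      invmx (fisher S theta0 I) @[I --> +oo] --> (0 : 'M[R]_(M * d)) &
      cvg_in_distribution P
        (fun I t =>
           (thetahat I (observed_frame (fun k => V I k) t) - theta0)
             *m sqrtmx (fisher S theta0 I))
        (@std_normal_cdf R (M * d))].
Proof.
move=> d23 M0 axS indepV poissonV compT intT _ smooth pdF.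
move=> [U [G [C [nbU _ env intG]]]] ident gml.
have n0 : (0 < M * d)%N by rewrite muln_gt0 M0; case: d23 => ->.
(* An index is needed for the envelope, as a bound of absolute values, to be nonnegative. *)
pose i0 : 'I_(M * d) := Ordinal n0.
pose q := signal S; pose b := noise S.
have b0 k : 0 < b k by case: axS.
have [r r0 ballr] : exists2 r : R, 0 < r & forall x, `|x - theta0| < r -> U x /\ Theta S x.
  have /nbhs_ballP[r /= r0 Hr] : \forall x \near theta0, U x /\ Theta S x by exact: filterI.
  by exists r => // x xr; apply: Hr; rewrite -ball_normE /= distrC.
have ball_U x (xr : `|x - theta0| < r) : U x by have [] := ballr x xr.
have ball_T x (xr : `|x - theta0| < r) : Theta S x by have [] := ballr x xr.
have T0 : Theta S theta0 by apply: ball_T; rewrite subrr normr0.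
have q0 k x : Theta S x -> 0 <= q k x by exact: signal_ge0.
have envq I w : 0 < I -> third_partials_bounded U (loglik_at q b I w) (G I w).
  by move=> I0; have := env I w I0; rewrite loglik_signal.
have G0 I w : 0 < I -> 0 <= G I w.
  move=> I0; have [_ _ _ h] := env I w I0 theta0 (nbhs_singleton nbU) i0 i0 i0.
  exact: le_trans h.
have v0 I : 0 < I -> forall k, 0 < rate S I k theta0.
  by move=> I0 k; exact: rate_gt0_Theta.
have [g [C1 [C10 [dq glip qtay flat0 flat]]]] : exists (g : 'I_Kx * 'I_Ky -> 'I_(M * d) -> 'rV[R]_(M * d) -> R) (C : R), 0 <= C /\
    [/\ forall k x, `|x - theta0| < r -> forall l, is_derive x (basis_vec l) (q k) (g k l x),
        forall k x, `|x - theta0| < r -> forall l, `|g k l x - g k l theta0| <= C * `|x - theta0|,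
        forall k x, `|x - theta0| < r ->
          `|q k x - q k theta0 - \sum_i g k i theta0 * (x - theta0) 0 i| <= C * `|x - theta0| ^+ 2,
        forall k, q k theta0 = 0 -> forall i, g k i theta0 = 0 &
        forall k, q k theta0 = 0 -> forall i x (tau : R), 0 < tau -> `|x - theta0| + tau < r ->
          `|g k i x| <= C * (q k x / tau + (`|x - theta0| + tau) * tau)].
  apply: (@smooth_rates _ _ _ q b theta0 r) => //; first by move=> k x xr; exact/q0/ball_T.
    move=> k; have [h1 [h2 J]] := jet3_of_envelope (k := k) ball_U (envq 1 [ffun=> 0%N] ltr01) (envq 1 _ ltr01).
    by exists h1, h2; eexists; exact: J.
  move=> k qk; pose m := poisson_pmf (b k) 0 * Num.min 1 (b k).
  have m0 : 0 < m.
    by rewrite mulr_gt0 ?lt_min ?ltr01 ?b0// /poisson_pmf b0 expr0 fact0 invr1 !mul1r expR_gt0.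
  exists ((`|C| + 1) / m); near=> I.
  have I1 : 1 <= I by near: I; apply: nbhs_pinfty_ge; rewrite num_real.
  have I0 : 0 < I by exact: lt_le_trans I1.
  have GI : (\int[P I]_t (G I (observed_frame (fun k => V I k) t))%:E <= (C * I)%:E)%E.
    by near: I.
  have vk : rate S I k theta0 = b k by rewrite rate_signal // /rate_at -/(q k) qk mulr0 add0r.
  have [w] := adjacent_frames (v0 I I0) (indepV I I0) (fun k n => poissonV I k n I0) k
    (fun w => G0 I w I0) GI.
  rewrite vk -/m => hw.
  have [h1 [h2 J]] := jet3_of_envelope ball_U (envq I w I0) (envq I (one_more k w) I0).
  exists h1, h2; apply: jet3_weaken J; apply: (le_trans hw).
  rewrite mulrAC ler_pM2r ?invr_gt0// mulrDl mul1r lerD//.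
  by rewrite ler_wpM2r ?ler_norm// ltW.
pose g0 k : 'rV[R]_(M * d) := \row_i g k i theta0.
pose q_ k := q k theta0.
have q_0 k : 0 <= q_ k by exact: q0.
have flat_ k : q_ k = 0 -> g0 k = 0.
  by move=> qk; apply/rowP => i; rewrite !mxE flat0.
have fisherE I : fisher S theta0 I = info q_ b g0 I.
  apply: eq_bigr => k _; rewrite rate_signal// -/q -/b.
  suff -> : grad (rate S I k) theta0 = I *: g0 k by [].
  apply/rowP => i; rewrite !mxE /partial.
  have rE : rate S I k = (fun y => b k + I * q k y).
    by apply/funext => y; rewrite rate_signal// addrC.
  have th0r : `|theta0 - theta0| < r by rewrite subrr normr0.
  rewrite rE; have [_] := is_derive_comp_dir (is_derive1_affine (q k theta0) I (b k)) (dq k theta0 th0r i).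
  by [].
have pd I : 0 < I -> posdefmx (info q_ b g0 I) by rewrite -fisherE; exact: pdF.
split => //.
- by under eq_fun do rewrite fisherE; exact: lambda_min_info.
- by under eq_fun do rewrite fisherE; exact: invmx_info.
move=> x _.
pose obs I := observed_frame (fun k => V I k).
pose p I C' := fine (P I (obs I @^-1` C')).
have p_lim I C' : 0 < I ->
    box_mean N (fun k => I * q_ k + b k) (\1_C') @[N --> \oo] --> p I C'.
  move=> I0; rewrite (_ : (fun k => _) = (fun k => rate S I k theta0)); last first.
    by apply/funext => k; rewrite rate_signal.
  exact: (@box_mean_event _ _ _ _ (P I) (V I) _ (indepV I I0) (fun k n => poissonV I k n I0)).
pose mx I w y := maximizer q b (Theta S) (correctly_labeled S theta0) I w y.
have est_max I w : 0 < I -> mx I w (thetahat I w).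
  move=> I0; have [[Th_ opt] lab] := gml I w I0; split => // y Ty.
  by rewrite -loglik_signal//; exact: opt.
have [c c0 separate] := gradients_separate q_0 b0 pd.
have g0E k (y : 'rV[R]_(M * d)) :
    \sum_i g0 k 0 i * y 0 i = \sum_i g k i theta0 * y 0 i.
  by apply: eq_bigr => i _; rewrite mxE.
have sepq (y : 'rV[R]_(M * d)) : `|y| <= c * \sum_k `|\sum_i g k i theta0 * y 0 i|.
  by have := separate y; under eq_bigr do rewrite g0E.
have lim := estimator_clt q_0 b0 flat_ pd (max := mx) (x0 := theta0) _ p_lim est_max.
apply: (@cvg_trans _ ((fun I => (p I [set w | forall i,
    ((thetahat I w - theta0) *m sqrtmx (info q_ b g0 I)) 0 i <= x 0 i])%:E) @ +oo)).
  apply: near_eq_cvg; near=> I; rewrite -fisherE fineK// fin_num_measure//.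
  exact: measurable_frame_event.
apply/cvg_EFin; first by near=> I.
apply: lim => A eps A0 eps0.
apply: filterS (linearized_score r0 C10 c0 b0 ball_T q0 dq glip qtay flat0 flat sepq
    (uniformly_identifiable axS compT (smooth 1 ltr01) ident) A0 eps0).
move=> sg lin w y tw mw i.
by under eq_bigr do rewrite g0E [g0 _ _ _]mxE; exact: lin.
Unshelve. all: by end_near. Qed.
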